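(* Consider learning $\mathrm{FO}^k$ queries over $(\mathbb{Q},<)$: given finite sets $\mathit{P}$ and $\mathit{N}$ of $k$-tuples of rational numbers and a regular tree grammar $\mathcal{G}$ over syntax trees of $\mathrm{FO}^k$ formulas over the signature $\{<\}$, synthesize a formula $\varphi(\overline{x})\in L(\mathcal{G})$ such that $(\mathbb{Q},<),t\models\varphi(\overline{x})$ for every $t\in\mathit{P}$ and $(\mathbb{Q},<),t\not\models\varphi(\overline{x})$ for every $t\in\mathit{N}$, or declare none exists. This problem is decidable in time $\mathcal{O}(2^{\mathrm{poly}(mk^k)}\cdot|\mathcal{G}|)$, where $m=|\mathit{P}|+|\mathit{N}|$.
   Context: $\mathrm{FO}^k$ denotes first-order formulas using only a fixed set of $k$ variables $\overline{x}=(x_1,\dots,x_k)$, built from atoms $x<y$ and $x=y$ (for variables $x,y$), Boolean connectives $\wedge,\vee,\neg$, and quantifiers $\forall x,\exists x$; they are represented as syntax trees over the ranked alphabet with unary symbols $\forall x,\exists x$, nullary atoms, and Boolean symbols. A tuple $t\in\mathbb{Q}^k$ is treated as the assignment of its components to $x_1,\dots,x_k$. $L(\mathcal{G})$ is the tree language of the regular tree grammar $\mathcal{G}$ and $|\mathcal{G}|$ its size. *)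

(* Defs.v *)
From HB Require Import structures.
From Stdlib Require Import Relation_Operators.
From mathcomp Require Import all_boot all_order all_algebra.

Set Implicit Arguments.
Unset Strict Implicit.
Unset Printing Implicit Defensive.

(** * Syntax trees of FO^k formulas and their semantics over (Q, <) *)

Inductive atom (k : nat) : Type :=
  | Lt of 'I_k & 'I_k
  | Eq of 'I_k & 'I_k.

Inductive unop (k : nat) : Type :=
  | Not
  | All of 'I_k
  | Ex of 'I_k.

Inductive binop : Type := And | Or.

Arguments Not {k}.

(* Trees over the ranked alphabet of FO^k, with additional leaves labelled by
   elements of X (the nonterminals, in the right-hand sides of a grammar). *)
Inductive tree (k : nat) (X : Type) : Type :=
  | Leaf of X
  | Atom of atom k
  | Un of unop k & tree k X
  | Bin of binop & tree k X & tree k X.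

Arguments Leaf {k X}.
Arguments Atom {k X}.
Arguments Un {k X}.
Arguments Bin {k X}.

Definition formula (k : nat) : Type := tree k void.

Lemma tree_comparable (k : nat) (X : eqType) : comparable (tree k X).
Proof.
rewrite /comparable /decidable; decide equality; try exact: eq_comparable;
  decide equality; exact: eq_comparable.
Qed.

HB.instance Definition _ (k : nat) (X : eqType) :=
  hasDecEq.Build (tree k X) (compareP (@tree_comparable k X)).

Fixpoint tree_map (k : nat) (X Y : Type) (f : X -> Y) (t : tree k X) :
    tree k Y :=
  match t with
  | Leaf x => Leaf (f x)
  | Atom a => Atom a
  | Un u t1 => Un u (tree_map f t1)
  | Bin b t1 t2 => Bin b (tree_map f t1) (tree_map f t2)
  end.

(* Number of nodes. *)
Fixpoint tree_size (k : nat) (X : Type) (t : tree k X) : nat :=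
  match t with
  | Leaf _ | Atom _ => 1
  | Un _ t1 => (tree_size t1).+1
  | Bin _ t1 t2 => (tree_size t1 + tree_size t2).+1
  end.

Definition assign (k : nat) (v : 'I_k -> rat) (i : 'I_k) (a : rat) :
    'I_k -> rat :=
  fun j => if j == i then a else v j.

Definition atom_sat (k : nat) (v : 'I_k -> rat) (a : atom k) : Prop :=
  match a with
  | Lt i j => (v i < v j)%R
  | Eq i j => v i = v j
  end.

Fixpoint sat (k : nat) (v : 'I_k -> rat) (phi : formula k) : Prop :=
  match phi with
  | Leaf e => match e with end
  | Atom a => atom_sat v a
  | Un Not f => ~ sat v f
  | Un (All i) f => forall a : rat, sat (assign v i a) f
  | Un (Ex i) f => exists a : rat, sat (assign v i a) f
  | Bin And f g => sat v f /\ sat v g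
  | Bin Or f g => sat v f \/ sat v g
  end.

Definition consistent (k : nat) (P N : seq (k.-tuple rat)) (phi : formula k) :
    Prop :=
  (forall t, t \in P -> sat (tnth t) phi) /\
  (forall t, t \in N -> ~ sat (tnth t) phi).

(** * Regular tree grammars *)

Record grammar (k : nat) : Type := Grammar {
  nonterms : nat;
  start : 'I_nonterms;
  prods : seq ('I_nonterms * tree k 'I_nonterms)
}.

Definition grammar_size (k : nat) (G : grammar k) : nat :=
  nonterms G + \sum_(p <- prods G) (tree_size p.2).+1.

Inductive rewrites (k : nat) (G : grammar k) :
    tree k 'I_(nonterms G) -> tree k 'I_(nonterms G) -> Prop :=
  | rewrites_prod A t : (A, t) \in prods G -> rewrites (Leaf A) t
  | rewrites_un u t t' : rewrites t t' -> rewrites (Un u t) (Un u t')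
  | rewrites_binl b t1 t1' t2 :
      rewrites t1 t1' -> rewrites (Bin b t1 t2) (Bin b t1' t2)
  | rewrites_binr b t1 t2 t2' :
      rewrites t2 t2' -> rewrites (Bin b t1 t2) (Bin b t1 t2').

Definition language (k : nat) (G : grammar k) (phi : formula k) : Prop :=
  clos_refl_trans _ (@rewrites k G)
    (Leaf (start G)) (tree_map (of_void _) phi).

(** * Random access machines with unit cost

   A program uses finitely many registers and finitely many unbounded arrays of
   natural numbers.  The rational numbers of the input are not encoded as
   numbers: they sit in a separate read-only table q, and the program can only
   compare two entries of that table, in one step.  The only arithmetic is
   addition and truncated subtraction, so that unit cost is reasonable. *)

Inductive prog : Type :=
  | Const (x c : nat)               (* x := c *)
  | Add (x y z : nat)               (* x := y + z *)
  | Sub (x y z : nat)               (* x := y - z, truncated *)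
  | Get (x a y : nat)               (* x := a[y] *)
  | Put (a x y : nat)               (* a[x] := y *)
  | RatLt (x y z : nat)             (* x := 1 if q[y] < q[z], else 0 *)
  | Seq (c1 c2 : prog)
  | If (x : nat) (c1 c2 : prog)     (* c1 if x is nonzero, else c2 *)
  | While (x : nat) (c : prog).     (* repeat c as long as x is nonzero *)

Record state : Type := State {
  reg : nat -> nat;
  arr : nat -> nat -> nat
}.

Definition set_reg (s : state) (x v : nat) : state :=
  State (fun y => if y == x then v else reg s y) (arr s).

Definition set_arr (s : state) (a i v : nat) : state :=
  State (reg s)
    (fun b j => if (b == a) && (j == i) then v else arr s b j).

(* exec q c s t s' : started in s, the program c halts in s' after t steps. *)
Inductive exec (q : seq rat) : prog -> state -> nat -> state -> Prop :=
  | exec_const x c s : exec q (Const x c) s 1 (set_reg s x c)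
  | exec_add x y z s :
      exec q (Add x y z) s 1 (set_reg s x (reg s y + reg s z))
  | exec_sub x y z s :
      exec q (Sub x y z) s 1 (set_reg s x (reg s y - reg s z))
  | exec_get x a y s :
      exec q (Get x a y) s 1 (set_reg s x (arr s a (reg s y)))
  | exec_put a x y s :
      exec q (Put a x y) s 1 (set_arr s a (reg s x) (reg s y))
  | exec_ratlt x y z s :
      exec q (RatLt x y z) s 1
        (set_reg s x (nth 0 q (reg s y) < nth 0 q (reg s z))%R)
  | exec_seq c1 c2 s1 s2 s3 t1 t2 :
      exec q c1 s1 t1 s2 -> exec q c2 s2 t2 s3 ->
      exec q (Seq c1 c2) s1 (t1 + t2) s3
  | exec_if x c1 c2 s t s' :
      exec q (if reg s x != 0 then c1 else c2) s t s' ->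
      exec q (If x c1 c2) s t.+1 s'
  | exec_while_end x c s : reg s x = 0 -> exec q (While x c) s 1 s
  | exec_while_loop x c s1 s2 s3 t1 t2 :
      reg s1 x <> 0 -> exec q c s1 t1 s2 -> exec q (While x c) s2 t2 s3 ->
      exec q (While x c) s1 (t1 + t2).+1 s3.

(* A word is passed in array 0, with its length in register 0; initially
   everything else is 0. *)
Definition init (w : seq nat) : state :=
  State (fun x => if x == 0 then size w else 0)
        (fun a i => if a == 0 then nth 0 w i else 0).

Definition output (s : state) : seq nat := mkseq (arr s 0) (reg s 0).

Definition runs (c : prog) (w : seq nat) (q : seq rat) (t : nat)
    (out : seq nat) : Prop :=
  exists s, exec q c (init w) t s /\ output s = out.

(** * Encoding of instances and of answers *)

(* Polish notation. *)
Fixpoint tree_code (k n : nat) (t : tree k 'I_n) : seq nat :=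
  match t with
  | Leaf A => [:: 0; val A]
  | Atom (Lt i j) => [:: 1; val i; val j]
  | Atom (Eq i j) => [:: 2; val i; val j]
  | Un Not t1 => 3 :: tree_code t1
  | Un (All i) t1 => [:: 4, val i & tree_code t1]
  | Un (Ex i) t1 => [:: 5, val i & tree_code t1]
  | Bin And t1 t2 => 6 :: tree_code t1 ++ tree_code t2
  | Bin Or t1 t2 => 7 :: tree_code t1 ++ tree_code t2
  end.

Definition grammar_code (k : nat) (G : grammar k) : seq nat :=
  [:: nonterms G, val (start G), size (prods G)
    & flatten [seq val p.1 :: tree_code p.2 | p <- prods G]].

Definition input_word (k : nat) (P N : seq (k.-tuple rat)) (G : grammar k) :
    seq nat :=
  [:: k, size P, size N & grammar_code G].

Definition input_rats (k : nat) (P N : seq (k.-tuple rat)) : seq rat :=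
  flatten [seq tval t | t <- P ++ N].

(* The shortest formula of L(G) may have exponentially many nodes in the size
   of G, hence formulas are output as syntax trees with sharing of subtrees: a
   list of lines, each of which has its children among the previous lines.
   line_code fs phi l : when the previous lines stand for the formulas fs, the
   line l stands for phi. *)
Inductive line_code (k : nat) (fs : seq (formula k)) :
    formula k -> seq nat -> Prop :=
  | line_lt i j : line_code fs (Atom (Lt i j)) [:: 1; val i; val j]
  | line_eq i j : line_code fs (Atom (Eq i j)) [:: 2; val i; val j]
  | line_not f a : onth fs a = Some f -> line_code fs (Un Not f) [:: 3; a; 0]
  | line_all i f a :
      onth fs a = Some f -> line_code fs (Un (All i) f) [:: 4; val i; a]
  | line_ex i f a :
      onth fs a = Some f -> line_code fs (Un (Ex i) f) [:: 5; val i; a]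
  | line_and f g a b :
      onth fs a = Some f -> onth fs b = Some g ->
      line_code fs (Bin And f g) [:: 6; a; b]
  | line_or f g a b :
      onth fs a = Some f -> onth fs b = Some g ->
      line_code fs (Bin Or f g) [:: 7; a; b].

Inductive lines_code (k : nat) : seq (formula k) -> seq nat -> Prop :=
  | lines_nil : lines_code [::] [::]
  | lines_rcons fs w phi l :
      lines_code fs w -> line_code fs phi l ->
      lines_code (rcons fs phi) (w ++ l).

(* The last line is the root. *)
Definition formula_code (k : nat) (phi : formula k) (w : seq nat) : Prop :=
  exists fs, lines_code (rcons fs phi) w.

Definition correct_answer (k : nat) (P N : seq (k.-tuple rat)) (G : grammar k)
    (out : seq nat) : Prop :=
  (exists phi w,
     [/\ out = 1 :: w, formula_code phi w, language G phi
       & consistent P N phi]) \/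
  (out = [:: 0] /\ forall phi, language G phi -> ~ consistent P N phi).

(* Main.v *)
(* The truth of a formula of FO^k at an assignment in (Q, <) depends only on the
   order type of the assignment, and every order type is realised by one of the
   T = k^k assignments with values in {0, ..., k-1}.  So a formula is abstracted
   to the set of those assignments that satisfy it, coded as a number below
   D = 2^T; density makes this abstraction compositional, also for quantifiers.
   The algorithm saturates the set of facts (x, v), where x is a nonterminal or
   the position of a subtree of a right-hand side of the grammar, and v is the
   value of some formula derived from x.  Each position has a single parent, and
   the leaves labelled by a nonterminal are chained in a list that starts at
   this nonterminal, so that every fact triggers at most two rules, each tried
   in time poly(D), and a work list handles all facts in time poly(D) * |G|.
   Every new fact records one line of a shared syntax tree witnessing it.

   The machine program is compiled from a small language with bounded loops
   only: its semantics is a total function and its running time is bounded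
   syntactically, loops over the size of the grammar being counted apart. *)

From Stdlib Require Import Relation_Operators.
Require Import Defs.
From mathcomp Require Import all_boot all_order all_algebra.
From mathcomp Require Import zify.

Set Implicit Arguments.
Unset Strict Implicit.
Unset Printing Implicit Defensive.

(** * A language with bounded loops and its compilation *)

(* L i is the i-th local variable.  It x z f iterates f as many times as the
   value of register x, from z, with the accumulator and the index appended to
   the local variables; App evaluates f with its four arguments as the only
   local variables. *)
Inductive exp : Type :=
  | V of nat
  | L of nat
  | K of nat
  | Plus of exp & exp
  | Minus of exp & exp
  | Arr of nat & exp
  | Rlt of exp & exp
  | IfE of exp & exp & exp
  | It of nat & exp & exp
  | App of exp & exp & exp & exp & exp.

Fixpoint eval (q : seq rat) (h : state) (env : seq nat) (e : exp) : nat :=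
  match e with
  | V x => reg h x
  | L i => nth 0 env i
  | K c => c
  | Plus a b => eval q h env a + eval q h env b
  | Minus a b => eval q h env a - eval q h env b
  | Arr a e => arr h a (eval q h env e)
  | Rlt a b => (nth 0 q (eval q h env a) < nth 0 q (eval q h env b))%R
  | IfE c a b => if eval q h env c != 0 then eval q h env a else eval q h env b
  | It x z f =>
      iteri (reg h x) (fun i acc => eval q h (env ++ [:: acc; i]) f)
        (eval q h env z)
  | App f a b c d =>
      eval q h [:: eval q h env a; eval q h env b; eval q h env c;
                  eval q h env d] f
  end.

Definition move (x y : nat) : prog := Seq (Const x 0) (Add x x y).

Fixpoint compE (rs : seq nat) (d : nat) (e : exp) : prog :=
  match e with
  | V x => move d x
  | L i => move d (nth 0 rs i)
  | K c => Const d c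
  | Plus a b => Seq (compE rs d a) (Seq (compE rs d.+1 b) (Add d d d.+1))
  | Minus a b => Seq (compE rs d a) (Seq (compE rs d.+1 b) (Defs.Sub d d d.+1))
  | Arr a e => Seq (compE rs d e) (Get d a d)
  | Rlt a b => Seq (compE rs d a) (Seq (compE rs d.+1 b) (RatLt d d d.+1))
  | IfE c a b => Seq (compE rs d c) (If d (compE rs d a) (compE rs d b))
  | It x z f =>
      Seq (compE rs d z) (Seq (Const d.+1 0) (Seq (move d.+2 x)
        (While d.+2
          (Seq (compE (rs ++ [:: d; d.+1]) d.+3 f) (Seq (move d d.+3)
          (Seq (Const d.+3 1) (Seq (Add d.+1 d.+1 d.+3)
               (Defs.Sub d.+2 d.+2 d.+3))))))))
  | App f a b c d' =>
      Seq (compE rs d a) (Seq (compE rs d.+1 b) (Seq (compE rs d.+2 c)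
        (Seq (compE rs d.+3 d') (Seq
          (compE [:: d; d.+1; d.+2; d.+3] d.+4 f) (move d d.+4)))))
  end.

Fixpoint wfe (g : nat) (cnt : pred nat) (n : nat) (e : exp) : bool :=
  match e with
  | V x => x < g
  | L i => i < n
  | K c => true
  | Plus a b | Minus a b | Rlt a b => wfe g cnt n a && wfe g cnt n b
  | Arr a e => wfe g cnt n e
  | IfE c a b => [&& wfe g cnt n c, wfe g cnt n a & wfe g cnt n b]
  | It x z f => [&& x < g, cnt x, wfe g cnt n z & wfe g cnt n.+2 f]
  | App f a b c d =>
      [&& wfe g cnt 4 f, wfe g cnt n a, wfe g cnt n b, wfe g cnt n c
        & wfe g cnt n d]
  end.

Fixpoint ecost (beta : nat -> nat) (e : exp) : nat :=
  match e with
  | V _ | L _ => 2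
  | K _ => 1
  | Plus a b | Minus a b | Rlt a b => (ecost beta a + ecost beta b).+1
  | Arr a e => (ecost beta e).+1
  | IfE c a b => (ecost beta c + (ecost beta a + ecost beta b)).+1
  | It x z f => ecost beta z + 4 + beta x * (ecost beta f + 6)
  | App f a b c d =>
      ecost beta a + ecost beta b + ecost beta c + ecost beta d
      + ecost beta f + 2
  end.

Lemma eval_ext (q : seq rat) (g : nat) (cnt : pred nat) (s h : state)
    (e : exp) (n : nat) (env : seq nat) :
  (forall x, x < g -> reg s x = reg h x) -> arr s = arr h ->
  wfe g cnt n e -> eval q s env e = eval q h env e.
Proof.
move=> Hr Ha.
elim: e n env => //=.
- by move=> x n env /Hr.
- by move=> a IHa b IHb n env /andP[/IHa-> /IHb->].
- by move=> a IHa b IHb n env /andP[/IHa-> /IHb->].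
- by move=> a e IHe n env /IHe->; rewrite Ha.
- by move=> a IHa b IHb n env /andP[/IHa-> /IHb->].
- by move=> c IHc a IHa b IHb n env /and3P[/IHc-> /IHa-> /IHb->].
- move=> x z IHz f IHf n env /and4P[/Hr-> _ /IHz-> wf].
  by apply: eq_iteri => i acc; apply: IHf wf.
- move=> f IHf a IHa b IHb c IHc d IHd n env.
  by case/and5P=> /IHf wf /IHa-> /IHb-> /IHc-> /IHd->; apply: wf.
Qed.

Lemma exec_move (q : seq rat) (x y : nat) (s : state) :
  x != y -> exists s', [/\ exec q (move x y) s 2 s', reg s' x = reg s y,
    forall z, z != x -> reg s' z = reg s z & arr s' = arr s].
Proof.
move=> xy; eexists; split.
- exact: (exec_seq (exec_const _ _ _ _) (exec_add _ _ _ _ _)).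
- by rewrite /= eqxx eq_sym (negPf xy).
- by move=> z /negPf /= ->.
- by [].
Qed.

Definition computes (q : seq rat) (c : prog) (d v b : nat) (s : state) : Prop :=
  exists t s', [/\ exec q c s t s', t <= b, reg s' d = v,
    forall x, x < d -> reg s' x = reg s x & arr s' = arr s].

Section CompileExp.
Variables (q : seq rat) (g : nat) (cnt : pred nat) (beta : nat -> nat).

Definition within (s : state) : Prop :=
  forall x, x < g -> cnt x -> reg s x <= beta x.

Definition good (rs env : seq nat) (d : nat) (s : state) : Prop :=
  [/\ g <= d, size rs = size env & forall i, i < size env ->
     nth 0 rs i < d /\ reg s (nth 0 rs i) = nth 0 env i].

Lemma good_step rs env d d' s s' :
  good rs env d s -> d <= d' -> (forall x, x < d -> reg s' x = reg s x) ->
  good rs env d' s'.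
Proof.
move=> [gd sz H] dd' Hr; split=> //; first lia.
by move=> i /H[lt <-]; split; [lia | rewrite Hr].
Qed.

Lemma within_step d s s' :
  g <= d -> within s -> (forall x, x < d -> reg s' x = reg s x) -> within s'.
Proof. by move=> gd W Hr x xg cx; rewrite Hr ?W //; lia. Qed.

Definition comp_spec (e : exp) : Prop := forall rs env d s,
  wfe g cnt (size env) e -> good rs env d s -> within s ->
  computes q (compE rs d e) d (eval q s env e) (ecost beta e) s.

Lemma comp_next rs env d d' s s' e :
  comp_spec e -> wfe g cnt (size env) e -> good rs env d s -> within s ->
  d <= d' -> (forall x, x < d -> reg s' x = reg s x) -> arr s' = arr s ->
  computes q (compE rs d' e) d' (eval q s env e) (ecost beta e) s'.
Proof.
move=> He we gs ws dd' Hr Ha; have [gd _ _] := gs.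
rewrite -(@eval_ext q g cnt s' s e (size env) env) //; last first.
  by move=> x xg; apply: Hr; lia.
apply: He => //; first exact: good_step Hr.
exact: within_step Hr.
Qed.

Lemma comp_binary rs env d s a b (i : prog) (o : nat -> nat -> nat) :
  (forall s, exec q i s 1 (set_reg s d (o (reg s d) (reg s d.+1)))) ->
  comp_spec a -> comp_spec b ->
  wfe g cnt (size env) a && wfe g cnt (size env) b ->
  good rs env d s -> within s ->
  computes q (Seq (compE rs d a) (Seq (compE rs d.+1 b) i)) d
    (o (eval q s env a) (eval q s env b)) (ecost beta a + ecost beta b).+1 s.
Proof.
move=> Hi IHa IHb /andP[wa wb] gs ws.
have [t1 [s1 [e1 c1 v1 r1 a1]]] := IHa _ _ _ _ wa gs ws.
have [t2 [s2 [e2 c2 v2 r2 a2]]] := comp_next IHb wb gs ws (leqnSn d) r1 a1.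
eexists; eexists; split.
- exact: exec_seq e1 (exec_seq e2 (Hi _)).
- lia.
- by rewrite /= eqxx v2 r2 // v1.
- by move=> x xd /=; rewrite (ltn_eqF xd) r2 ?r1 //; lia.
- by rewrite /= a2.
Qed.

Lemma exec_count_loop (x : nat) (c : prog) (b : nat)
    (P : nat -> state -> Prop) (n : nat) (s : state) :
  (forall i s, i < n -> P i s -> reg s x = n - i ->
     exists t s', [/\ exec q c s t s', t <= b, P i.+1 s'
                    & reg s' x = n - i.+1]) ->
  P 0 s -> reg s x = n ->
  exists t s', [/\ exec q (While x c) s t s', t <= n * b.+1 + 1 & P n s'].
Proof.
move=> step P0 x0.
suff H m i s1 : m + i = n -> P i s1 -> reg s1 x = n - i ->
    exists t s', [/\ exec q (While x c) s1 t s', t <= m * b.+1 + 1 & P n s'].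
  by apply: (H n 0) => //; rewrite ?addn0 ?subn0.
elim: m i s1 => [|m IH] i s1 mi Pi xi.
  exists 1, s1; split=> //; last by rewrite -mi add0n.
  by apply: exec_while_end; rewrite xi; lia.
have lti : i < n by lia.
have [t1 [s2 [e1 c1 P1 x1]]] := step i s1 lti Pi xi.
have mi' : m + i.+1 = n by lia.
have [t2 [s3 [e2 c2 P2]]] := IH i.+1 s2 mi' P1 x1.
exists (t1 + t2).+1, s3; split=> //; last lia.
by apply: exec_while_loop e1 e2; rewrite xi; lia.
Qed.

Lemma comp_correct e : comp_spec e.
Proof.
elim: e => [x|i|c|a IHa b IHb|a IHa b IHb|a e IHe|a IHa b IHb
  |c IHc a IHa b IHb|x z IHz f IHf|f IHf a IHa b IHb c IHc d' IHd]
  rs env d s /= we gs ws.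
- have [gd _ _] := gs.
  have [|s' [e v r ar]] := @exec_move q d x s; first lia.
  by exists 2, s'; split=> // y yd; apply: r; lia.
- have [gd sz H] := gs; have [lt ri] := H _ we.
  have [|s' [e v r ar]] := @exec_move q d (nth 0 rs i) s; first lia.
  exists 2, s'; split=> //; first by rewrite v.
  by move=> y yd; apply: r; lia.
- exists 1, (set_reg s d c); split=> //=; first exact: exec_const.
    by rewrite eqxx.
  by move=> y yd; rewrite (ltn_eqF yd).
- by apply: (comp_binary (o := addn)) => // s1; apply: exec_add.
- by apply: (comp_binary (o := subn)) => // s1; apply: exec_sub.
- have [t1 [s1 [e1 c1 v1 r1 a1]]] := IHe _ _ _ _ we gs ws.
  eexists; eexists; split.
  + exact: exec_seq e1 (exec_get _ _ _ _ _).
  + lia.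
  + by rewrite /= eqxx v1 a1.
  + by move=> x xd /=; rewrite (ltn_eqF xd) r1.
  + by rewrite /= a1.
- apply: (comp_binary (o := fun u v => (nth 0 q u < nth 0 q v)%R)) => // s1.
  exact: exec_ratlt.
- case/and3P: we => wc wa wb.
  have [t1 [s1 [e1 c1 v1 r1 a1]]] := IHc _ _ _ _ wc gs ws.
  have [t2 [s2 [e2 c2 v2 r2 a2]]] := comp_next IHa wa gs ws (leqnn d) r1 a1.
  have [t3 [s3 [e3 c3 v3 r3 a3]]] := comp_next IHb wb gs ws (leqnn d) r1 a1.
  have [vc|vc] := boolP (eval q s env c != 0).
    exists (t1 + t2.+1), s2; split=> //; first 1 last.
    + lia.
    + by move=> x xd; rewrite r2 // r1.
    + by rewrite a2.
    by apply: exec_seq e1 _; apply: exec_if; rewrite v1 vc.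
  exists (t1 + t3.+1), s3; split=> //; first 1 last.
  + lia.
  + by move=> x xd; rewrite r3 // r1.
  + by rewrite a3.
  by apply: exec_seq e1 _; apply: exec_if; rewrite v1 (negPf vc).
- case/and4P: we => xg cx wz wf; have [gd sz H] := gs.
  have [t1 [s1 [e1 c1 v1 r1 a1]]] := IHz _ _ _ _ wz gs ws.
  set s2 := set_reg s1 d.+1 0.
  have [|s3 [e3 v3 r3 a3]] := @exec_move q d.+2 x s2; first lia.
  set F := fun i acc => eval q s (env ++ [:: acc; i]) f.
  set c := (X in While _ X).
  pose P i s' := [/\ reg s' d = iteri i F (eval q s env z), reg s' d.+1 = i,
    forall y, y < d -> reg s' y = reg s y & arr s' = arr s].
  have [|||t4 [s4 [e4 c4 [p1 p2 p3 p4]]]] :=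
      @exec_count_loop d.+2 c (ecost beta f + 5) P (reg s x) s3.
  + move=> i s5 lti [q1 q2 q3 q4] q5.
    have gs5 : good (rs ++ [:: d; d.+1]) (env ++ [:: reg s5 d; i]) d.+3 s5.
      split; [lia|by rewrite !size_cat sz|].
      move=> j; rewrite size_cat !nth_cat sz => /= ltj.
      case: (ltnP j (size env)) => jn.
        by have [ri vi] := H _ jn; split; [lia|rewrite q3].
      by have [->|->] : j - size env = 0 \/ j - size env = 1; [lia| |];
        split=> //=; lia.
    have wf5 : wfe g cnt (size (env ++ [:: reg s5 d; i])) f.
      by rewrite size_cat addn2.
    have [t6 [s6 [e6 c6 v6 r6 a6]]] := IHf _ _ _ _ wf5 gs5 (within_step gd ws q3).
    have [|s7 [e7 v7 r7 a7]] := @exec_move q d d.+3 s6; first lia.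
    eexists; eexists; split.
    * apply: exec_seq e6 (exec_seq e7 (exec_seq (exec_const _ _ _ _)
        (exec_seq (exec_add _ _ _ _ _) (exec_sub _ _ _ _ _)))).
    * lia.
    * have n1 : (d == d.+1) = false by lia.
      have n2 : (d == d.+2) = false by lia.
      have n3 : (d == d.+3) = false by lia.
      have n4 : (d.+1 == d.+2) = false by lia.
      have n5 : (d.+1 == d.+3) = false by lia.
      have n6 : (d.+1 == d) = false by lia.
      split.
      - rewrite /= n1 n2 n3 v7 v6 /= /F -q1.
        by apply: (@eval_ext q g cnt _ _ _ (size env).+2) => // y yg; apply: q3; lia.
      - by rewrite /= !(eqxx, n1, n2, n4, n5, n6) r7 ?r6 ?q2 ?n6 //; lia.
      - move=> y yd; have [z1 z2 z3 z0] : [/\ (y == d.+1) = false,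
          (y == d.+2) = false, (y == d.+3) = false & y != d] by split; lia.
        by rewrite /= z1 z2 z3 r7 // r6 ?q3 //; lia.
      - by rewrite /= a7 a6.
    * have [m1 m2 m3 m4] : [/\ (d.+2 == d.+1) = false, (d.+2 == d.+3) = false,
        (d.+3 == d.+1) = false & d.+2 != d] by split; lia.
      by rewrite /= !(eqxx, m1, m2, m3) r7 // r6 ?q5 //; lia.
  + split=> //.
    * by rewrite r3 ?/= ?ifN ?v1 //; lia.
    * by rewrite r3 /= ?eqxx //; lia.
    * by move=> y yd; rewrite r3 /= ?ifN ?r1 //; lia.
    * by rewrite a3 /= a1.
  + by rewrite v3 /= ifN ?r1 //; lia.
  eexists; exists s4; split; [|idtac|exact: p1|exact: p3|exact: p4].
  + exact: exec_seq e1 (exec_seq (exec_const _ _ _ _) (exec_seq e3 e4)).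
  + have := ws _ xg cx; nia.
- case/and5P: we => wf wa wb wc wd; have [gd sz H] := gs.
  have [t1 [s1 [e1 c1 v1 r1 a1]]] := IHa _ _ _ _ wa gs ws.
  have [t2 [s2 [e2 c2 v2 r2 a2]]] := comp_next IHb wb gs ws (leqnSn d) r1 a1.
  have r2' y : y < d -> reg s2 y = reg s y by move=> yd; rewrite r2 ?r1 //; lia.
  have [||t3 [s3 [e3 c3 v3 r3 a3]]] := @comp_next _ _ _ d.+2 _ s2 _ IHc wc gs ws _ r2' _;
    rewrite ?a2 //; first lia.
  have r3' y : y < d -> reg s3 y = reg s y by move=> yd; rewrite r3 ?r2' //; lia.
  have [||t4 [s4 [e4 c4 v4 r4 a4]]] := @comp_next _ _ _ d.+3 _ s3 _ IHd wd gs ws _ r3' _;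
    rewrite ?a3 ?a2 //; first lia.
  have r4' y : y < d -> reg s4 y = reg s y by move=> yd; rewrite r4 ?r3' //; lia.
  have [|||t5 [s5 [e5 c5 v5 r5 a5]]] := @IHf [:: d; d.+1; d.+2; d.+3]
    [:: eval q s env a; eval q s env b; eval q s env c; eval q s env d'] d.+4 s4.
  + by [].
  + split=> //; first lia.
    case=> [|[|[|[|//]]]] _ /=; split; try lia.
    * by rewrite r4 ?r3 ?r2 //; lia.
    * by rewrite r4 ?r3 ?v2 //; lia.
    * by rewrite r4 ?v3 //; lia.
  + by apply: within_step r4'.
  have [|s6 [e6 v6 r6 a6]] := @exec_move q d d.+4 s5; first lia.
  eexists; exists s6; split.
  + exact: exec_seq e1 (exec_seq e2 (exec_seq e3 (exec_seq e4 (exec_seq e5 e6)))).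
  + lia.
  + rewrite v6 v5; apply: (@eval_ext q g cnt _ _ _ 4) => //.
    * by move=> y yg; rewrite r4' //; lia.
    * by rewrite a4 a3 a2.
  + move=> y yd; rewrite r6 ?r5 ?r4' //; lia.
  + by rewrite a6 a5 a4 a3 a2.
Qed.

End CompileExp.

Inductive stm : Type :=
  | Skip
  | Asg of nat & exp
  | St of nat & exp & exp
  | Sq of stm & stm
  | Cond of exp & stm & stm
  | For of nat & nat & stm.

Fixpoint sem (q : seq rat) (c : stm) (h : state) : state :=
  match c with
  | Skip => h
  | Asg x e => set_reg h x (eval q h [::] e)
  | St a i e => set_arr h a (eval q h [::] i) (eval q h [::] e)
  | Sq c1 c2 => sem q c2 (sem q c1 h)
  | Cond e c1 c2 => if eval q h [::] e != 0 then sem q c1 h else sem q c2 h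
  | For x i c1 =>
      iteri (reg h x) (fun j h1 => sem q c1 (set_reg h1 i j)) h
  end.

Fixpoint compS (d : nat) (c : stm) : prog :=
  match c with
  | Skip => Const d 0
  | Asg x e => Seq (compE [::] d e) (move x d)
  | St a i e => Seq (compE [::] d i) (Seq (compE [::] d.+1 e) (Put a d d.+1))
  | Sq c1 c2 => Seq (compS d c1) (compS d c2)
  | Cond e c1 c2 => Seq (compE [::] d e) (If d (compS d c1) (compS d c2))
  | For x i c1 =>
      Seq (move d x) (Seq (Const d.+1 0) (While d
        (Seq (move i d.+1) (Seq (compS d.+2 c1)
        (Seq (Const d.+2 1) (Seq (Add d.+1 d.+1 d.+2)
             (Defs.Sub d d d.+2)))))))
  end.

(* The registers in cnt may serve as loop counts and are never assigned; those
   in big do not occur as counts inside expressions. *)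
Fixpoint wfs (g : nat) (cnt big : pred nat) (c : stm) : bool :=
  match c with
  | Skip => true
  | Asg x e => [&& x < g, ~~ cnt x & wfe g (predD cnt big) 0 e]
  | St a i e => wfe g (predD cnt big) 0 i && wfe g (predD cnt big) 0 e
  | Sq c1 c2 => wfs g cnt big c1 && wfs g cnt big c2
  | Cond e c1 c2 =>
      [&& wfe g (predD cnt big) 0 e, wfs g cnt big c1 & wfs g cnt big c2]
  | For x i c1 => [&& x < g, cnt x, i < g, ~~ cnt i & wfs g cnt big c1]
  end.

Fixpoint scost (beta : nat -> nat) (c : stm) : nat :=
  match c with
  | Skip => 1
  | Asg x e => ecost beta e + 2
  | St a i e => (ecost beta i + ecost beta e).+1
  | Sq c1 c2 => scost beta c1 + scost beta c2
  | Cond e c1 c2 => (ecost beta e + (scost beta c1 + scost beta c2)).+1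
  | For x i c1 => 4 + beta x * (scost beta c1 + 6)
  end.

Section CompileStm.
Variables (q : seq rat) (g : nat) (cnt big : pred nat) (beta : nat -> nat).

(* [s] is the machine state, [h] the abstract one. *)
Definition agree (s h : state) : Prop :=
  (forall x, x < g -> reg s x = reg h x) /\ arr s = arr h.

Lemma comp_agree d e s h :
  wfe g (predD cnt big) 0 e -> g <= d -> within g cnt beta s -> agree s h ->
  exists t s', [/\ exec q (compE [::] d e) s t s', t <= ecost beta e,
    reg s' d = eval q h [::] e, forall x, x < d -> reg s' x = reg s x &
    arr s' = arr s].
Proof.
move=> we gd ws [Hr Ha].
have gs : good g [::] [::] d s by split.
have ws' : within g (predD cnt big) beta s.
  by move=> x xg /andP[_]; apply: ws.
have [t [s' [e1 c1 v1 r1 a1]]] := @comp_correct q g _ beta e [::] [::] d s we gs ws'.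
by exists t, s'; split=> //; rewrite v1; apply: eval_ext Hr Ha we.
Qed.

Lemma sem_cnt c h x : wfs g cnt big c -> cnt x -> reg (sem q c h) x = reg h x.
Proof.
move=> + cx; elim: c h => //=.
- by move=> y e h /and3P[_ ny _]; rewrite ifN //; apply: contraNneq ny => <-.
- by move=> c1 IH1 c2 IH2 h /andP[w1 w2]; rewrite IH2 // IH1.
- by move=> e c1 IH1 c2 IH2 h /and3P[_ w1 w2]; case: ifP => _; auto.
- move=> y i c1 IH h /and5P[_ _ _ ni w1].
  elim: (reg h y) => //= n IHn; rewrite IH //= ifN //.
  by apply: contraNneq ni => <-.
Qed.

Lemma compS_correct c d s h :
  wfs g cnt big c -> g <= d -> within g cnt beta h -> agree s h ->
  exists t s', [/\ exec q (compS d c) s t s', t <= scost beta c,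
    agree s' (sem q c h) & forall x, g <= x < d -> reg s' x = reg s x].
Proof.
elim: c d s h => [|x e|a i e|c1 IH1 c2 IH2|e c1 IH1 c2 IH2|x i c1 IH1] d s h /=
  wc gd wh ag; have [Hr Ha] := ag;
  have ws : within g cnt beta s by move=> y yg cy; rewrite Hr // wh.
- exists 1, (set_reg s d 0); split=> //; first exact: exec_const.
    by split=> //= y yg; rewrite ifN ?Hr //; lia.
  by move=> y yd /=; rewrite ifN //; lia.
- case/and3P: wc => xg ncx we.
  have [t1 [s1 [e1 c1 v1 r1 a1]]] := comp_agree we gd ws ag.
  have [|s2 [e2 v2 r2 a2]] := @exec_move q x d s1; first lia.
  exists (t1 + 2), s2; split; [exact: exec_seq e1 e2|lia|split|] => /=.
  + move=> y yg; case: eqP => [->|/eqP ne]; first by rewrite v2 v1.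
    by rewrite r2 // r1 ?Hr //; lia.
  + by rewrite a2 a1.
  + by move=> y yd; rewrite r2 ?r1 //; lia.
- case/andP: wc => wi we.
  have [t1 [s1 [e1 c1 v1 r1 a1]]] := comp_agree wi gd ws ag.
  have ag1 : agree s1 h.
    by split=> [y yg|]; rewrite ?a1 // r1 ?Hr //; lia.
  have gd1 : g <= d.+1 by lia.
  have ws1 : within g cnt beta s1.
    by move=> y yg cy; rewrite r1 ?ws //; lia.
  have [t2 [s2 [e2 c2 v2 r2 a2]]] := comp_agree we gd1 ws1 ag1.
  eexists; eexists; split.
  + exact: exec_seq e1 (exec_seq e2 (exec_put _ _ _ _ _)).
  + lia.
  + split=> /=; first by move=> y yg; rewrite r2 ?r1 ?Hr //; lia.
    by rewrite v2 r2 // v1 a2 a1 Ha.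
  + by move=> y yd /=; rewrite r2 ?r1 //; lia.
- case/andP: wc => w1 w2.
  have [t1 [s1 [e1 k1 ag1 p1]]] := IH1 d s h w1 gd wh ag.
  have wh1 : within g cnt beta (sem q c1 h).
    by move=> y yg cy; rewrite sem_cnt // wh.
  have [t2 [s2 [e2 k2 ag2 p2]]] := IH2 d s1 (sem q c1 h) w2 gd wh1 ag1.
  exists (t1 + t2), s2; split=> //; [exact: exec_seq e1 e2|lia|].
  by move=> y yd; rewrite p2 ?p1.
- case/and3P: wc => we w1 w2.
  have [t0 [s0 [e0 k0 v0 r0 a0]]] := comp_agree we gd ws ag.
  have ag0 : agree s0 h.
    by split=> [y yg|]; rewrite ?a0 // r0 ?Hr //; lia.
  have [t1 [s1 [e1 k1 ag1 p1]]] := IH1 d s0 h w1 gd wh ag0.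
  have [t2 [s2 [e2 k2 ag2 p2]]] := IH2 d s0 h w2 gd wh ag0.
  have p y : g <= y < d -> reg s0 y = reg s y by move=> yd; rewrite r0 //; lia.
  case: ifPn => ve.
    exists (t0 + t1.+1), s1; split=> //; [|lia|by move=> y yd; rewrite p1 ?p].
    by apply: exec_seq e0 _; apply: exec_if; rewrite v0 ve.
  exists (t0 + t2.+1), s2; split=> //; [|lia|by move=> y yd; rewrite p2 ?p].
  by apply: exec_seq e0 _; apply: exec_if; rewrite v0 (negPf ve).
- case/and5P: wc => xg cx ig nci w1.
  have [|s1 [e1 v1 r1 a1]] := @exec_move q d x s; first lia.
  set c := (X in While _ X); set s2 := set_reg s1 d.+1 0.
  set F := fun j h1 => sem q c1 (set_reg h1 i j).
  pose P j s' := [/\ agree s' (iteri j F h), reg s' d.+1 = j &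
    forall y, g <= y < d -> reg s' y = reg s y].
  have whj j : within g cnt beta (iteri j F h).
    elim: j => //= j IHj y yg cy; rewrite /F sem_cnt //= ifN ?IHj //.
    by apply: contraNneq nci => <-.
  have [|||t3 [s3 [e3 k3 [p1 p2 p3]]]] :=
      @exec_count_loop q d c (scost beta c1 + 5) P (reg h x) s2.
  + move=> j s4 ltj [[q1 q1'] q2 q3] q4.
    have [|s5 [e5 v5 r5 a5]] := @exec_move q i d.+1 s4; first lia.
    have ag5 : agree s5 (set_reg (iteri j F h) i j).
      split; last by rewrite a5 q1'.
      move=> y yg /=; case: eqP => [->|/eqP ne]; first by rewrite v5 q2.
      by rewrite r5 // q1.
    have wh5 : within g cnt beta (set_reg (iteri j F h) i j).
      move=> y yg cy /=; rewrite ifN ?whj //.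
      by apply: contraNneq nci => <-.
    have gd2 : g <= d.+2 by lia.
    have [t6 [s6 [e6 k6 [ag6 ag6'] p6]]] := IH1 d.+2 s5 _ w1 gd2 wh5 ag5.
    have [n1 n2 n3] : [/\ (d == d.+1) = false, (d == d.+2) = false
      & d != i] by split; lia.
    have [n4 n5 n6] : [/\ (d.+1 == d.+2) = false, (d.+1 == d) = false
      & d.+1 != i] by split; lia.
    have [n7 n8] : (d.+2 == d.+1) = false /\ (d.+2 == d) = false by split; lia.
    eexists; eexists; split.
    * exact: exec_seq e5 (exec_seq e6 (exec_seq (exec_const _ _ _ _)
        (exec_seq (exec_add _ _ _ _ _) (exec_sub _ _ _ _ _)))).
    * lia.
    * split; first split.
      - move=> y yg; have [m1 m2 m3] : [/\ (y == d) = false,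
          (y == d.+1) = false & (y == d.+2) = false] by split; lia.
        by rewrite /= m1 m2 m3 ag6.
      - by rewrite /= ag6'.
      - by rewrite /= !(eqxx, n4, n5) p6 ?r5 ?q2 ?addn1 //; lia.
      - move=> y yd; have [m1 m2 m3 m4] : [/\ (y == d) = false,
          (y == d.+1) = false, (y == d.+2) = false & y != i] by split; lia.
        by rewrite /= m1 m2 m3 p6 ?r5 ?q3 //; lia.
    * by rewrite /= !(eqxx, n1, n2, n7, n8) p6 ?r5 ?q4 //; lia.
  + split; first split.
    * by move=> y yg; rewrite /= ifN ?r1 ?Hr //; lia.
    * by rewrite /= a1.
    * by rewrite /= eqxx.
    * by move=> y yd; rewrite /= ifN ?r1 //; lia.
  + by rewrite /= ifN ?v1 ?Hr //; lia.
  eexists; exists s3; split.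
  + exact: exec_seq e1 (exec_seq (exec_const _ _ _ _) e3).
  + have := wh _ xg cx; nia.
  + exact: p1.
  + exact: p3.
Qed.

End CompileStm.

Fixpoint esize (e : exp) : nat :=
  match e with
  | V _ | L _ => 2
  | K _ => 1
  | Plus a b | Minus a b | Rlt a b => (esize a + esize b).+1
  | Arr a e => (esize e).+1
  | IfE c a b => (esize c + (esize a + esize b)).+1
  | It x z f => esize z + 4 + (esize f + 6)
  | App f a b c d => esize a + esize b + esize c + esize d + esize f + 2
  end.

Fixpoint edepth (e : exp) : nat :=
  match e with
  | V _ | L _ | K _ => 0
  | Plus a b | Minus a b | Rlt a b => maxn (edepth a) (edepth b)
  | Arr a e => edepth e
  | IfE c a b => maxn (edepth c) (maxn (edepth a) (edepth b))
  | It x z f => maxn (edepth z) (edepth f).+1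
  | App f a b c d => maxn (edepth a) (maxn (edepth b) (maxn (edepth c)
      (maxn (edepth d) (edepth f))))
  end.

Fixpoint ssize (c : stm) : nat :=
  match c with
  | Skip => 1
  | Asg x e => esize e + 2
  | St a i e => (esize i + esize e).+1
  | Sq c1 c2 => ssize c1 + ssize c2
  | Cond e c1 c2 => (esize e + (ssize c1 + ssize c2)).+1
  | For x i c1 => 4 + (ssize c1 + 6)
  end.

Fixpoint sdepth (c : stm) : nat :=
  match c with
  | Skip => 0
  | Asg x e => edepth e
  | St a i e => maxn (edepth i) (edepth e)
  | Sq c1 c2 => maxn (sdepth c1) (sdepth c2)
  | Cond e c1 c2 => maxn (edepth e) (maxn (sdepth c1) (sdepth c2))
  | For x i c1 => (sdepth c1).+1
  end.

(* Nesting depth of the loops over a register in big. *)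
Fixpoint sbig (big : pred nat) (c : stm) : nat :=
  match c with
  | Skip | Asg _ _ | St _ _ _ => 0
  | Sq c1 c2 | Cond _ c1 c2 => maxn (sbig big c1) (sbig big c2)
  | For x i c1 => big x + sbig big c1
  end.

Section CostBound.
Variables (beta : nat -> nat) (g : nat) (cnt big : pred nat) (B Z : nat).
Hypotheses (B0 : 0 < B) (Z0 : 0 < Z).

Let le_scale a d d' x : d <= d' -> x <= a * B ^ d -> x <= a * B ^ d'.
Proof.
move=> dd /leq_trans-> //; rewrite leq_mul2l leq_pexp2l ?orbT //.
Qed.

Lemma ecost_bound (small : pred nat) n e :
  (forall x, small x -> beta x <= B) -> wfe g small n e ->
  ecost beta e <= esize e * B ^ edepth e.
Proof.
move=> bB; elim: e n => /=; try by move=> *; rewrite ?expn0.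
- move=> a IHa b IHb n /andP[/IHa /(le_scale (leq_maxl _ (edepth b))) Ha
    /IHb /(le_scale (leq_maxr (edepth a) _)) Hb].
  by have := expn_gt0 B (maxn (edepth a) (edepth b)); rewrite B0 /=; nia.
- move=> a IHa b IHb n /andP[/IHa /(le_scale (leq_maxl _ (edepth b))) Ha
    /IHb /(le_scale (leq_maxr (edepth a) _)) Hb].
  by have := expn_gt0 B (maxn (edepth a) (edepth b)); rewrite B0 /=; nia.
- by move=> a e IHe n /IHe; have := expn_gt0 B (edepth e); rewrite B0 /=; nia.
- move=> a IHa b IHb n /andP[/IHa /(le_scale (leq_maxl _ (edepth b))) Ha
    /IHb /(le_scale (leq_maxr (edepth a) _)) Hb].
  by have := expn_gt0 B (maxn (edepth a) (edepth b)); rewrite B0 /=; nia.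
- move=> c IHc a IHa b IHb n /and3P[/IHc Hc /IHa Ha /IHb Hb].
  set d := maxn _ _.
  have {}Hc : ecost beta c <= esize c * B ^ d by apply: le_scale Hc; lia.
  have {}Ha : ecost beta a <= esize a * B ^ d by apply: le_scale Ha; lia.
  have {}Hb : ecost beta b <= esize b * B ^ d by apply: le_scale Hb; lia.
  by have := expn_gt0 B d; rewrite B0 /=; nia.
- move=> x z IHz f IHf n /and4P[_ /bB bx /IHz Hz /IHf Hf].
  set d := maxn _ _.
  have {}Hz : ecost beta z <= esize z * B ^ d by apply: le_scale Hz; lia.
  have Hf1 : beta x * (ecost beta f + 6) <= (esize f + 6) * B ^ d.
    apply: (@le_scale _ (edepth f).+1); first lia.
    apply: (@leq_trans (B * ((esize f + 6) * B ^ edepth f))).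
      rewrite leq_mul //; have := expn_gt0 B (edepth f); rewrite B0 /=; nia.
    by rewrite expnS mulnCA.
  by have := expn_gt0 B d; rewrite B0 /=; nia.
- move=> f IHf a IHa b IHb c IHc d IHd n /and5P[/IHf Hf /IHa Ha /IHb Hb /IHc Hc
    /IHd Hd].
  set m := maxn _ _.
  have {}Hf : ecost beta f <= esize f * B ^ m by apply: le_scale Hf; lia.
  have {}Ha : ecost beta a <= esize a * B ^ m by apply: le_scale Ha; lia.
  have {}Hb : ecost beta b <= esize b * B ^ m by apply: le_scale Hb; lia.
  have {}Hc : ecost beta c <= esize c * B ^ m by apply: le_scale Hc; lia.
  have {}Hd : ecost beta d <= esize d * B ^ m by apply: le_scale Hd; lia.
  by have := expn_gt0 B m; rewrite B0 /=; nia.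
Qed.

Let unit_pos d u : 0 < B ^ d * Z ^ u.
Proof. by rewrite muln_gt0 !expn_gt0 B0 Z0. Qed.

Let le_scale2 a d d' u u' x : d <= d' -> u <= u' ->
  x <= a * (B ^ d * Z ^ u) -> x <= a * (B ^ d' * Z ^ u').
Proof.
move=> dd uu /leq_trans-> //.
by rewrite leq_mul2l leq_mul ?orbT // leq_pexp2l.
Qed.

Lemma scost_bound c :
  (forall x, cnt x -> ~~ big x -> beta x <= B) ->
  (forall x, cnt x -> big x -> beta x <= B * Z) ->
  wfs g cnt big c -> scost beta c <= ssize c * (B ^ sdepth c * Z ^ sbig big c).
Proof.
move=> bB bZ.
have He e : wfe g (predD cnt big) 0 e ->
    ecost beta e <= esize e * (B ^ edepth e * Z ^ 0).
  move=> we; rewrite expn0 muln1; apply: ecost_bound we.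
  by move=> x /andP[] /= ? ?; apply: bB.
elim: c => /=.
- by [].
- move=> x e /and3P[_ _ /He]; have := unit_pos (edepth e) 0; nia.
- move=> a i e /andP[/He Hi /He Hf].
  have {}Hi := le_scale2 (leq_maxl _ (edepth e)) (leqnn 0) Hi.
  have {}Hf := le_scale2 (leq_maxr (edepth i) _) (leqnn 0) Hf.
  have := unit_pos (maxn (edepth i) (edepth e)) 0; nia.
- move=> c1 IH1 c2 IH2 /andP[/IH1 H1 /IH2 H2].
  have {}H1 := le_scale2 (leq_maxl _ (sdepth c2)) (leq_maxl _ (sbig big c2)) H1.
  have {}H2 := le_scale2 (leq_maxr (sdepth c1) _) (leq_maxr (sbig big c1) _) H2.
  by rewrite mulnDl leq_add.
- move=> e c1 IH1 c2 IH2 /and3P[/He H0 /IH1 H1 /IH2 H2].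
  set d := maxn _ _; set u := maxn _ _.
  have {}H0 : ecost beta e <= esize e * (B ^ d * Z ^ u).
    by apply: le_scale2 H0; lia.
  have {}H1 : scost beta c1 <= ssize c1 * (B ^ d * Z ^ u).
    by apply: le_scale2 H1; lia.
  have {}H2 : scost beta c2 <= ssize c2 * (B ^ d * Z ^ u).
    by apply: le_scale2 H2; lia.
  have := unit_pos d u; nia.
- move=> x i c1 IH1 /and5P[_ cx _ _ /IH1 H1].
  have P := unit_pos (sdepth c1) (sbig big c1).
  have H2 : scost beta c1 + 6 <=
      (ssize c1 + 6) * (B ^ sdepth c1 * Z ^ sbig big c1) by nia.
  have bx : beta x <= B * Z ^ big x.
    case: (boolP (big x)) => hx; first by rewrite expn1 bZ.
    by rewrite expn0 muln1 bB.
  have := leq_mul bx H2; rewrite expnS expnD.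
  move: (B ^ _) (Z ^ sbig _ _) (Z ^ big x) P (unit_pos 0 (big x)) => b z y.
  rewrite expn0 mul1n => P Py.
  have -> : B * y * ((ssize c1 + 6) * (b * z)) =
    (ssize c1 + 6) * (B * b * (y * z)) by nia.
  have : 0 < B * b * (y * z) by rewrite !muln_gt0 in P Py *; lia.
  nia.
Qed.

End CostBound.

(** * Values of formulas, computed by the machine *)

Definition rW := 0.
Definition rK := 1.
Definition rM := 2.
Definition rP := 3.
Definition rT := 4.
Definition rD := 5.

Definition App1 f a := App f a (K 0) (K 0) (K 0).
Definition App2 f a b := App f a b (K 0) (K 0).
Definition App3 f a b c := App f a b c (K 0).
Definition eNeq a b := Plus (Minus a b) (Minus b a).

Definition eHalf :=
  It rD (K 0) (IfE (Minus (L 0) (Plus (L 5) (Plus (L 5) (K 1))))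
                 (Plus (L 4) (K 1)) (L 4)).
Definition eShr :=
  It rT (L 0) (IfE (Minus (L 1) (L 5)) (App1 eHalf (L 4)) (L 4)).
Definition eOdd := Minus (L 0) (Plus (App1 eHalf (L 0)) (App1 eHalf (L 0))).
Definition eBit := App1 eOdd (App2 eShr (L 0) (L 1)).
Definition ePow :=
  It rT (K 1) (IfE (Minus (L 0) (L 5)) (Plus (L 4) (L 4)) (L 4)).
Definition eMulK := It rK (K 0) (Plus (L 4) (L 0)).
Definition eDivK :=
  It rT (K 0) (IfE (Minus (App1 eMulK (Plus (L 5) (K 1))) (L 0))
                 (L 4) (Plus (L 4) (K 1))).
Definition eModK := Minus (L 0) (App1 eMulK (App1 eDivK (L 0))).
Definition eShrK :=
  It rK (L 0) (IfE (Minus (L 1) (L 5)) (App1 eDivK (L 4)) (L 4)).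
Definition eDig := App1 eModK (App2 eShrK (L 0) (L 1)).
Definition eLt :=
  IfE (Minus (App2 eDig (L 0) (L 2)) (App2 eDig (L 0) (L 1))) (K 1) (K 0).
Definition eViol :=
  It rK (K 0) (Plus (L 4) (It rK (K 0) (Plus (L 6)
    (IfE (eNeq (L 5) (L 0)) (IfE (eNeq (L 7) (L 0))
      (eNeq (App3 eLt (L 1) (L 5) (L 7)) (App3 eLt (L 2) (L 5) (L 7)))
      (K 0)) (K 0))))).
(* The bit e of the value of a node with symbol s, numbered as in tree_code,
   and arguments a, b (variables or values of the children). *)
Definition eBitop :=
  IfE (Minus (L 0) (K 6))
    (IfE (App2 eBit (L 1) (L 3)) (K 1) (App2 eBit (L 2) (L 3)))
  (IfE (Minus (L 0) (K 5))
    (IfE (App2 eBit (L 1) (L 3)) (App2 eBit (L 2) (L 3)) (K 0))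
  (IfE (Minus (L 0) (K 4))
    (It rT (K 0) (IfE (App3 eViol (L 1) (L 3) (L 5)) (L 4)
       (IfE (App2 eBit (L 2) (L 5)) (K 1) (L 4))))
  (IfE (Minus (L 0) (K 3))
    (IfE (It rT (K 0) (IfE (App3 eViol (L 1) (L 3) (L 5)) (L 4)
       (IfE (App2 eBit (L 2) (L 5)) (L 4) (K 1)))) (K 0) (K 1))
  (IfE (Minus (L 0) (K 2))
    (IfE (App2 eBit (L 1) (L 3)) (K 0) (K 1))
  (IfE (Minus (L 0) (K 1))
    (IfE (eNeq (App2 eDig (L 3) (L 1)) (App2 eDig (L 3) (L 2))) (K 0) (K 1))
    (App3 eLt (L 3) (L 1) (L 2))))))).
Definition eVal :=
  It rT (K 0) (Plus (L 4)
    (IfE (App eBitop (L 0) (L 1) (L 2) (L 5)) (App1 ePow (L 5)) (K 0))).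
Definition eMism :=
  It rK (K 0) (Plus (L 4) (It rK (K 0) (Plus (L 6)
    (eNeq (App3 eLt (L 1) (L 5) (L 7))
       (Rlt (Plus (App1 eMulK (L 0)) (L 5)) (Plus (App1 eMulK (L 0)) (L 7))))))).
Definition eHit :=
  It rT (K 0) (IfE (App2 eMism (L 0) (L 5)) (L 4)
    (IfE (App2 eBit (L 1) (L 5)) (K 1) (L 4))).
Definition eBad :=
  It rM (K 0) (Plus (L 4)
    (IfE (Minus (V rP) (L 5)) (IfE (App2 eHit (L 5) (L 0)) (K 0) (K 1))
       (App2 eHit (L 5) (L 0)))).

Definition bitn (v e : nat) : bool := odd (v %/ 2 ^ e).
Definition dig (k e i : nat) : nat := (e %/ k ^ i) %% k.
Definition dlt (k e i j : nat) : bool := dig k e i < dig k e j.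
(* The assignments e and f have the same order type on the variables
   distinct from the i-th one. *)
Definition near (k i e f : nat) : bool :=
  all (fun j => all (fun l =>
    [|| j == i, l == i | dlt k e j l == dlt k f j l]) (iota 0 k)) (iota 0 k).

Definition bitop (k T s a b e : nat) : bool :=
  match s with
  | 0 | 1 => dlt k e a b
  | 2 => dig k e a == dig k e b
  | 3 => ~~ bitn a e
  | 4 => all (fun f => near k a e f ==> bitn b f) (iota 0 T)
  | 5 => has (fun f => near k a e f && bitn b f) (iota 0 T)
  | 6 => bitn a e && bitn b e
  | _ => bitn a e || bitn b e
  end.

Definition valop (k T s a b : nat) : nat :=
  \sum_(e < T) bitop k T s a b e * 2 ^ e.

Definition fits (q : seq rat) (k j e : nat) : bool :=
  all (fun i => all (fun l =>
    dlt k e i l == (nth 0 q (j * k + i) < nth 0 q (j * k + l))%R)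
    (iota 0 k)) (iota 0 k).

Definition hit (q : seq rat) (k T j v : nat) : bool :=
  has (fun e => fits q k j e && bitn v e) (iota 0 T).

Definition accepts (q : seq rat) (k T m p v : nat) : bool :=
  all (fun j => hit q k T j v == (j < p)) (iota 0 m).

Lemma iteri_sum (f : nat -> nat -> nat) (g : nat -> nat) n :
  (forall i x, i < n -> f i x = x + g i) -> iteri n f 0 = \sum_(i < n) g i.
Proof.
elim: n => [|n IH] H; first by rewrite big_ord0.
by rewrite big_ord_recr /= -IH ?H // => i x ltin; apply: H; lia.
Qed.

Lemma iteri_has (f : nat -> nat -> nat) (P : pred nat) n :
  (forall i x, i < n -> f i x = if P i then 1 else x) ->
  iteri n f 0 = has P (iota 0 n).
Proof.
elim: n => [//|n IH] H.
rewrite -addn1 iotaD has_cat /= orbF addn1 /= H // IH //; last first.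
  by move=> i x ltin; apply: H; lia.
by case: (P _); rewrite ?orbT ?orbF.
Qed.

Lemma sum_all (f : nat -> nat) (P : pred nat) n :
  (forall i, i < n -> (f i == 0) = P i) ->
  (\sum_(i < n) f i == 0) = all P (iota 0 n).
Proof.
move=> H; rewrite sum_nat_eq0; apply/forallP/allP => [A i|A i].
  by rewrite mem_iota add0n => /andP[_ ltin]; rewrite -H //; apply: (A (Ordinal ltin)).
by apply/implyP=> _; rewrite H // A // mem_iota /= add0n.
Qed.

Lemma valop_lt k T s a b : valop k T s a b < 2 ^ T.
Proof.
rewrite /valop; elim: T (bitop k T s a b) => [|T IH] F; first by rewrite big_ord0.
rewrite big_ord_recr expnS mul2n -addnn /=.
rewrite -addSn leq_add //.
by case: (F T); rewrite ?mul1n ?mul0n.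
Qed.

Lemma bitn_sum (F : nat -> bool) T e :
  e < T -> bitn (\sum_(i < T) F i * 2 ^ i) e = F e.
Proof.
rewrite /bitn; elim: e T F => [|e IH] [//|T] F ltT.
  rewrite expn0 divn1 big_ord_recl expn0 muln1 oddD /=.
  rewrite (_ : odd (\sum_(i < T) _) = false) ?addbF ?oddb //.
  elim: T {ltT} => [|T IH]; first by rewrite big_ord0.
  by rewrite big_ord_recr /= oddD IH oddM expnS oddM /= andbF.
rewrite big_ord_recl /= expn0 muln1 expnS divnMA.
rewrite (_ : \sum_(i < T) _ = 2 * \sum_(i < T) F i.+1 * 2 ^ i); last first.
  rewrite big_distrr /=; apply: eq_bigr => i _.
  by rewrite /bump add1n expnS; lia.
rewrite divnDr ?dvdn_mulr // mulKn // (_ : F 0 %/ 2 = 0) ?add0n; last by case: (F 0).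
exact: (IH T (fun i => F i.+1)).
Qed.

Lemma bitn_valop k T s a b e : e < T -> bitn (valop k T s a b) e = bitop k T s a b e.
Proof. exact: bitn_sum. Qed.

Section EvalSpec.
Variables (q : seq rat) (h : state) (k T m p : nat).
Hypotheses (hK : reg h rK = k) (hT : reg h rT = T) (hD : reg h rD = 2 ^ T).
Hypotheses (hM : reg h rM = m) (hP : reg h rP = p) (TE : T = k ^ k).

Notation ev := (eval q h).

Lemma iteri_half v n : iteri n (fun i x => if v - (i + (i + 1)) != 0 then x + 1 else x) 0
  = minn n v./2.
Proof.
have := odd_double_half v; case: (odd v) => vE;
  elim: n => [|n /= ->]; try (by rewrite min0n); case: ifP; lia.
Qed.

Lemma eval_half v b c d : v <= 2 ^ T -> ev [:: v; b; c; d] eHalf = v./2.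
Proof.
move=> vT /=; rewrite hD iteri_half; lia.
Qed.
Opaque eHalf.

Lemma iteri_lt (f : nat -> nat) e n x :
  iteri n (fun i acc => if e - i != 0 then f acc else acc) x
  = iter (minn n e) f x.
Proof.
elim: n => [|n IH] /=; first by rewrite min0n.
rewrite IH; case: ifP => en; last by congr iter; lia.
have -> : minn n.+1 e = n.+1 by lia.
by have -> : minn n e = n by lia.
Qed.

Lemma iter_half v e : iter e half v = v %/ 2 ^ e.
Proof.
elim: e => [|e IH]; first by rewrite divn1.
by rewrite iterS IH expnSr divnMA -divn2.
Qed.

Lemma eval_shr v e c d : v <= 2 ^ T -> e <= T -> ev [:: v; e; c; d] eShr = v %/ 2 ^ e.
Proof.
move=> vT eT; rewrite -iter_half /= hT.
pose f x := ev [:: x; 0; 0; 0] eHalf.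
rewrite (iteri_lt f) (minn_idPr eT).
elim: e {eT} => //= e ->; rewrite /f eval_half //.
by rewrite iter_half (leq_trans (leq_div _ _)).
Qed.
Opaque eShr.

Lemma eval_bit v e c d : v < 2 ^ T -> e < T -> ev [:: v; e; c; d] eBit = bitn v e.
Proof.
move=> vT eT /=; rewrite eval_shr //=; try lia.
rewrite /bitn; have : v %/ 2 ^ e <= 2 ^ T by rewrite (leq_trans (leq_div _ _)) // ltnW.
move: (v %/ _) => u uT; rewrite eval_half //; lia.
Qed.
Opaque eBit.

Lemma eval_pow e b c d : e <= T -> ev [:: e; b; c; d] ePow = 2 ^ e.
Proof.
move=> eT /=; rewrite hT (iteri_lt (fun x => x + x)) (minn_idPr eT).
by elim: e {eT} => //= e ->; rewrite expnS; lia.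
Qed.
Opaque ePow.

Lemma eval_mulK j b c d : ev [:: j; b; c; d] eMulK = j * k.
Proof. by rewrite /= hK; elim: k => [|n /= ->]; rewrite ?muln0 // mulnS addnC. Qed.
Opaque eMulK.

Lemma eval_divK e b c d : 0 < k -> e < T -> ev [:: e; b; c; d] eDivK = e %/ k.
Proof.
move=> k0 eT /=; rewrite hT.
rewrite (@eq_iteri _ _ (fun i x => if e %/ k <= i then x else x + 1)); last first.
  by move=> i x; rewrite eval_mulK addn1 subn_eq0 -ltnNge -ltn_divLR // ltnS.
have uT : e %/ k <= T by rewrite (leq_trans (leq_div _ _)) // ltnW.
suff -> n u : iteri n (fun i x => if u <= i then x else x + 1) 0 = minn n u by lia.
by elim: n => [|n /= ->]; [rewrite min0n | case: leqP; lia].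
Qed.
Opaque eDivK.

Lemma eval_modK e b c d : 0 < k -> e < T -> ev [:: e; b; c; d] eModK = e %% k.
Proof.
move=> k0 eT /=; rewrite eval_divK // eval_mulK {1}(divn_eq e k); lia.
Qed.
Opaque eModK.

Lemma iter_divK e i : iter i (fun x => x %/ k) e = e %/ k ^ i.
Proof.
elim: i => [|i IH]; first by rewrite divn1.
by rewrite iterS IH expnSr divnMA.
Qed.

Lemma eval_shrK e i c d : 0 < k -> e < T -> i <= k ->
  ev [:: e; i; c; d] eShrK = e %/ k ^ i.
Proof.
move=> k0 eT ik; rewrite -iter_divK /= hK.
pose f x := ev [:: x; 0; 0; 0] eDivK.
rewrite (iteri_lt f) (minn_idPr ik).
elim: i {ik} => //= i ->; rewrite /f eval_divK //.
by rewrite iter_divK (leq_ltn_trans (leq_div _ _)).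
Qed.
Opaque eShrK.

Lemma eval_dig e i c d : e < T -> (k == 0) || (i < k) ->
  ev [:: e; i; c; d] eDig = dig k e i.
Proof.
move=> eT /orP[/eqP k0|ik] /=; last first.
  rewrite eval_shrK ?eval_modK //; try lia.
  by rewrite (leq_ltn_trans (leq_div _ _)).
have -> : e = 0 by move: eT; rewrite TE k0; lia.
Transparent eShrK eModK.
by rewrite /= hK k0 /= /dig div0n mod0n.
Qed.
Opaque eShrK eModK eDig.

Lemma eval_lt e i j d : e < T -> (k == 0) || (i < k) && (j < k) ->
  ev [:: e; i; j; d] eLt = dlt k e i j.
Proof.
move=> eT ijk.
have [ik jk] : (k == 0) || (i < k) /\ (k == 0) || (j < k).
  by move: ijk; case: (k == 0) => //= /andP[].
by rewrite /= !eval_dig // subn_eq0 -ltnNge /dlt; case: ifP.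
Qed.
Opaque eLt.

Lemma neq0 (a b : bool) : (a - b + (b - a) == 0) = (a == b).
Proof. by case: a; case: b. Qed.

Lemma neqn0 (a b : nat) : (a - b + (b - a) == 0) = (a == b).
Proof. lia. Qed.

Lemma double_sum_all (f : nat -> nat -> nat) (P : nat -> pred nat) :
  (forall i j, i < k -> j < k -> (f i j == 0) = P i j) ->
  (iteri k (fun i x => x + iteri k (fun j y => y + f i j) 0) 0 == 0)
  = all (fun i => all (P i) (iota 0 k)) (iota 0 k).
Proof.
move=> H; rewrite (iteri_sum (g := fun i => iteri k (fun j y => y + f i j) 0)) //.
apply: (@sum_all (fun i => iteri k (fun j y => y + f i j) 0)
  (fun i => all (P i) (iota 0 k))) => i ik.
rewrite (iteri_sum (g := f i)) //.
by apply: (@sum_all (f i) (P i)) => j jk; apply: H.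
Qed.

Lemma eval_viol i e f d : e < T -> f < T ->
  (ev [:: i; e; f; d] eViol == 0) = near k i e f.
Proof.
move=> eT fT /=; rewrite hK.
rewrite (double_sum_all (P := fun j l =>
  [|| j == i, l == i | dlt k e j l == dlt k f j l])) // => j l jk lk.
rewrite !neqn0; case: (j == i) => //=; case: (l == i) => //=.
by rewrite !eval_lt ?jk ?lk ?orbT // neq0.
Qed.
Opaque eViol.

Definition arg_ok s a b :=
  match s with
  | 0 | 1 | 2 => (k == 0) || (a < k) && (b < k)
  | 3 => a < 2 ^ T
  | 4 | 5 => b < 2 ^ T
  | _ => (a < 2 ^ T) && (b < 2 ^ T)
  end.

Lemma eval_bitop s a b e : e < T -> arg_ok s a b ->
  ev [:: s; a; b; e] eBitop = bitop k T s a b e.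
Proof.
move=> eT ok.
have [s7|s7] := ltnP 6 s.
  have [[aT bT] ->] : (a < 2 ^ T /\ b < 2 ^ T) /\
      bitop k T s a b e = bitn a e || bitn b e.
    by case: s s7 ok => [|[|[|[|[|[|[|s]]]]]]] //= _ /andP.
  rewrite /= subn_eq0 -ltnNge s7 !eval_bit //; by case: (bitn a e).
case: s s7 ok => [|[|[|[|[|[|[|//]]]]]]] _ ok; rewrite /bitop /= ?hT.
- by rewrite eval_lt.
- by rewrite eval_lt.
- have [ak bk] : (k == 0) || (a < k) /\ (k == 0) || (b < k).
    by move: ok => /=; case: (k == 0) => //= /andP[].
  by rewrite !eval_dig // neqn0; case: eqP.
- by rewrite eval_bit //; case: bitn.
- rewrite (iteri_has (P := fun f => ~~ (near k a e f ==> bitn b f))).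
    by rewrite has_predC; case: all.
  move=> f x fT; rewrite eval_viol // eval_bit // negb_imply.
  by case: near => //=; case: bitn.
- rewrite (iteri_has (P := fun f => near k a e f && bitn b f)) //.
  move=> f x fT; rewrite eval_viol // eval_bit //.
  by case: near => //=; case: bitn.
- case/andP: ok => aT bT; rewrite !eval_bit //; by case: (bitn a e).
Qed.
Opaque eBitop.

Lemma eval_val s a b d : arg_ok s a b -> ev [:: s; a; b; d] eVal = valop k T s a b.
Proof.
move=> ok /=; rewrite hT (iteri_sum (g := fun e => bitop k T s a b e * 2 ^ e)) //.
move=> e x eT; rewrite eval_bitop // eval_pow ?(ltnW eT) //.
by case: bitop; rewrite ?mul1n ?mul0n.
Qed.
Opaque eVal.

Lemma eval_mism j e c d : e < T -> (ev [:: j; e; c; d] eMism == 0) = fits q k j e.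
Proof.
move=> eT /=; rewrite hK.
rewrite (double_sum_all (P := fun i l => dlt k e i l ==
   (nth 0 q (j * k + i) < nth 0 q (j * k + l))%R)) // => i l ik lk.
by rewrite !eval_lt ?ik ?lk ?orbT // !eval_mulK neq0.
Qed.
Opaque eMism.

Lemma eval_hit j v c d : v < 2 ^ T -> ev [:: j; v; c; d] eHit = hit q k T j v.
Proof.
move=> vT /=; rewrite hT (iteri_has (P := fun e => fits q k j e && bitn v e)) //.
move=> e x eT; rewrite eval_mism // eval_bit //.
by case: fits => //=; case: bitn.
Qed.
Opaque eHit.

Lemma eval_bad v b c d : v < 2 ^ T ->
  (ev [:: v; b; c; d] eBad == 0) = accepts q k T m p v.
Proof.
move=> vT /=; rewrite hM hP.
rewrite (iteri_sum (g := fun j => hit q k T j v != (j < p) : nat)); last first.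
  move=> j x jm; rewrite eval_hit // subn_eq0 -ltnNge.
  by case: (j < p) => //=; case: hit.
apply: (@sum_all (fun j => hit q k T j v != (j < p) : nat)
  (fun j => hit q k T j v == (j < p))) => j _.
by case: (hit q k T j v == _).
Qed.
Opaque eBad.

End EvalSpec.

(** * Order types *)

Import Order.TTheory GRing.Theory Num.Theory.

Definition same_order (k : nat) (v w : 'I_k -> rat) : Prop :=
  forall j l, (v j < v l)%R = (w j < w l)%R.

Lemma rat_between (s t : seq rat) :
  (forall x y, x \in s -> y \in t -> (x < y)%R) ->
  exists a, (forall x, x \in s -> (x < a)%R) /\ (forall y, y \in t -> (a < y)%R).
Proof.
elim: s t => [|x s IH] t H.
  elim: t {H} => [|y t [a [_ Ha]]]; first by exists 0%R.
  exists (Num.min a y - 1)%R; split=> // z; rewrite inE => /orP[/eqP->|zt].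
    by rewrite ltrBlDr ltr_pwDr // ge_min lexx orbT.
  by rewrite (lt_trans _ (Ha _ zt)) // ltrBlDr ltr_pwDr // ge_min lexx.
have [|a [Ha1 Ha2]] := IH t.
  by move=> u y us; apply: H; rewrite inE us orbT.
have : exists b, [/\ (x < b)%R, (a <= b)%R
    & forall y, y \in t -> (b < y)%R].
  have [xa|ax] := ltP x a; first by exists a; split.
  have : forall y, y \in t -> (x < y)%R by move=> y; apply: H; rewrite inE eqxx.
  elim: t {H} Ha2 => [|y t IHt] Ha2 Hx.
    by exists (x + 1)%R; split=> //; rewrite ?ltrDl // (le_trans ax) // lerDl.
  have [z zt|z zt|b [b1 b2 b3]] := IHt.
  - by apply: Ha2; rewrite inE zt orbT.
  - by apply: Hx; rewrite inE zt orbT.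
  have xy : (x < y)%R by apply: Hx; rewrite inE eqxx.
  have xm : (x < Num.min b y)%R by rewrite lt_min b1.
  exists ((x + Num.min b y) / 2%:R)%R; have [m1 m2] := midf_lt xm; split=> //.
    exact: le_trans ax (ltW m1).
  move=> z; rewrite inE => /orP[/eqP->|zt]; apply: (lt_le_trans m2).
    by rewrite ge_min lexx orbT.
  by rewrite ge_min (ltW (b3 _ zt)).
move=> [b [b1 b2 b3]]; exists b; split=> // z; rewrite inE => /orP[/eqP->//|zs].
exact: lt_le_trans (Ha1 _ zs) b2.
Qed.

(* (Q, <) is dense and without endpoints: a partial isomorphism between finite
   sets extends by one point. *)
Lemma same_order_extend (k : nat) (i : 'I_k) (v w : 'I_k -> rat) :
  (forall j l, j != i -> l != i -> (v j < v l)%R = (w j < w l)%R) ->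
  exists a, same_order v (assign w i a).
Proof.
move=> H.
case: (pickP (fun j => (j != i) && (v j == v i))) => [j0 /andP[j0i /eqP vj0]|no].
  exists (w j0) => j l; rewrite /assign; case: (eqVneq j i) => [->|ji];
    case: (eqVneq l i) => [->|li]; rewrite -?vj0 ?ltxx // H //.
have [|a [Ha1 Ha2]] := @rat_between [seq w j | j <- enum 'I_k & (j != i) && (v j < v i)%R]
  [seq w j | j <- enum 'I_k & (j != i) && (v i < v j)%R].
  move=> x y /mapP[j]; rewrite mem_filter => /andP[/andP[ji vj] _] ->.
  move=> /mapP[l]; rewrite mem_filter => /andP[/andP[li vl] _] ->.
  by rewrite -H //; apply: lt_trans vj vl.
have lo j : j != i -> (v j < v i)%R -> (w j < a)%R.
  move=> ji vj; apply: Ha1; apply/mapP; exists j => //.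
  by rewrite mem_filter ji vj mem_enum.
have hi j : j != i -> (v i < v j)%R -> (a < w j)%R.
  move=> ji vj; apply: Ha2; apply/mapP; exists j => //.
  by rewrite mem_filter ji vj mem_enum.
exists a => j l; rewrite /assign; case: (eqVneq j i) => [->|ji];
  case: (eqVneq l i) => [->|li]; rewrite ?ltxx //; last exact: H.
- have := no l; rewrite li /=.
  case: (ltgtP (v i) (v l)) => // vl _; first by rewrite hi.
  by rewrite lt_gtF // lo.
- have := no j; rewrite ji /=.
  case: (ltgtP (v j) (v i)) => // vj _; first by rewrite lo.
  by rewrite lt_gtF // hi.
Qed.

Lemma same_order_assign (k : nat) (v w : 'I_k -> rat) i a :
  same_order v w -> exists b, same_order (assign v i a) (assign w i b).
Proof.
move=> vw; apply: same_order_extend => j l ji li.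
by rewrite /assign (negPf ji) (negPf li).
Qed.

Lemma same_order_sym (k : nat) (v w : 'I_k -> rat) :
  same_order v w -> same_order w v.
Proof. by move=> H j l. Qed.

Lemma sat_same_order (k : nat) (f : formula k) v w :
  same_order v w -> sat v f <-> sat w f.
Proof.
suff H : forall v w, same_order v w -> sat v f -> sat w f.
  by move=> vw; split; apply: H => //; apply: same_order_sym.
elim: f {v w} => [[]|[i j|i j]|[|i|i] f IH|[] f IHf g IHg] v w vw /=.
- by rewrite vw.
- move=> vij; apply/eqP; rewrite eq_le !leNgt -!vw vij ltxx //.
- by move=> nv wf; apply: nv; apply: IH wf; apply: same_order_sym.
- move=> all b; have [a ab] := @same_order_assign _ w v i b (same_order_sym vw).
  exact: IH (same_order_sym ab) (all a).
- case=> a va; have [b ab] := @same_order_assign _ v w i a vw.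
  by exists b; apply: IH ab va.
- by case=> vf vg; split; [apply: IHf vf|apply: IHg vg].
- by case=> [vf|vg]; [left; apply: IHf vf|right; apply: IHg vg].
Qed.

Fixpoint vals (k d T : nat) (f : formula k) : nat :=
  match f with
  | Leaf e => match e with end
  | Atom (Lt i j) => valop d T 1 i j
  | Atom (Eq i j) => valop d T 2 i j
  | Un Not f => valop d T 3 (vals d T f) 0
  | Un (All i) f => valop d T 4 i (vals d T f)
  | Un (Ex i) f => valop d T 5 i (vals d T f)
  | Bin And f g => valop d T 6 (vals d T f) (vals d T g)
  | Bin Or f g => valop d T 7 (vals d T f) (vals d T g)
  end.

Lemma vals_lt k d T (f : formula k) : vals d T f < 2 ^ T.
Proof. by case: f => [[]|[]|[]|[]] *; apply: valop_lt. Qed.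

Section OrderTypes.
Variable k : nat.

Definition point (e : nat) (i : 'I_k) : rat := ((dig k e i)%:R)%R.

Lemma point_lt e i j : (point e i < point e j)%R = dlt k e i j.
Proof. by rewrite /point ltr_nat. Qed.

Lemma digits n (r : nat -> nat) : (forall i, i < n -> r i < k) ->
  exists2 e, e < k ^ n & forall i, i < n -> dig k e i = r i.
Proof.
elim: n r => [|n IH] r Hr; first by exists 0.
have [i ltin|e ltek He] := IH (fun i => r i.+1); first exact: Hr.
have r0 : r 0 < k by apply: Hr.
exists (e * k + r 0).
  rewrite expnSr; have := leq_mul ltek (leqnn k); lia.
case=> [|i] ltin; rewrite /dig.
  by rewrite expn0 divn1 modnMDl modn_small.
rewrite expnS divnMA divnMDl ?(divn_small r0) ?addn0; last lia.
exact: He.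
Qed.

Lemma order_type (v : 'I_k -> rat) :
  exists2 e, e < k ^ k & same_order v (point e).
Proof.
pose r (x : rat) := #|[set j : 'I_k | (v j < x)%R]|.
have rk i : r (v i) < k.
  rewrite -[X in _ < X]card_ord -cardsT; apply: proper_card.
  by rewrite properT; apply/negP => /eqP/setP/(_ i); rewrite !inE ltxx.
pose r' i := if insub i is Some j then r (v j) else 0.
have [i ltin|e ltek He] := @digits k r'.
  by rewrite /r' insubT.
exists e => // j l; rewrite point_lt /dlt !He // /r' !valK.
have mono x y : (x <= y)%R -> r x <= r y.
  move=> xy; apply: subset_leq_card; apply/subsetP=> z; rewrite !inE => zx.
  exact: lt_le_trans xy.
have [vjl|vlj] := ltP (v j) (v l); last by have := mono _ _ vlj; lia.
symmetry; apply: proper_card; apply/properP; split.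
  by apply/subsetP=> z; rewrite !inE => /lt_trans; apply.
by exists j; rewrite !inE ?ltxx.
Qed.

Lemma nearP (i : 'I_k) e f :
  reflect (forall j l : 'I_k, j != i -> l != i -> dlt k e j l = dlt k f j l)
    (near k i e f).
Proof.
apply: (iffP allP) => [H j l ji li|H j].
  have /allP/(_ (val l)) : all (fun l : nat => [|| val j == i, l == i
      | dlt k e j l == dlt k f j l]) (iota 0 k).
    by apply: H; rewrite mem_iota /= ltn_ord.
  rewrite mem_iota /= ltn_ord => /(_ isT).
  by rewrite !val_eqE (negPf ji) (negPf li) => /eqP.
rewrite mem_iota /= add0n => jk; apply/allP => l.
rewrite mem_iota /= add0n => lk.
have := H (Ordinal jk) (Ordinal lk); rewrite -!val_eqE /=.
by case: eqP => //= _; case: eqP => //= _ ->.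
Qed.

Lemma near_assign (i : 'I_k) e f :
  near k i e f -> exists a, same_order (point f) (assign (point e) i a).
Proof.
move=> /nearP H; apply: same_order_extend => j l ji li.
by rewrite !point_lt H.
Qed.

Lemma assign_near (i : 'I_k) e a : exists f,
  [/\ f < k ^ k, near k i e f & same_order (assign (point e) i a) (point f)].
Proof.
have [f ltf Hf] := order_type (assign (point e) i a).
exists f; split=> //; apply/nearP => j l ji li.
by rewrite -!point_lt -Hf /assign (negPf ji) (negPf li).
Qed.

Lemma vals_sat (f : formula k) e :
  e < k ^ k -> bitn (vals k (k ^ k) f) e <-> sat (point e) f.
Proof.
elim: f e => [[]|[i j|i j]|[|i|i] f IH|[] f IHf g IHg] e ltek /=;
  rewrite bitn_valop //=.
- by rewrite -point_lt.
- rewrite /point; split=> [/eqP->//|/eqP]; by rewrite eqr_nat.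
- by rewrite -IH //; split=> /negP.
- split=> [/allP H a|H].
    have [f' [lt' nf same]] := assign_near i e a.
    apply/(sat_same_order f same)/IH => //.
    have : f' \in iota 0 (k ^ k) by rewrite mem_iota.
    by move/H; rewrite nf.
  apply/allP => f'; rewrite mem_iota /= add0n => lt'; apply/implyP => nf.
  have [a same] := near_assign nf.
  by apply/IH => //; apply/(sat_same_order f same).
- split=> [/hasP[f']|[a Ha]].
    rewrite mem_iota /= add0n => lt' /andP[nf bf].
    have [a same] := near_assign nf.
    by exists a; apply/(sat_same_order f same)/IH.
  have [f' [lt' nf same]] := assign_near i e a.
  apply/hasP; exists f'; first by rewrite mem_iota.
  by rewrite nf; apply/IH => //; apply/(sat_same_order f same).
- by rewrite -IHf // -IHg //; split=> /andP.
- by rewrite -IHf // -IHg //; split=> /orP.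
Qed.

Variables (P N : seq (k.-tuple rat)).

Lemma nth_input (j : nat) (t0 : k.-tuple rat) (i : 'I_k) :
  j < size (P ++ N) ->
  nth 0%R (input_rats P N) (j * k + i) = tnth (nth t0 (P ++ N) j) i.
Proof.
rewrite /input_rats; elim: (P ++ N) j => [//|t s IH] [|j] /= ltj.
  by rewrite nth_cat size_tuple ltn_ord (tnth_nth 0%R).
rewrite nth_cat size_tuple mulSn -addnA ifF ?addKn ?IH //.
by rewrite ltnNge leq_addr.
Qed.

Lemma hit_sat (f : formula k) j t0 : j < size (P ++ N) ->
  hit (input_rats P N) k (k ^ k) j (vals k (k ^ k) f)
    <-> sat (tnth (nth t0 (P ++ N) j)) f.
Proof.
move=> ltj; set t := nth _ _ _.
have fitsP e : fits (input_rats P N) k j e <-> same_order (tnth t) (point e).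
  split=> [/allP H a b|H].
    have /allP/(_ (val b)) : all (fun l : nat => dlt k e a l ==
        (nth 0 (input_rats P N) (j * k + a)
           < nth 0 (input_rats P N) (j * k + l))%R) (iota 0 k).
      by apply: H; rewrite mem_iota /= ltn_ord.
    rewrite mem_iota /= ltn_ord => /(_ isT).
    by rewrite !(nth_input t0) // point_lt => /eqP.
  apply/allP => a; rewrite mem_iota /= add0n => ak.
  apply/allP => b; rewrite mem_iota /= add0n => bk.
  rewrite (@nth_input j t0 (Ordinal ak)) // (@nth_input j t0 (Ordinal bk)) //.
  by rewrite H point_lt.
split=> [/hasP[e]|ts].
  rewrite mem_iota /= add0n => lte /andP[/fitsP same be].
  by apply/(sat_same_order f same)/vals_sat.
have [e lte same] := order_type (tnth t).
apply/hasP; exists e; first by rewrite mem_iota.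
by apply/andP; split; [apply/fitsP|apply/vals_sat/(sat_same_order f same)].
Qed.

Lemma accepts_consistent (f : formula k) :
  accepts (input_rats P N) k (k ^ k) (size P + size N) (size P)
    (vals k (k ^ k) f) <-> consistent P N f.
Proof.
split=> [/allP H|[HP HN]].
  have H' j : j < size (P ++ N) -> hit (input_rats P N) k (k ^ k) j
      (vals k (k ^ k) f) = (j < size P).
    by rewrite size_cat => ltj; apply/eqP/H; rewrite mem_iota.
  split=> t tin.
    have [j ltj E] := nthP t tin.
    have ltj' : j < size (P ++ N) by rewrite size_cat ltn_addr.
    by have := H' j ltj'; rewrite ltj => /(hit_sat f t ltj'); rewrite nth_cat ltj E.
  have [j ltj E] := nthP t tin.
  have ltj' : size P + j < size (P ++ N) by rewrite size_cat ltn_add2l.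
  move=> st; have := H' _ ltj'.
  rewrite ltnNge leq_addr /= => /negP; apply; apply/(hit_sat f t ltj').
  by rewrite nth_cat ltnNge leq_addr /= addKn E.
apply/allP=> j; rewrite mem_iota /= add0n -size_cat => ltj.
have [t0 _] : exists t0 : k.-tuple rat, true by case: (P ++ N) ltj => // t0 *; exists t0.
have := hit_sat f t0 ltj; rewrite nth_cat; case: ltnP => jP E.
  by apply/eqP/E/HP; rewrite mem_nth.
apply/eqP; apply/negP => /E; apply: HN.
by rewrite mem_nth // ltn_subLR // -size_cat.
Qed.

End OrderTypes.

(** * Derivations and the layout of the grammar in the input word *)

Section Derivation.
Variables (k : nat) (G : grammar k).
Local Notation T := (tree k 'I_(nonterms G)).

Inductive derives : T -> formula k -> Prop :=
  | derives_leaf A t f : (A, t) \in prods G -> derives t f -> derives (Leaf A) f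
  | derives_atom a : derives (Atom a) (Atom a)
  | derives_un u t f : derives t f -> derives (Un u t) (Un u f)
  | derives_bin b t1 t2 f1 f2 :
      derives t1 f1 -> derives t2 f2 -> derives (Bin b t1 t2) (Bin b f1 f2).

Lemma language_derives (f : formula k) : language G f <-> derives (Leaf (start G)) f.
Proof.
split=> [H|].
  have back t t' g : @rewrites k G t t' -> derives t' g -> derives t g.
    move=> r; elim: r g => {t t'} [A t tin|u t t' _ IH|b t1 t1' t2 _ IH
      |b t1 t2 t2' _ IH] g d.
    - exact: derives_leaf tin d.
    - by inversion d; subst; apply: derives_un; apply: IH.
    - by inversion d; subst; apply: derives_bin => //; apply: IH.
    - by inversion d; subst; apply: derives_bin => //; apply: IH.
  have self : derives (tree_map (of_void _) f) f.
    by elim: f {H} => [[]|a|u f IH|b f IHf g IHg] /=; constructor.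
  have gen t t' : clos_refl_trans _ (@rewrites k G) t t' ->
      forall g, derives t' g -> derives t g.
    elim=> {t t'} [t t' r g|t //|t1 t2 t3 _ IH1 _ IH2 g d]; first exact: back r.
    exact: IH1 (IH2 _ d).
  exact: gen H _ self.
have lift (c : T -> T) : (forall t t', rewrites t t' -> rewrites (c t) (c t')) ->
    forall t t', clos_refl_trans _ (@rewrites k G) t t' ->
    clos_refl_trans _ (@rewrites k G) (c t) (c t').
  move=> H t t'; elim=> {t t'} [t t' r|t|t1 t2 t3 _ H1 _ H2].
  - by apply: rt_step; apply: H.
  - exact: rt_refl.
  - exact: rt_trans H1 H2.
rewrite /language; elim=> {f} [A t f tin _ IH|a|u t f _ IH|b t1 t2 f1 f2 _ IH1 _ IH2].
- by apply: rt_trans IH; apply: rt_step; apply: rewrites_prod.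
- exact: rt_refl.
- by apply: (lift (Un u)) IH => t' t''; apply: rewrites_un.
- apply: (@rt_trans _ _ _ (Bin b (tree_map (of_void _) f1) t2)).
    by apply: (lift (fun t => Bin b t t2)) IH1 => t' t''; apply: rewrites_binl.
  by apply: (lift (Bin b _)) IH2 => t' t''; apply: rewrites_binr.
Qed.

End Derivation.

Section Layout.
Variables (k n W : nat).
Local Notation T := (tree k 'I_n).

Definition clen (t : T) : nat := size (tree_code t).

Definition uoff (u : unop k) : nat := if u is Not then 1 else 2.

Definition ucode (u : unop k) : seq nat :=
  match u with
  | Not => [:: 3]
  | All i => [:: 4; val i]
  | Ex i => [:: 5; val i]
  end.

Definition bcode (b : binop) : nat := if b is And then 6 else 7.

Lemma tree_code_un u (t : T) : tree_code (Un u t) = ucode u ++ tree_code t.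
Proof. by case: u. Qed.

Lemma tree_code_bin b (t1 t2 : T) :
  tree_code (Bin b t1 t2) = bcode b :: tree_code t1 ++ tree_code t2.
Proof. by case: b. Qed.

Lemma clen_un u t : clen (Un u t) = uoff u + clen t.
Proof. by rewrite /clen tree_code_un size_cat; case: u. Qed.

Lemma clen_bin b t1 t2 : clen (Bin b t1 t2) = (clen t1 + clen t2).+1.
Proof. by rewrite /clen tree_code_bin /= size_cat. Qed.

Lemma clen_gt0 t : 0 < clen t.
Proof. by case: t => [?|[]|[]|[]]. Qed.

Lemma tree_size_clen t : tree_size t <= clen t.
Proof.
elim: t => [//|[]//|u t IH|b t1 IH1 t2 IH2].
  by rewrite clen_un /=; case: u => *; rewrite /uoff; lia.
by rewrite clen_bin /=; lia.
Qed.

Lemma clen_tree_size t : clen t <= 3 * tree_size t.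
Proof.
elim: t => [//|[]//|u t IH|b t1 IH1 t2 IH2].
  by rewrite clen_un /=; case: u => *; rewrite /uoff; lia.
by rewrite clen_bin /=; lia.
Qed.

(* The subtrees of t with their positions and the positions of their parents,
   when the code of t starts at position x. *)
Fixpoint nodes (t : T) (x p : nat) : seq (nat * (T * nat)) :=
  (x, (t, p)) ::
  match t with
  | Leaf _ | Atom _ => [::]
  | Un u t1 => nodes t1 (x + uoff u) x
  | Bin b t1 t2 => nodes t1 x.+1 x ++ nodes t2 (x.+1 + clen t1) x
  end.

Fixpoint allnodes (ps : seq ('I_n * T)) (x : nat) : seq (nat * (T * nat)) :=
  if ps is (A, t) :: ps' then
    nodes t x.+1 (W + A) ++ allnodes ps' (x.+1 + clen t)
  else [::].

Definition prods_code (ps : seq ('I_n * T)) : seq nat :=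
  flatten [seq val p.1 :: tree_code p.2 | p <- ps].

Lemma nodes_range t x p y s r :
  (y, (s, r)) \in nodes t x p -> x <= y /\ y + clen s <= x + clen t.
Proof.
elim: t x p => [A|a|u t IH|b t1 IH1 t2 IH2] x p /=; rewrite inE.
- by move=> /eqP[-> -> _].
- by move=> /eqP[-> -> _].
- case/orP=> [/eqP[-> -> _] //|/IH]; rewrite clen_un; lia.
- case/orP=> [/eqP[-> -> _] //|]; rewrite mem_cat clen_bin.
  by case/orP => [/IH1|/IH2]; lia.
Qed.

Lemma nodes_fst_range t x p y :
  y \in map fst (nodes t x p) -> x <= y < x + clen t.
Proof.
case/mapP=> -[z [s r]] /nodes_range H /= ->; have := clen_gt0 s; lia.
Qed.

Lemma nodes_uniq t x p : uniq (map fst (nodes t x p)).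
Proof.
elim: t x p => [A|a|u t IH|b t1 IH1 t2 IH2] x p //=.
  rewrite IH andbT; apply/negP => /nodes_fst_range.
  by case: u => [|i|i] /=; lia.
rewrite map_cat cat_uniq IH1 IH2 mem_cat andbT /=; apply/andP; split.
  by apply/negP => /orP[] /nodes_fst_range; lia.
by apply/hasPn => y /nodes_fst_range yr; apply/negP => /nodes_fst_range; lia.
Qed.

Lemma allnodes_range ps x y s r :
  (y, (s, r)) \in allnodes ps x -> x < y /\ y + clen s <= x + size (prods_code ps).
Proof.
elim: ps x => [//|[A t] ps IH] x /=.
rewrite mem_cat /prods_code /= size_cat -/(clen t) -/(prods_code ps).
by case/orP=> [/nodes_range|/IH]; lia.
Qed.

Lemma allnodes_fst_range ps x y :
  y \in map fst (allnodes ps x) -> x < y < x + size (prods_code ps).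
Proof.
case/mapP=> -[z [s r]] /allnodes_range H /= ->; have := clen_gt0 s; lia.
Qed.

Lemma allnodes_uniq ps x : uniq (map fst (allnodes ps x)).
Proof.
elim: ps x => [//|[A t] ps IH] x /=; rewrite map_cat cat_uniq nodes_uniq IH andbT.
apply/hasPn => y /allnodes_fst_range yr; apply/negP => /nodes_fst_range; lia.
Qed.

Lemma nodes_head t x p : (x, (t, p)) \in nodes t x p.
Proof. by case: t => *; rewrite inE eqxx. Qed.

Lemma nodes_un u t x p y r t0 :
  (y, (Un u t, r)) \in nodes t0 x p -> (y + uoff u, (t, y)) \in nodes t0 x p.
Proof.
elim: t0 x p => [A|a|v t' IH|b t1 IH1 t2 IH2] x p; rewrite /= inE;
  try by case/eqP.
  case/orP=> [/eqP[-> -> -> _]|/IH H]; rewrite inE ?nodes_head ?orbT //.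
  by rewrite H orbT.
case/orP=> [/eqP[] //|]; rewrite inE !mem_cat.
by case/orP => [/IH1 ->|/IH2 ->]; rewrite !orbT.
Qed.

Lemma nodes_bin b t1 t2 x p y r t0 : (y, (Bin b t1 t2, r)) \in nodes t0 x p ->
  (y.+1, (t1, y)) \in nodes t0 x p /\
  (y.+1 + clen t1, (t2, y)) \in nodes t0 x p.
Proof.
elim: t0 x p => [A|a|v t' IH|b' s1 IH1 s2 IH2] x p; rewrite /= inE;
  try by case/eqP.
  by case/orP=> [/eqP[] //|/IH[H1 H2]]; rewrite !inE H1 H2 !orbT.
case/orP=> [/eqP[-> _ -> -> _]|]; rewrite !inE !mem_cat.
  by rewrite !nodes_head !orbT.
by case/orP => [/IH1[-> ->]|/IH2[-> ->]]; rewrite !orbT.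
Qed.

Definition child (x : nat) (t : T) (p : nat) (t' : T) : Prop :=
  match t' with
  | Leaf _ | Atom _ => False
  | Un u t1 => t = t1 /\ x = p + uoff u
  | Bin b t1 t2 => (t = t1 /\ x = p.+1) \/ (t = t2 /\ x = p.+1 + clen t1)
  end.

Lemma nodes_parent t0 x0 p0 x t p : (x, (t, p)) \in nodes t0 x0 p0 ->
  [/\ x = x0, t = t0 & p = p0] \/
  exists t' p', (p, (t', p')) \in nodes t0 x0 p0 /\ child x t p t'.
Proof.
elim: t0 x0 p0 => [A|a|v t' IH|b' s1 IH1 s2 IH2] x0 p0; rewrite /= inE.
- by move=> /eqP[-> -> ->]; left.
- by move=> /eqP[-> -> ->]; left.
- case/orP=> [/eqP[-> -> ->]|]; first by left.
  case/IH=> [[-> -> ->]|[t1 [p1 [H1 H2]]]]; right.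
    by exists (Un v t'), p0; rewrite inE eqxx.
  by exists t1, p1; rewrite inE H1 orbT.
case/orP=> [/eqP[-> -> ->]|]; first by left.
rewrite mem_cat; case/orP=> [/IH1|/IH2].
  case=> [[-> -> ->]|[t1 [p1 [H1 H2]]]]; right.
    by exists (Bin b' s1 s2), p0; rewrite inE eqxx; split=> //; left.
  by exists t1, p1; rewrite inE mem_cat H1 !orbT.
case=> [[-> -> ->]|[t1 [p1 [H1 H2]]]]; right.
  by exists (Bin b' s1 s2), p0; rewrite inE eqxx; split=> //; right.
by exists t1, p1; rewrite inE mem_cat H1 !orbT.
Qed.

Lemma allnodes_root (ps : seq ('I_n * T)) x A t : (A, t) \in ps ->
  exists y, (y, (t, W + A)) \in allnodes ps x.
Proof.
elim: ps x => [//|[B s] ps IH] x; rewrite inE => /orP[/eqP[-> ->]|/IH H].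
  by exists x.+1; rewrite /= mem_cat nodes_head.
by have [y Hy] := H (x.+1 + clen s); exists y; rewrite /= mem_cat Hy orbT.
Qed.

Lemma allnodes_un ps x0 u t y r : (y, (Un u t, r)) \in allnodes ps x0 ->
  (y + uoff u, (t, y)) \in allnodes ps x0.
Proof.
elim: ps x0 => [//|[B s] ps IH] x0 /=; rewrite !mem_cat.
by case/orP=> [/nodes_un->//|/IH ->]; rewrite orbT.
Qed.

Lemma allnodes_bin ps x0 b t1 t2 y r :
  (y, (Bin b t1 t2, r)) \in allnodes ps x0 ->
  (y.+1, (t1, y)) \in allnodes ps x0 /\
  (y.+1 + clen t1, (t2, y)) \in allnodes ps x0.
Proof.
elim: ps x0 => [//|[B s] ps IH] x0 /=; rewrite !mem_cat.
by case/orP=> [/nodes_bin[-> ->]//|/IH [-> ->]]; rewrite !orbT.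
Qed.

Lemma allnodes_parent ps x0 x t p : (x, (t, p)) \in allnodes ps x0 ->
  (exists A : 'I_n, p = W + A /\ (A, t) \in ps) \/
  exists t' p', (p, (t', p')) \in allnodes ps x0 /\ child x t p t'.
Proof.
elim: ps x0 => [//|[B s] ps IH] x0 /=; rewrite mem_cat => /orP[|/IH].
  case/nodes_parent=> [[-> -> ->]|[t' [p' [H1 H2]]]].
    by left; exists B; rewrite inE eqxx.
  by right; exists t', p'; rewrite mem_cat H1.
case=> [[A [-> H]]|[t' [p' [H1 H2]]]]; first by left; exists A; rewrite inE H orbT.
by right; exists t', p'; rewrite mem_cat H1 orbT.
Qed.

Definition at_pos (w : seq nat) (x : nat) (s : seq nat) : Prop :=
  forall i, i < size s -> nth 0 w (x + i) = nth 0 s i.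

Lemma at_cat w x s1 s2 :
  at_pos w x (s1 ++ s2) <-> at_pos w x s1 /\ at_pos w (x + size s1) s2.
Proof.
split=> [H|[H1 H2]].
  split=> i lti.
    by rewrite H ?size_cat ?nth_cat ?lti // ltn_addr.
  by rewrite -addnA H ?size_cat ?ltn_add2l // nth_cat ltnNge leq_addr addKn.
move=> i; rewrite size_cat nth_cat => lti; case: ltnP => i1; first exact: H1.
by rewrite -H2; [congr nth; lia | lia].
Qed.

Lemma at_cons w x a s :
  at_pos w x (a :: s) <-> nth 0 w x = a /\ at_pos w x.+1 s.
Proof.
rewrite -cat1s at_cat addn1; split=> [[H1 H2]|[<- H2]]; split=> //.
  by have := H1 0 isT; rewrite addn0.
by case=> [|//] _; rewrite addn0.
Qed.

Lemma nodes_at w t x p y s r : at_pos w x (tree_code t) ->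
  (y, (s, r)) \in nodes t x p -> at_pos w y (tree_code s).
Proof.
elim: t x p => [A|a|v t' IH|b' s1 IH1 s2 IH2] x p aw; rewrite /= inE.
- by move=> /eqP[-> -> _].
- by move=> /eqP[-> -> _].
- case/orP=> [/eqP[-> -> _]//|]; apply: IH.
  move: aw; rewrite tree_code_un => /at_cat[_]; by case: v.
case/orP=> [/eqP[-> -> _]//|]; move: aw; rewrite tree_code_bin => /at_cons[_].
by move=> /at_cat[a1 a2]; rewrite mem_cat => /orP[/IH1|/IH2]; apply.
Qed.

Lemma allnodes_at w ps x y s r : at_pos w x (prods_code ps) ->
  (y, (s, r)) \in allnodes ps x -> at_pos w y (tree_code s).
Proof.
elim: ps x => [//|[A t] ps IH] x /at_cons[_ /at_cat[a1 a2]] /=.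
by rewrite mem_cat => /orP[/nodes_at|/IH]; apply.
Qed.

End Layout.

(** * The parser *)

Definition upd (f : nat -> nat) (i v : nat) : nat -> nat :=
  fun j => if j == i then v else f j.

(* State of the parser: parents, last children, successors in the lists of the
   leaves with the same nonterminal, stack of parents, position. *)
Record config : Type := Config {
  cpar : nat -> nat;
  clast : nat -> nat;
  cnext : nat -> nat;
  cstack : seq nat;
  cpos : nat
}.

Definition pstep (w : seq nat) (c : config) : config :=
  let x := cpos c in
  if x < size w then
    if cstack c is p :: s then
      let a := nth 0 w x in
      let par := upd (cpar c) x p in
      let lst := upd (clast c) p x in
      if 5 < a then Config par lst (cnext c) [:: x, x & s] (x + 1)
      else if 3 < a then Config par lst (cnext c) (x :: s) (x + 2)
      else if 2 < a then Config par lst (cnext c) (x :: s) (x + 1)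
      else if 0 < a then Config par lst (cnext c) s (x + 3)
      else let A := size w + nth 0 w (x + 1) in
        Config par lst (upd (upd (cnext c) x (cnext c A)) A x) s (x + 2)
    else Config (cpar c) (clast c) (cnext c) [:: size w + nth 0 w x] (x + 1)
  else c.

Section Parse.
Variables (k n : nat) (w : seq nat).
Local Notation T := (tree k 'I_n).
Local Notation W := (size w).

Definition leaf_of (e : nat * (T * nat)) : option (nat * nat) :=
  if e is (x, (Leaf A, _)) then Some (x, val A) else None.

(* The successor function, given the leaves already read, the last one first. *)
Fixpoint nxf (ls : seq (nat * nat)) : nat -> nat :=
  if ls is (x, A) :: ls' then upd (upd (nxf ls') x (nxf ls' (W + A))) (W + A) x
  else fun=> 0.

Definition last_ok (lst : nat -> nat) (x : nat) (t : T) : Prop :=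
  if t is Bin _ t1 _ then lst x = x.+1 + clen t1 else True.

Definition parsed (par lst : nat -> nat) (ns : seq (nat * (T * nat))) : Prop :=
  forall y s r, (y, (s, r)) \in ns -> par y = r /\ last_ok lst y s.

Lemma parsed_frame par lst par' lst' ns a b :
  (forall y, y \in map fst ns -> a <= y < b) ->
  (forall y, a <= y < b -> par' y = par y /\ lst' y = lst y) ->
  parsed par lst ns -> parsed par' lst' ns.
Proof.
move=> R F P y s r yin; have [H1 H2] := P _ _ _ yin.
have [|H3 H4] := F y; first by apply: R; apply/mapP; exists (y, (s, r)).
by rewrite H3; split=> //; case: s H2 {yin P} => //= *; rewrite H4.
Qed.

Lemma parse_tree (t : T) par lst ls p s x :
  at_pos w x (tree_code t) -> x + clen t <= W -> ~~ (x <= p < x + clen t) ->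
  exists par' lst',
    [/\ iter (tree_size t) (pstep w) (Config par lst (nxf ls) (p :: s) x)
        = Config par' lst' (nxf (rev (pmap leaf_of (nodes t x p)) ++ ls)) s
            (x + clen t),
      parsed par' lst' (nodes t x p),
      forall y, y \notin map fst (nodes t x p) -> par' y = par y,
      forall y, ~~ (x <= y < x + clen t) -> y != p -> lst' y = lst y
      & lst' p = x].
Proof.
elim: t par lst ls p s x => [A|a|u t IH|b t1 IH1 t2 IH2] par lst ls p s x aw xW px.
- move: xW aw; rewrite /clen /= => xW /at_cons[a1 /at_cons[a2 _]].
  exists (upd par x p), (upd lst p x); split.
  + rewrite /pstep /= ifT; last lia.
    by rewrite a1 /= addn1 a2.
  + by move=> y t r; rewrite /= inE => /eqP[-> -> ->]; rewrite /upd eqxx.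
  + by move=> y; rewrite /= inE /upd => /negPf->.
  + by move=> y _; rewrite /upd => /negPf->.
  + by rewrite /upd eqxx.
- have [c [c0 c3 cE]] : exists c, [/\ 0 < c, c < 3 & nth 0 w x = c].
    by case: a aw {xW px} => i j /at_cons[a1 _]; [exists 1|exists 2].
  have cl : clen (Atom a : T) = 3 by case: a {aw xW px}.
  rewrite cl in xW px *.
  exists (upd par x p), (upd lst p x); split.
  + rewrite /pstep /= ifT; last lia.
    by rewrite cE c0; have [-> -> ->] : [/\ (5 < c) = false, (3 < c) = false
      & (2 < c) = false] by split; lia.
  + by move=> y t r; rewrite /= inE => /eqP[-> -> ->]; rewrite /upd eqxx.
  + by move=> y; rewrite /= inE /upd => /negPf->.
  + by move=> y _; rewrite /upd => /negPf->.
  + by rewrite /upd eqxx.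
- have u0 : 0 < uoff u by case: u {aw xW px}.
  have cl0 := clen_gt0 t.
  move: aw xW px; rewrite tree_code_un clen_un => /at_cat[a1 a2] xW px.
  have su : size (ucode u) = uoff u by case: u {a1 a2 xW px u0}.
  rewrite su in a2.
  have xW' : x + uoff u + clen t <= W by lia.
  have px' : ~~ (x + uoff u <= x < x + uoff u + clen t) by lia.
  have [par' [lst' [H1 H2 H3 H4 H5]]] :=
    IH (upd par x p) (upd lst p x) ls x s _ a2 xW' px'.
  exists par', lst'; split.
  + rewrite -[tree_size _]/(tree_size t).+1 iterSr addnA -[pmap _ _]/(pmap leaf_of
      (nodes t (x + uoff u) x)) -H1; congr iter.
    rewrite /pstep /= ifT; last lia.
    by case: u a1 {a2 xW px u0 su xW' px' H1 H2 H3 H4 H5} => [|i|i] /at_cons[-> _] /=.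
  + move=> y t' r; rewrite /= inE => /orP[/eqP[-> -> ->]|/H2//]; split=> //.
    rewrite H3 /upd ?eqxx //; apply/negP => /nodes_fst_range; lia.
  + move=> y; rewrite /= inE => /norP[yx /H3->].
    by rewrite /upd (negPf yx).
  + move=> y yx yp; rewrite H4 /upd ?(negPf yp) //; lia.
  + rewrite H4 /upd ?eqxx //; lia.
have cl1 := clen_gt0 t1; have cl2 := clen_gt0 t2.
move: aw xW px; rewrite tree_code_bin clen_bin => /at_cons[a0 /at_cat[a1 a2]] xW px.
rewrite -/(clen t1) in a2.
have xW1 : x.+1 + clen t1 <= W by lia.
have px1 : ~~ (x.+1 <= x < x.+1 + clen t1) by lia.
have [par1 [lst1 [H1 K1 P1 L1 M1]]] :=
  IH1 (upd par x p) (upd lst p x) ls x (x :: s) _ a1 xW1 px1.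
have xW2 : x.+1 + clen t1 + clen t2 <= W by lia.
have px2 : ~~ (x.+1 + clen t1 <= x < x.+1 + clen t1 + clen t2) by lia.
have [par2 [lst2 [H2 K2 P2 L2 M2]]] := IH2 par1 lst1
  (rev (pmap leaf_of (nodes t1 x.+1 x)) ++ ls) x s _ a2 xW2 px2.
have P2' y : y < x.+1 + clen t1 -> par2 y = par1 y.
  by move=> yx; apply: P2; apply/negP => /nodes_fst_range; lia.
exists par2, lst2; split.
- rewrite -[tree_size _]/(tree_size t1 + tree_size t2).+1 iterSr addnC iterD.
  rewrite (_ : pstep w _ = Config (upd par x p) (upd lst p x) (nxf ls)
    [:: x, x & s] x.+1); last first.
    rewrite /pstep /= ifT; last lia.
    by rewrite a0 addn1; case: b {a0}.
  rewrite H1 H2 /= pmap_cat rev_cat catA; congr Config; lia.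
- move=> y t' r; rewrite /= inE mem_cat => /or3P[/eqP[-> -> ->]|yin|/K2//].
    split=> //=; rewrite P2' ?P1 /upd ?eqxx //; last lia.
    by apply/negP => /nodes_fst_range; lia.
  apply: (@parsed_frame par1 lst1 par2 lst2 _ x.+1 (x.+1 + clen t1)) yin => //.
    by move=> z /nodes_fst_range.
  by move=> z zr; rewrite P2' ?L2 //; lia.
- move=> y; rewrite /= map_cat inE mem_cat !negb_or => /and3P[yx y1 y2].
  by rewrite P2 // P1 // /upd (negPf yx).
- move=> y yx yp; rewrite L2 ?L1 /upd ?(negPf yp) //; lia.
- rewrite L2 ?L1 /upd ?eqxx //; lia.
Qed.

Definition prods_steps (ps : seq ('I_n * T)) : nat :=
  \sum_(p <- ps) (tree_size p.2).+1.

Lemma parse_prods (ps : seq ('I_n * T)) par lst ls x :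
  at_pos w x (prods_code ps) -> x + size (prods_code ps) = W ->
  exists par' lst',
    [/\ iter (prods_steps ps) (pstep w) (Config par lst (nxf ls) [::] x)
        = Config par' lst' (nxf (rev (pmap leaf_of (allnodes W ps x)) ++ ls))
            [::] W,
      parsed par' lst' (allnodes W ps x),
      forall y, y \notin map fst (allnodes W ps x) -> par' y = par y
      & forall y, y <= x -> lst' y = lst y].
Proof.
elim: ps par lst ls x => [|[A t] ps IH] par lst ls x.
  rewrite /prods_code /= addn0 => _ <-; exists par, lst.
  by rewrite /prods_steps big_nil.
rewrite /prods_code /= size_cat -/(clen t) -/(prods_code ps).
move=> /at_cons[a0 /at_cat[a1 a2]] xW.
rewrite -/(clen t) in a2.
have xW1 : x.+1 + clen t <= W by lia.
have px1 : ~~ (x.+1 <= W + A < x.+1 + clen t) by lia.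
have [par1 [lst1 [H1 K1 P1 L1 M1]]] :=
  parse_tree par lst ls [::] a1 xW1 px1.
have xW2 : x.+1 + clen t + size (prods_code ps) = W by lia.
have [par2 [lst2 [H2 K2 P2 L2]]] := IH par1 lst1
  (rev (pmap leaf_of (nodes t x.+1 (W + A))) ++ ls) _ a2 xW2.
have cl := clen_gt0 t.
have P2' y : y < x.+1 + clen t -> par2 y = par1 y.
  by move=> yx; apply: P2; apply/negP => /allnodes_fst_range; lia.
exists par2, lst2; split.
- rewrite /prods_steps big_cons addnC iterD iterSr.
  rewrite (_ : pstep w _ = Config par lst (nxf ls) [:: W + A] x.+1); last first.
    rewrite /pstep /= ifT ?a0 ?addn1 //; lia.
  by rewrite H1 H2 pmap_cat rev_cat catA.
- move=> y t' r; rewrite mem_cat => /orP[yin|/K2//].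
  apply: (@parsed_frame par1 lst1 par2 lst2 _ x.+1 (x.+1 + clen t)) yin => //.
    by move=> z /nodes_fst_range.
  by move=> z zr; rewrite P2' ?L2 //; lia.
- move=> y; rewrite map_cat mem_cat negb_or => /andP[y1 y2].
  by rewrite P2 // P1.
- by move=> y yx; rewrite L2 ?L1 //; lia.
Qed.

Lemma prods_steps_le (ps : seq ('I_n * T)) : prods_steps ps <= size (prods_code ps).
Proof.
rewrite /prods_steps; elim: ps => [|[A t] ps IH]; first by rewrite big_nil.
rewrite big_cons /prods_code /= size_cat -/(clen t) -/(prods_code ps).
by have := tree_size_clen t; lia.
Qed.

Lemma nxf_sound ls y : (forall x A, (x, A) \in ls -> x < W) ->
  nxf ls y != 0 -> exists A,
  (nxf ls y, A) \in ls /\ (y = W + A \/ (y, A) \in ls).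
Proof.
elim: ls y => [//|[x A] ls IH] y R /=; rewrite /upd.
have {}IH := IH _ (fun z B zin => R z B (@predU1r _ _ _ _ zin)).
case: (eqVneq y (W + A)) => [->|yA].
  by exists A; rewrite inE eqxx; split=> //; left.
case: (eqVneq y x) => [->|yx] /IH[B [H1 H2]]; exists B; rewrite !inE H1 orbT; split=> //.
  case: H2 => [/addnI <-|H2]; right; first by rewrite eqxx.
  by have := R _ _ (@predU1r _ _ _ _ H2); lia.
by case: H2 => [->|->]; [left|right; rewrite orbT].
Qed.

Lemma nxf_small ls y : (forall A, y != W + A) -> y \notin map fst ls -> nxf ls y = 0.
Proof.
move=> yW; elim: ls => [//|[x A] ls IH] /=; rewrite inE /upd => /norP[yx /IH H].
by rewrite (negPf (yW A)) (negPf yx).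
Qed.

Lemma nxf_complete (F : nat -> Prop) ls A :
  uniq (map fst ls) -> (forall x B, (x, B) \in ls -> 0 < x < W) ->
  F (W + A) -> (forall y, F y -> nxf ls y != 0 -> F (nxf ls y)) ->
  forall x, (x, A) \in ls -> F x.
Proof.
move=> + + FA; elim: ls => [//|[x B] ls IH] /=.
move=> /andP[xls uls] R H z.
have x0 := R x B (mem_head _ _).
have R' y C : (y, C) \in ls -> 0 < y < W.
  by move=> yin; apply: (R y C); rewrite inE yin orbT.
have HA : F (W + B) -> F x.
  by move=> FB; have := H _ FB; rewrite /upd eqxx; apply; lia.
rewrite inE => /orP[/eqP[-> AB]|]; first by apply: HA; rewrite -AB.
apply: IH => // y Fy.
have ny : nxf ls x = 0 by apply: nxf_small => // C; lia.
case: (eqVneq y (W + B)) => [yB|yB].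
  move: Fy; rewrite yB => /HA Fx; have := H _ Fx.
  by rewrite /upd eqxx ifF //; lia.
case: (eqVneq y x) => [->|yx]; first by rewrite ny.
by have := H _ Fy; rewrite /upd (negPf yB) (negPf yx).
Qed.

Lemma mem_leaves ns x A :
  (x, A) \in pmap leaf_of ns <-> exists B p, (x, (Leaf B, p)) \in ns /\ A = val B.
Proof.
rewrite mem_pmap; split=> [/mapP[[y [[B|a|u t|b t1 t2] p]] yin] //= [-> ->]|].
  by exists B, p.
by case=> B [p [xin ->]]; apply/mapP; exists (x, (Leaf B, p)).
Qed.

Lemma leaves_subseq ns : subseq (map fst (pmap leaf_of ns)) (map fst ns).
Proof.
elim: ns => [//|[x [t p]] ns IH].
case: t => [A|a|u t|b t1 t2]; rewrite [pmap _ _]/=; first by rewrite /= eqxx.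
all: by rewrite -[map fst (_ :: _)]cat1s; apply: subseq_trans (suffix_subseq _ _).
Qed.

End Parse.

Fixpoint keepr (x : nat) (c : stm) : bool :=
  match c with
  | Skip | St _ _ _ => true
  | Asg y _ => x != y
  | Sq c1 c2 | Cond _ c1 c2 => keepr x c1 && keepr x c2
  | For _ i c1 => (x != i) && keepr x c1
  end.

Fixpoint keepa (a : nat) (c : stm) : bool :=
  match c with
  | Skip | Asg _ _ => true
  | St b _ _ => a != b
  | Sq c1 c2 | Cond _ c1 c2 => keepa a c1 && keepa a c2
  | For _ i c1 => keepa a c1
  end.

Lemma sem_keepr q c x h : keepr x c -> reg (sem q c h) x = reg h x.
Proof.
elim: c h => //=.
- by move=> y e h /negPf->.
- by move=> c1 IH1 c2 IH2 h /andP[/IH1 H1 /IH2 H2]; rewrite H2.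
- by move=> e c1 IH1 c2 IH2 h /andP[/IH1 H1 /IH2 H2]; case: ifP.
- move=> y i c1 IH h /andP[/negPf xi /IH H].
  by elim: (reg h y) => //= n IHn; rewrite H /= xi.
Qed.

Lemma sem_keepa q c a h : keepa a c -> arr (sem q c h) a =1 arr h a.
Proof.
elim: c h => //=.
- by move=> b i e h /negPf ab j /=; rewrite ab.
- by move=> c1 IH1 c2 IH2 h /andP[/IH1 H1 /IH2 H2] j; rewrite H2 H1.
- move=> e c1 IH1 c2 IH2 h /andP[/IH1 H1 /IH2 H2] j.
  by case: ifP; rewrite ?H1 ?H2.
- move=> y i c1 IH h /IH H.
  by elim: (reg h y) => [//|n IHn] j /=; rewrite H /= IHn.
Qed.

Lemma sem_for q x i c h (P : nat -> state -> Prop) :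
  P 0 h ->
  (forall j h, P j h -> j < reg h x -> P j.+1 (sem q c (set_reg h i j))) ->
  keepr x (For x i c) -> P (reg h x) (sem q (For x i c) h).
Proof.
move=> P0 step /= /andP[xi xc].
set F := fun j h1 => sem q c (set_reg h1 i j).
have regx m : reg (iteri m F h) x = reg h x.
  by elim: m => //= m IHm; rewrite /F sem_keepr //= (negPf xi).
suff H m : m <= reg h x -> P m (iteri m F h) by apply: H.
elim: m => //= m IHm ltm; apply: step; first by apply: IHm; lia.
by rewrite regx.
Qed.

(* Use of the arrays: 0 input and output, 1 stack, 2 parents, 3 last children,
   4 successors in the lists of leaves, 5 and 6 nodes and values of the queue,
   7 for each fact, one plus the number of its line, 8 to 10 the lines. *)
Definition rF := 6.
Notation rPos := 7.
Notation rSp := 8.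
Notation rp := 9.
Notation rs := 10.
Notation rA := 11.
Notation rI := 12.
Notation rHd := 13.
Notation rTl := 14.
Notation rNl := 15.
Notation rX := 16.
Notation rV := 17.
Notation rL := 18.
Notation rx := 19.
Notation rv := 20.
Notation rl := 21.
Notation ru := 22.
Notation rm := 23.
Notation ry := 24.
Notation rFound := 25.
Notation r1 := 26.
Notation r2 := 27.
Notation r3 := 28.
Definition nregs := 29.

Notation "c1 ;;; c2" := (Sq c1 c2) (at level 90, right associativity).

Definition incr x := Asg x (Plus (V x) (K 1)).

Definition sParse : stm :=
  Cond (Minus (V rW) (V rPos))
    (Cond (V rSp)
      (Asg rSp (Minus (V rSp) (K 1)) ;;;
       Asg rp (Arr 1 (V rSp)) ;;;
       St 2 (V rPos) (V rp) ;;;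
       St 3 (V rp) (V rPos) ;;;
       Asg rs (Arr 0 (V rPos)) ;;;
       Cond (Minus (V rs) (K 5))
         (St 1 (V rSp) (V rPos) ;;; St 1 (Plus (V rSp) (K 1)) (V rPos) ;;;
          Asg rSp (Plus (V rSp) (K 2)) ;;; incr rPos)
       (Cond (Minus (V rs) (K 3))
         (St 1 (V rSp) (V rPos) ;;; incr rSp ;;; Asg rPos (Plus (V rPos) (K 2)))
       (Cond (Minus (V rs) (K 2))
         (St 1 (V rSp) (V rPos) ;;; incr rSp ;;; incr rPos)
       (Cond (V rs)
         (Asg rPos (Plus (V rPos) (K 3)))
         (Asg rA (Plus (V rW) (Arr 0 (Plus (V rPos) (K 1)))) ;;;
          St 4 (V rPos) (Arr 4 (V rA)) ;;; St 4 (V rA) (V rPos) ;;;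
          Asg rPos (Plus (V rPos) (K 2)))))))
      (St 1 (K 0) (Plus (V rW) (Arr 0 (V rPos))) ;;; Asg rSp (K 1) ;;; incr rPos))
    Skip.

Section ParseCorrect.
Variables (q : seq rat) (w : seq nat).

Definition parser_state (c : config) (h : state) : Prop :=
  [/\ reg h rW = size w, reg h rPos = cpos c, reg h rSp = size (cstack c),
      forall i, i < size (cstack c) -> arr h 1 i = nth 0 (rev (cstack c)) i &
  [/\ arr h 0 =1 nth 0 w, arr h 2 =1 cpar c, arr h 3 =1 clast c
    & arr h 4 =1 cnext c]].

Lemma sem_parse c h j :
  parser_state c h -> parser_state (pstep w c) (sem q sParse (set_reg h rI j)).
Proof.
case: c => par lst nx stk x [/= hW hP hS hst [h0 h2 h3 h4]].
rewrite /pstep /= hW hP.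
case: ltnP => xw; last by rewrite ifF //; lia.
rewrite ifT; last lia.
rewrite hS; case: stk hS hst => [|p s] hS hst /=.
  split=> //=.
  by case=> [|//] _ /=; rewrite h0.
have hp : arr h 1 (size s + 1 - 1) = p.
  by rewrite addnK hst //= rev_cons nth_rcons size_rev ltnn eqxx.
have hs i : i < size s -> arr h 1 i = nth 0 (rev s) i.
  by move=> lti; rewrite hst ?rev_cons ?nth_rcons ?size_rev ?lti //=; lia.
have sz : (size s).+1 - 1 = size s by rewrite subn1.
rewrite addnK in hp.
rewrite !sz !hp h0; set a := nth 0 w x.
have e2 i : (if i == x then p else arr h 2 i) = upd par x p i.
  by rewrite /upd h2.
have e3 i : (if i == p then x else arr h 3 i) = upd lst p x i.
  by rewrite /upd h3.
have -> : (a - 5 != 0) = (5 < a) by lia.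
have -> : (a - 3 != 0) = (3 < a) by lia.
have -> : (a - 2 != 0) = (2 < a) by lia.
have -> : (a != 0) = (0 < a) by lia.
case: ifP => _; [|case: ifP => _; [|case: ifP => _; [|case: ifP => _]]].
- split=> //=; first by rewrite addn2.
    move=> i lti; rewrite !rev_cons !nth_rcons size_rcons size_rev.
    case: (eqVneq i (size s + 1)) => [->|n1].
      by rewrite addn1 ltnn eqxx.
    have -> : i < (size s).+1 by move: lti n1; rewrite /= addn1; lia.
    case: ltngtP => // lt1; first exact: hs.
    by move: lti n1; rewrite /= addn1; lia.
- split=> //=; first by rewrite addn1.
    move=> i lti; rewrite rev_cons nth_rcons size_rev.
    by case: ltngtP => // lt1; [exact: hs | move: lti; rewrite /=; lia].
- split=> //=; first by rewrite addn1.
    move=> i lti; rewrite rev_cons nth_rcons size_rev.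
    by case: ltngtP => // lt1; [exact: hs | move: lti; rewrite /=; lia].
- by split=> //=; split=> //= i; rewrite /upd ?h2 ?h3.
- split=> //=; split=> //= i; rewrite /upd ?h0 ?h2 ?h3 ?h4 //.
Qed.

End ParseCorrect.

(** * The saturation of the set of facts *)

Definition eMulD := It rD (K 0) (Plus (L 4) (L 0)).
Definition eAddr := Plus (App1 eMulD (L 0)) (L 1).
Definition addr x v := App2 eAddr x v.

Definition sPush : stm :=
  Cond (Arr 7 (addr (V rX) (V rV))) Skip
    (St 7 (addr (V rX) (V rV)) (V rL) ;;;
     St 5 (V rTl) (V rX) ;;; St 6 (V rTl) (V rV) ;;; incr rTl ;;;
     Asg rNl (Plus (V rNl) (Minus (V rL) (V rNl)))).

Definition sNew : stm :=
  St 8 (V rNl) (V r1) ;;; St 9 (V rNl) (V r2) ;;; St 10 (V rNl) (V r3) ;;;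
  Asg rL (Plus (V rNl) (K 1)) ;;; sPush.

Lemma eval_addr q h x v b c : eval q h [:: x; v; b; c] eAddr = x * reg h rD + v.
Proof.
rewrite /=; congr addn; elim: (reg h rD) => [|m /= ->]; first by rewrite muln0.
by rewrite mulnS addnC.
Qed.
Opaque eMulK eAddr eVal eBad.

Definition ext (A : Type) (s s' : seq A) : Prop := exists r, s' = s ++ r.

Lemma ext_refl (A : Type) (s : seq A) : ext s s.
Proof. by exists [::]; rewrite cats0. Qed.

Lemma ext_trans (A : Type) (s2 s1 s3 : seq A) : ext s1 s2 -> ext s2 s3 -> ext s1 s3.
Proof. by move=> [r ->] [r' ->]; exists (r ++ r'); rewrite catA. Qed.

Lemma ext_mem (A : eqType) (s s' : seq A) x : ext s s' -> x \in s -> x \in s'.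
Proof. by move=> [r ->]; rewrite mem_cat => ->. Qed.

Lemma ext_onth (A : Type) (s s' : seq A) i x :
  ext s s' -> onth s i = Some x -> onth s' i = Some x.
Proof. by move=> [r ->]; elim: s i => [|y s IH] [|i] //=; apply: IH. Qed.

Lemma onth_size (A : Type) (s : seq A) i x : onth s i = Some x -> i < size s.
Proof. by elim: s i => [|y s IH] [|i] //=; apply: IH. Qed.

Lemma onth_rcons (A : Type) (s : seq A) y i :
  onth (rcons s y) i = if i == size s then Some y else onth s i.
Proof. by elim: s i => [|z s IH] [|i] //=; rewrite ?IH //; case: i. Qed.

Section Invariant.
Variables (k : nat) (G : grammar k) (q : seq rat) (w : seq nat).
Variables (d T m p : nat) (par lst nx : nat -> nat).
Local Notation n := (nonterms G).
Local Notation W := (size w).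
Local Notation D := (2 ^ T).
Local Notation NN := (allnodes W (prods G) 6).

(* The trees derivable from a node: a nonterminal A is the node W + A. *)
Definition gen (x : nat) (f : formula k) : Prop :=
  (exists A : 'I_n, x = W + A /\ derives (Leaf A) f) \/
  (exists t r, (x, (t, r)) \in NN /\ derives t f).

Record search_inv (fs : seq (formula k)) (Q : seq (nat * nat)) (h : state) : Prop := Inv {
  inv_W : reg h rW = W;
  inv_K : reg h rK = d;
  inv_T : reg h rT = T;
  inv_D : reg h rD = D;
  inv_M : reg h rM = m;
  inv_P : reg h rP = p;
  inv_word : arr h 0 =1 nth 0 w;
  inv_par : arr h 2 =1 par;
  inv_lst : arr h 3 =1 lst;
  inv_nx : arr h 4 =1 nx;
  inv_tl : reg h rTl = size Q;
  inv_queue : forall j, j < size Q -> (arr h 5 j, arr h 6 j) = nth (0, 0) Q j;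
  inv_table : forall x v, v < D -> (arr h 7 (x * D + v) != 0) = ((x, v) \in Q);
  inv_uniq : uniq Q;
  inv_range : forall x v, (x, v) \in Q -> x < W + n /\ v < D;
  inv_nl : reg h rNl = size fs;
  inv_lines_le : size fs <= size Q;
  inv_lines : forall i f, onth fs i = Some f ->
    line_code (take i fs) f [:: arr h 8 i; arr h 9 i; arr h 10 i];
  inv_sound : forall x v, (x, v) \in Q -> exists l f,
    [/\ arr h 7 (x * D + v) = l.+1, onth fs l = Some f, gen x f & vals d T f = v]
}.

Lemma inv_set_reg fs Q h x v :
  x \notin [:: rW; rK; rT; rD; rM; rP; rTl; rNl] ->
  search_inv fs Q h -> search_inv fs Q (set_reg h x v).
Proof.
rewrite !inE !negb_or => /and5P[x0 x1 x2 x3 /and4P[x4 x5 x6 x7]].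
case=> *; split=> //=; rewrite ifN 1?eq_sym //.
Qed.

Lemma inv_set_line fs Q h a v :
  a \in [:: 8; 9; 10] -> search_inv fs Q h -> search_inv fs Q (set_arr h a (size fs) v).
Proof.
rewrite !inE => ain [hW hK hT hD hM hP h0 h2 h3 h4 hTl hq ht hu hr hn hle hl hs].
have a7 b : b <= 7 -> (b == a) = false by case/or3P: ain => /eqP->; lia.
split=> //=.
- by move=> i; rewrite /= a7 //= h0.
- by move=> i; rewrite /= a7 //= h2.
- by move=> i; rewrite /= a7 //= h3.
- by move=> i; rewrite /= a7 //= h4.
- by move=> j jQ; rewrite !a7 //= hq.
- by move=> x u uD; rewrite a7 //= ht.
- move=> i f fi; have := onth_size fi => ilt.
  by rewrite (ltn_eqF ilt) !andbF; apply: hl.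
- by move=> x u xu; rewrite a7 //=; apply: hs.
Qed.

Lemma addr_inj x v x' v' : v < D -> v' < D ->
  (x * D + v == x' * D + v') = ((x, v) == (x', v')).
Proof.
move=> vD vD'; apply/eqP/eqP => [E|[-> -> //]].
have D0 : 0 < D by rewrite expn_gt0.
have := congr1 (divn^~ D) E; rewrite !divnMDl // !divn_small // !addn0 => <-.
by have := congr1 (modn^~ D) E; rewrite /= !modnMDl !modn_small // => ->.
Qed.

Definition grows (fs : seq (formula k)) (Q : seq (nat * nat)) (h : state)
    (S : seq (nat * nat) -> Prop) : Prop :=
  exists fs' Q', [/\ search_inv fs' Q' h, ext fs fs', ext Q Q' & S Q'].

Lemma push_spec fs Q h x v l f :
  search_inv fs Q h -> reg h rX = x -> reg h rV = v -> reg h rL = l.+1 ->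
  x < W + n -> v < D -> gen x f -> vals d T f = v ->
  (onth fs l = Some f \/ l = size fs /\
     line_code fs f [:: arr h 8 l; arr h 9 l; arr h 10 l]) ->
  grows fs Q (sem q sPush h) (fun Q' => (x, v) \in Q').
Proof.
move=> I hX hV hL xn vD gf fv lf.
rewrite /= eval_addr hX hV hL (inv_D I) (inv_table I) //.
case: ifP => xQ.
  by exists fs, Q; split=> //; apply: ext_refl.
have [fs' [e1 e2 e3 e4]] : exists fs', [/\ ext fs fs', onth fs' l = Some f,
    size fs' = size fs + (l.+1 - size fs)
    & forall i g, onth fs' i = Some g ->
      line_code (take i fs') g [:: arr h 8 i; arr h 9 i; arr h 10 i]].
  case: lf => [lf|[lE lf]].
    exists fs; split=> //; [exact: ext_refl| |exact: inv_lines I].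
    by have := onth_size lf; lia.
  exists (rcons fs f); split.
  - by exists [:: f]; rewrite cats1.
  - by rewrite onth_rcons lE eqxx.
  - by rewrite size_rcons lE; lia.
  move=> i g; rewrite onth_rcons; case: eqP => [-> [<-]|_ gi].
    by rewrite -cats1 take_size_cat // -lE.
  have ilt := onth_size gi.
  by rewrite -cats1 takel_cat ?(ltnW ilt) //; apply: (inv_lines I).
case: (I) => [hW hK hT hD hM hP h0 h2 h3 h4 hTl hq ht hu hr hn hle hl hs].
exists fs', (rcons Q (x, v)); split=> //; first last.
- by rewrite mem_rcons mem_head.
- by exists [:: (x, v)]; rewrite cats1.
split=> //=.
- by rewrite hTl size_rcons addn1.
- move=> j; rewrite size_rcons nth_rcons hTl => jQ.
  by case: ltngtP => // lt; [exact: hq | lia].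
- move=> y u uD; rewrite mem_rcons inE addr_inj //.
  by case: ((y, u) == (x, v)) => //=; rewrite ht.
- by rewrite rcons_uniq xQ hu.
- move=> y u; rewrite mem_rcons inE => /orP[/eqP[-> ->]//|]; exact: hr.
- by rewrite hn e3.
- rewrite e3 size_rcons.
  by have : l <= size fs; [case: lf => [fl|[-> _]] //; exact: ltnW (onth_size fl) | lia].
- move=> y u; rewrite mem_rcons inE => /orP[/eqP[-> ->]|yu].
    by exists l, f; rewrite eqxx.
  have [_ uD] := hr _ _ yu.
  have [l' [f' [a1 a2 a3 a4]]] := hs _ _ yu.
  exists l', f'; rewrite addr_inj // ifF; last first.
    by apply/negP => /eqP yx; rewrite yx xQ in yu.
  by split=> //; apply: ext_onth a2.
Qed.

Lemma new_spec fs Q h x v c1 c2 c3 f :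
  search_inv fs Q h -> reg h rX = x -> reg h rV = v ->
  reg h r1 = c1 -> reg h r2 = c2 -> reg h r3 = c3 ->
  x < W + n -> v < D -> gen x f -> vals d T f = v ->
  line_code fs f [:: c1; c2; c3] ->
  grows fs Q (sem q sNew h) (fun Q' => (x, v) \in Q').
Proof.
move=> I hX hV h1 h2 h3 xn vD gf fv lf.
have nl := inv_nl I.
rewrite /sNew -[sem q _ _]/(sem q sPush _).
apply: (@push_spec _ _ _ _ _ (size fs) f) => //=.
- apply: inv_set_reg => //=; rewrite nl.
  by do 3![apply: inv_set_line => //].
- by rewrite nl addn1.
right; split=> //.
by rewrite nl !eqxx h1 h2 h3.
Qed.

End Invariant.

Arguments sem : simpl never.

Lemma sem_sq q c1 c2 h : sem q (Sq c1 c2) h = sem q c2 (sem q c1 h).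
Proof. by []. Qed.

Lemma sem_cond q e c1 c2 h :
  sem q (Cond e c1 c2) h = if eval q h [::] e != 0 then sem q c1 h else sem q c2 h.
Proof. by []. Qed.

Lemma sem_asg q x e h : sem q (Asg x e) h = set_reg h x (eval q h [::] e).
Proof. by []. Qed.

Lemma sem_st q a i e h :
  sem q (St a i e) h = set_arr h a (eval q h [::] i) (eval q h [::] e).
Proof. by []. Qed.

Definition sCopy (e : exp) : stm :=
  Asg rX e ;;; Asg rV (V rv) ;;; Asg rL (V rl) ;;; sPush.

Definition sEmit (a b x y : exp) : stm :=
  Asg r1 (V rs) ;;; Asg r2 a ;;; Asg r3 b ;;; Asg rX (V rp) ;;;
  Asg rV (App3 eVal (V rs) x y) ;;; sNew.

Definition pred1e x := Minus (V x) (K 1).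

Definition sRight : stm :=
  Asg ry (Arr 7 (addr (Plus (V rp) (K 1)) (V ru))) ;;;
  Cond (V ry) (sEmit (pred1e ry) (pred1e rl) (V ru) (V rv)) Skip.

Definition sLeft : stm :=
  Asg ry (Arr 7 (addr (V rm) (V ru))) ;;;
  Cond (V ry) (sEmit (pred1e rl) (pred1e ry) (V rv) (V ru)) Skip.

Definition sInner : stm :=
  Cond (Minus (V rs) (K 5))
    (Cond (eNeq (V rx) (Plus (V rp) (K 1))) (For rD ru sRight) (For rD ru sLeft))
  (Cond (Minus (V rs) (K 3))
    (sEmit (Arr 0 (Plus (V rp) (K 1))) (pred1e rl)
       (Arr 0 (Plus (V rp) (K 1))) (V rv))
    (sEmit (pred1e rl) (K 0) (V rv) (K 0))).

Definition sUp : stm :=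
  Cond (V rp)
    (Cond (Minus (Plus (V rp) (K 1)) (V rW)) (sCopy (V rp)) sInner) Skip.

Definition sNext : stm := Cond (V ry) (sCopy (V ry)) Skip.

Definition sFetch : stm :=
  Asg rx (Arr 5 (V rHd)) ;;; Asg rv (Arr 6 (V rHd)) ;;; incr rHd ;;;
  Asg rl (Arr 7 (addr (V rx) (V rv))) ;;;
  Asg rp (Arr 2 (V rx)) ;;; Asg rs (Arr 0 (V rp)) ;;;
  Asg rm (Arr 3 (V rp)) ;;; Asg ry (Arr 4 (V rx)).

Definition sItem : stm :=
  Cond (Minus (V rTl) (V rHd)) (sFetch ;;; sNext ;;; sUp) Skip.

Definition sAtom : stm :=
  Cond (Arr 2 (V rI)) (Cond (Arr 0 (V rI))
    (Cond (Minus (Arr 0 (V rI)) (K 2)) Skip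
      (Asg rp (V rI) ;;; Asg rs (Arr 0 (V rI)) ;;;
       sEmit (Arr 0 (Plus (V rp) (K 1))) (Arr 0 (Plus (V rp) (K 2)))
         (Arr 0 (Plus (V rp) (K 1))) (Arr 0 (Plus (V rp) (K 2))))) Skip) Skip.

Section Processing.
Variables (k : nat) (G : grammar k) (q : seq rat) (w : seq nat).
Variables (d m p : nat) (par lst nx : nat -> nat).
Local Notation n := (nonterms G).
Local Notation W := (size w).
Local Notation T := (d ^ d).
Local Notation D := (2 ^ T).
Local Notation NN := (allnodes W (prods G) 6).
Local Notation gen := (@gen k G w).
Local Notation search_inv := (@search_inv k G w d T m p par lst nx).
Local Notation grows := (@grows k G w d T m p par lst nx).

Hypothesis Hat : at_pos w 6 (prods_code (prods G)).
Hypothesis Hsz : 6 + size (prods_code (prods G)) = W.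
Hypothesis Hpar : parsed par lst NN.
Hypothesis Hpar0 : forall y, y \notin map fst NN -> par y = 0.
Hypothesis Hnx : nx =1 nxf w (rev (pmap (@leaf_of k n) NN)).

Lemma node_range x t r : (x, (t, r)) \in NN -> 6 < x /\ x + clen t <= W.
Proof. by move/allnodes_range; rewrite Hsz. Qed.

Lemma node_lt x t r : (x, (t, r)) \in NN -> 6 < x < W.
Proof. move/node_range=> [x6 xW]; have := clen_gt0 t; lia. Qed.

Lemma node_at x t r : (x, (t, r)) \in NN -> at_pos w x (tree_code t).
Proof. exact: allnodes_at Hat. Qed.

Lemma node_uniq x t r t' r' :
  (x, (t, r)) \in NN -> (x, (t', r')) \in NN -> t = t'.
Proof.
have := allnodes_uniq W (prods G) 6.
elim: NN => [//|[y [s z]] ns IH] /= /andP[yns uns].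
rewrite !inE => /orP[/eqP[-> -> _]|H1] /orP[/eqP[]|H2].
- by move=> ->.
- by case/negP: yns; apply/mapP; exists (y, (t', r')).
- by move=> E _ _; case/negP: yns; apply/mapP; exists (x, (t, r)); rewrite // -E.
exact: IH.
Qed.

Lemma par_node x : par x != 0 -> exists t, (x, (t, par x)) \in NN.
Proof.
move=> px; have : x \in map fst NN.
  by apply: contraNT px => /Hpar0 ->.
by case/mapP=> -[y [t r]] yin /= ->; exists t; have [-> _] := Hpar yin.
Qed.

Lemma leaf_node x A : (x, A) \in rev (pmap (@leaf_of k n) NN) <->
  exists B r, (x, (Leaf B, r)) \in NN /\ A = val B.
Proof. by rewrite mem_rev mem_leaves. Qed.

Lemma gen_node x f t r : (x, (t, r)) \in NN -> gen x f -> derives t f.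
Proof.
move=> xin [[A [xA _]]|[t' [r' [xin' dt]]]]; first by have := node_lt xin; lia.
by rewrite (node_uniq xin xin').
Qed.

Lemma gen_lt x f : gen x f -> x < W + n.
Proof.
case=> [[A [-> _]]|[t [r [/node_lt xin _]]]]; last lia.
by rewrite ltn_add2l.
Qed.

Lemma nx_gen x f : nx x != 0 -> gen x f -> gen (nx x) f.
Proof.
rewrite Hnx => nx0 gx.
have [|A [/leaf_node[B [r [yin AB]]] H]] := nxf_sound _ nx0.
  by move=> y A /leaf_node[B [r [/node_lt yin _]]]; lia.
right; exists (Leaf B), r; split=> //.
case: H => [xA|/leaf_node[C [r' [xin AC]]]].
  case: gx => [[C [xC dC]]|[t [r' [/node_lt xin _]]]]; last lia.
  by rewrite (_ : B = C) //; apply: val_inj; rewrite /= -AB; lia.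
rewrite (_ : B = C); first exact: gen_node xin gx.
by apply: val_inj; rewrite -AB.
Qed.

Lemma up_root x f : W <= par x -> gen x f -> gen (par x) f.
Proof.
move=> Wp gx; have [|t xin] := @par_node x; first lia.
have dt := gen_node xin gx.
case: (allnodes_parent xin) => [[A [-> tin]]|[t' [p' [/node_lt]]]]; last lia.
by left; exists A; split=> //; apply: derives_leaf tin dt.
Qed.

Lemma up_child x f : par x != 0 -> par x < W -> gen x f ->
  exists t t' r, [/\ (x, (t, par x)) \in NN, (par x, (t', r)) \in NN,
    child x t (par x) t' & derives t f].
Proof.
move=> p0 pW gx; have [t xin] := par_node p0.
case: (allnodes_parent xin) => [[A [pA _]]|[t' [p' [pin ch]]]]; first lia.
by exists t, t', p'; split=> //; apply: gen_node xin gx.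
Qed.

Lemma word_at x t r i a s : (x, (t, r)) \in NN -> tree_code t = s ->
  i < size s -> nth 0 s i = a -> nth 0 w (x + i) = a.
Proof. by move=> xin ts lti; rewrite -ts in lti *; rewrite (node_at xin lti). Qed.

Lemma word0 x t r a s : (x, (t, r)) \in NN -> tree_code t = a :: s -> nth 0 w x = a.
Proof. by move=> xin ts; rewrite -[x]addn0; apply: (word_at xin ts). Qed.

Lemma grows_impl fs Q h (S S' : seq (nat * nat) -> Prop) :
  (forall Q', S Q' -> S' Q') -> grows fs Q h S -> grows fs Q h S'.
Proof.
by move=> H [fs' [Q' [I e1 e2 S1]]]; exists fs', Q'; split=> //; apply: H.
Qed.

Lemma copy_spec fs Q h e x v l f :
  search_inv fs Q h -> eval q h [::] e = x -> reg h rv = v -> reg h rl = l.+1 ->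
  onth fs l = Some f -> gen x f -> vals d T f = v ->
  grows fs Q (sem q (sCopy e) h) (fun Q' => (x, v) \in Q').
Proof.
move=> I hx hv hl fl gx fv.
rewrite /sCopy -[sem q _ _]/(sem q sPush _).
have vD : v < D by rewrite -fv; apply: vals_lt.
apply: (@push_spec _ _ _ _ _ _ _ _ _ _ _ _ _ _ _ _ l f) => //=; last by left.
- by do 3![apply: inv_set_reg => //].
- exact: gen_lt gx.
Qed.

Lemma emit_spec fs Q h a b x y c1 c2 c3 u v f P :
  search_inv fs Q h -> reg h rs = c1 ->
  (forall z, eval q (set_reg h r1 z) [::] a = c2) ->
  (forall z z', eval q (set_reg (set_reg h r1 z) r2 z') [::] b = c3) ->
  (forall z z' z2 z3, eval q (set_reg (set_reg (set_reg (set_reg h r1 z) r2 z')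
     r3 z2) rX z3) [::] x = u) ->
  (forall z z' z2 z3, eval q (set_reg (set_reg (set_reg (set_reg h r1 z) r2 z')
     r3 z2) rX z3) [::] y = v) ->
  reg h rp = P -> arg_ok d T c1 u v -> gen P f ->
  vals d T f = valop d T c1 u v -> line_code fs f [:: c1; c2; c3] ->
  grows fs Q (sem q (sEmit a b x y) h)
    (fun Q' => (P, valop d T c1 u v) \in Q').
Proof.
move=> I hs ha hb hx hy hp ok gp fv lf.
pose h1 := set_reg h r1 (reg h rs); pose h2 := set_reg h1 r2 (eval q h1 [::] a).
pose h3 := set_reg h2 r3 (eval q h2 [::] b); pose h4 := set_reg h3 rX (reg h3 rp).
rewrite -[sem q _ _]/(sem q sNew (set_reg h4 rV
  (eval q h4 [::] (App3 eVal (V rs) x y)))).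
have I4 : search_inv fs Q h4 by do 4![apply: inv_set_reg => //].
set e := eval q h4 _ _.
have eE : e = valop d T c1 u v.
  rewrite /e /= hx hy hs.
  by apply: eval_val => //; [apply: inv_K I4|apply: inv_T I4|apply: inv_D I4].
apply: (@new_spec _ _ _ _ _ _ _ _ _ _ _ _ _ _ _ _ c1 c2 c3 f) => //=.
- exact: inv_set_reg.
- exact: ha.
- exact: hb.
- exact: gen_lt gp.
- exact: valop_lt.
Qed.

Definition current (h : state) (x v l : nat) : Prop :=
  [/\ reg h rx = x, reg h rv = v, reg h rl = l.+1
    & [/\ reg h rp = par x, reg h rs = nth 0 w (par x) & reg h rm = lst (par x)]].

Lemma current_sem h x v l c :
  all (fun y => keepr y c) [:: rx; rv; rl; rp; rs; rm] ->
  current h x v l -> current (sem q c h) x v l.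
Proof.
move=> /= /and5P[k1 k2 k3 k4 /and3P[k5 k6 _]] [e1 e2 e3 [e4 e5 e6]].
by split; [| | |split]; rewrite sem_keepr.
Qed.

Lemma current_set h x v l y z : y \notin [:: rx; rv; rl; rp; rs; rm] ->
  current h x v l -> current (set_reg h y z) x v l.
Proof.
rewrite !inE !negb_or => /and5P[k1 k2 k3 k4 /andP[k5 k6]] [e1 e2 e3 [e4 e5 e6]].
by split; [| | |split]; rewrite /= ifN 1?eq_sym.
Qed.

Definition up_closed (x v : nat) (Q Q' : seq (nat * nat)) : Prop :=
  let P := par x in let c := nth 0 w P in
  [/\ c = 3 -> (P, valop d T 3 v 0) \in Q',
      c = 4 \/ c = 5 -> (P, valop d T c (nth 0 w (P + 1)) v) \in Q',
      5 < c -> x = P + 1 ->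
        forall u, (lst P, u) \in Q -> (P, valop d T c v u) \in Q'
    & 5 < c -> x <> P + 1 ->
        forall u, (P + 1, u) \in Q -> (P, valop d T c u v) \in Q'].

Lemma binary_loop (c : stm) (sib : nat) (res : nat -> nat) (fs : seq (formula k))
    Q h x v l f :
  search_inv fs Q h -> current h x v l -> onth fs l = Some f ->
  keepr rD (For rD ru c) ->
  all (fun y => keepr y c) [:: rx; rv; rl; rp; rs; rm] ->
  (forall fs' Q' h u, search_inv fs' Q' h -> current h x v l ->
     onth fs' l = Some f -> u < D ->
     grows fs' Q' (sem q c (set_reg h ru u))
       (fun Q'' => (sib, u) \in Q' -> (par x, res u) \in Q'')) ->
  grows fs Q (sem q (For rD ru c) h)
    (fun Q' => forall u, (sib, u) \in Q -> (par x, res u) \in Q').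
Proof.
move=> I cu fl kD kc step.
pose P j h := exists fs' Q', [/\ search_inv fs' Q' h, ext fs fs', ext Q Q',
  current h x v l &
  forall u, u < j -> (sib, u) \in Q -> (par x, res u) \in Q'].
have [||fs' [Q' [I' e1 e2 _ S]]] := @sem_for q rD ru c h P _ _ kD.
- by exists fs, Q; split=> //; apply: ext_refl.
- move=> j h' [fs1 [Q1 [I1 e1 e2 c1 S1]]]; rewrite (inv_D I1) => jD.
  have [fs2 [Q2 [I2 e3 e4 S2]]] := step fs1 Q1 h' j I1 c1 (ext_onth e1 fl) jD.
  exists fs2, Q2; split=> //; try exact: ext_trans e1 _; try exact: ext_trans e2 _.
    by apply: current_sem => //; apply: current_set.
  move=> u; rewrite ltnS leq_eqVlt => /orP[/eqP->|uj] uQ.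
    by apply: S2; apply: ext_mem uQ.
  by apply: ext_mem e4 _; apply: S1.
exists fs', Q'; split=> // u uQ; apply: S => //.
by rewrite (inv_D I); have [_] := inv_range I uQ.
Qed.

Lemma inner_spec fs Q h x v l f :
  search_inv fs Q h -> current h x v l -> onth fs l = Some f -> gen x f ->
  vals d T f = v -> par x != 0 -> par x < W ->
  grows fs Q (sem q sInner h) (up_closed x v Q).
Proof.
move=> I cu fl gx fv p0 pW; have [cx cv cl [cp cs cm]] := cu.
have vD : v < D by rewrite -fv; apply: vals_lt.
have [t [t' [r [xin pin ch dt]]]] := up_child p0 pW gx.
rewrite /up_closed; set P := par x in cp cs cm p0 pW xin pin ch *.
case: t' pin ch => [//|//|u t1|b t1 t2] pin ch.
- case: ch => tt1 _; subst t1.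
  have gp : gen P (Un u f) by right; exists (Un u t), r; split=> //; constructor.
  case: u pin gp => [|i|i] pin gp; have w0 := word0 pin (erefl _).
  + apply: (@grows_impl _ _ _ (fun Q' => (P, valop d T 3 v 0) \in Q')).
      by move=> Q' S'; split; rewrite ?w0 //; case.
    rewrite /sInner !sem_cond /= cs w0 /=.
    rewrite w0 in cs; apply: (@emit_spec _ _ _ _ _ _ _ 3 l 0 v 0 (Un Not f)) => //=.
    * by rewrite cl subn1.
    * by rewrite fv.
    * exact: line_not.
  + have wi : nth 0 w (P + 1) = i
      by apply: (@word_at _ _ _ 1 _ _ pin (erefl _)).
    apply: (@grows_impl _ _ _ (fun Q' => (P, valop d T 4 i v) \in Q')).
      by move=> Q' S'; split; rewrite ?w0 ?wi.
    rewrite /sInner !sem_cond /= cs w0 /=.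
    rewrite w0 in cs; apply: (@emit_spec _ _ _ _ _ _ _ 4 i l i v (Un (All i) f)) => //=.
    * by rewrite cp (inv_word I) wi.
    * by rewrite cl subn1.
    * by rewrite cp (inv_word I) wi.
    * by rewrite fv.
    * exact: line_all.
  + have wi : nth 0 w (P + 1) = i
      by apply: (@word_at _ _ _ 1 _ _ pin (erefl _)).
    apply: (@grows_impl _ _ _ (fun Q' => (P, valop d T 5 i v) \in Q')).
      by move=> Q' S'; split; rewrite ?w0 ?wi.
    rewrite /sInner !sem_cond /= cs w0 /=.
    rewrite w0 in cs; apply: (@emit_spec _ _ _ _ _ _ _ 5 i l i v (Un (Ex i) f)) => //=.
    * by rewrite cp (inv_word I) wi.
    * by rewrite cl subn1.
    * by rewrite cp (inv_word I) wi.
    * by rewrite fv.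
    * exact: line_ex.
have [t1in t2in] := allnodes_bin pin.
have [_ lP] := Hpar pin; rewrite /last_ok in lP.
have w0 := word0 pin (tree_code_bin b t1 t2).
have c5 : 5 < bcode b by case: (b).
have genP f1 f2 : derives t1 f1 -> derives t2 f2 -> gen P (Bin b f1 f2).
  by move=> d1 d2; right; exists (Bin b t1 t2), r; split=> //; constructor.
have valsP (f1 f2 : formula k) : vals d T (Bin b f1 f2) =
    valop d T (bcode b) (vals d T f1) (vals d T f2) by case: (b).
have lineP fs0 f1 f2 l1 l2 : onth fs0 l1 = Some f1 -> onth fs0 l2 = Some f2 ->
    line_code fs0 (Bin b f1 f2) [:: bcode b; l1; l2].
  by case: (b); constructor.
have argP u1 u2 : u1 < D -> u2 < D -> arg_ok d T (bcode b) u1 u2.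
  by move=> a1 a2; case: (b); rewrite /= a1 a2.
have cl1 := clen_gt0 t1.
rewrite /sInner !sem_cond /= cs w0 ifT; last lia.
rewrite cx cp; case: (eqVneq x (P + 1)) => xP.
  have tt1 : t = t1.
    by case: ch => [[]|[_]] //; lia.
  subst t; rewrite ifF; last lia.
  apply: (@grows_impl _ _ _ (fun Q' => forall u, (lst P, u) \in Q ->
     (P, valop d T (bcode b) v u) \in Q')).
    move=> Q' S' /=; split=> //; first by lia.
    by case; lia.
  apply: (binary_loop I cu fl) => // fs' Q' h' u I' [cx' cv' cl' [cp' cs' cm']] fl' uD.
  rewrite /sLeft sem_sq sem_asg sem_cond /= cm' eval_addr /= (inv_D I') -/P.
  case: ifP => ry0; last first.
    exists fs', Q'; split=> //; try exact: ext_refl.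
      by do 2![apply: inv_set_reg => //].
    by rewrite (inv_table I') // in ry0; rewrite ry0.
  have uQ : (lst P, u) \in Q' by rewrite -(inv_table I').
  have [l2 [f2 [a1 a2 a3 a4]]] := inv_sound I' uQ.
  rewrite lP in a3; have d2 := gen_node t2in a3.
  apply: (@grows_impl _ _ _ (fun Q' => (P, valop d T (bcode b) v u) \in Q')) => //.
  apply: (@emit_spec _ _ _ _ _ _ _ (bcode b) l l2 v u (Bin b f f2)) => //=.
  - by do 2![apply: inv_set_reg => //].
  - by rewrite cs' w0.
  - by rewrite cl' subn1.
  - by rewrite a1 subn1.
  - exact: argP.
  - exact: genP.
  - by rewrite -fv -a4; apply: valsP.
  - exact: lineP.
have [tt2 xl] : t = t2 /\ x = lst P.
  by case: ch => [[_ xE]|[-> ->]]; [lia|rewrite lP].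
subst t; rewrite ifT; last lia.
apply: (@grows_impl _ _ _ (fun Q' => forall u, (P + 1, u) \in Q ->
   (P, valop d T (bcode b) u v) \in Q')).
  move=> Q' S' /=; split=> //; [by lia|by case; lia|].
  by move=> _ E; rewrite E eqxx in xP.
apply: (binary_loop I cu fl) => // fs' Q' h' u I' [cx' cv' cl' [cp' cs' cm']] fl' uD.
rewrite /sRight sem_sq sem_asg sem_cond /= cp' eval_addr /= (inv_D I') -/P.
case: ifP => ry0; last first.
  exists fs', Q'; split=> //; try exact: ext_refl.
    by do 2![apply: inv_set_reg => //].
  by rewrite (inv_table I') // in ry0; rewrite ry0.
have uQ : (P + 1, u) \in Q' by rewrite -(inv_table I').
have [l1 [f1 [a1 a2 a3 a4]]] := inv_sound I' uQ.
rewrite addn1 in a3; have d1 := gen_node t1in a3.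
apply: (@grows_impl _ _ _ (fun Q' => (P, valop d T (bcode b) u v) \in Q')) => //.
apply: (@emit_spec _ _ _ _ _ _ _ (bcode b) l1 l u v (Bin b f1 f)) => //=.
- by do 2![apply: inv_set_reg => //].
- by rewrite cs' w0.
- by rewrite a1 subn1.
- by rewrite cl' subn1.
- exact: argP.
- exact: genP.
- by rewrite -fv -a4; apply: valsP.
- exact: lineP.
Qed.

Definition item_closed (x v : nat) (Q Q' : seq (nat * nat)) : Prop :=
  [/\ nx x != 0 -> (nx x, v) \in Q', W <= par x -> (par x, v) \in Q'
    & par x != 0 -> par x < W -> up_closed x v Q Q'].

Lemma item_spec fs Q h x v :
  search_inv fs Q h -> reg h rHd < size Q -> nth (0, 0) Q (reg h rHd) = (x, v) ->
  grows fs Q (sem q (sFetch ;;; sNext ;;; sUp) h) (item_closed x v Q) /\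
  reg (sem q (sFetch ;;; sNext ;;; sUp) h) rHd = (reg h rHd).+1.
Proof.
move=> I jQ Qj; split; last first.
  by rewrite 2!sem_sq sem_keepr // sem_keepr // /sFetch !sem_sq !sem_asg /= addn1.
have xQ : (x, v) \in Q by rewrite -Qj mem_nth.
have [xn vD] := inv_range I xQ.
have [l [f [a1 a2 a3 a4]]] := inv_sound I xQ.
have [ax av] : arr h 5 (reg h rHd) = x /\ arr h 6 (reg h rHd) = v.
  by have := inv_queue I jQ; rewrite Qj => -[].
rewrite 2!sem_sq; set h1 := sem q sFetch h.
have [I1 c1 ry1] : [/\ search_inv fs Q h1, current h1 x v l & reg h1 ry = nx x].
  rewrite /h1 /sFetch !sem_sq !sem_asg; split.
  - by do 8![apply: inv_set_reg => //].
  - split=> /=; [by rewrite ax|by rewrite av| |split].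
    + by rewrite eval_addr /= ax av (inv_D I) a1.
    + by rewrite ax (inv_par I).
    + by rewrite ax (inv_par I) (inv_word I).
    + by rewrite ax (inv_par I) (inv_lst I).
  - by rewrite /= ax (inv_nx I).
clearbody h1; have [cx cv cl _] := c1.
have [fs2 [Q2 [I2 e1 e2 S2]]] :
    grows fs Q (sem q sNext h1) (fun Q' => nx x != 0 -> (nx x, v) \in Q').
  rewrite /sNext sem_cond /= ry1; case: ifP => nx0; last first.
    by exists fs, Q; split=> //; apply: ext_refl.
  apply: (@grows_impl _ _ _ (fun Q' => (nx x, v) \in Q')) => //.
  by apply: (@copy_spec _ _ _ _ _ _ l f) => //; apply: nx_gen.
have c2 : current (sem q sNext h1) x v l by apply: current_sem.
have a2' := ext_onth e1 a2.
move: (sem q sNext h1) I2 c2 => h2 I2 c2.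
have [cx2 cv2 cl2 [cp2 cs2 cm2]] := c2.
have [fs3 [Q3 [I3 e3 e4 [S3 S4]]]] : grows fs2 Q2 (sem q sUp h2) (fun Q' =>
    (W <= par x -> (par x, v) \in Q') /\
    (par x != 0 -> par x < W -> up_closed x v Q2 Q')).
  rewrite /sUp sem_cond /= cp2.
  case: ifP => p0; last first.
    exists fs2, Q2; split=> //; try exact: ext_refl.
    by split=> // Wp; have := Hsz; lia.
  rewrite sem_cond /= cp2 (inv_W I2); case: ifP => pW.
    apply: (@grows_impl _ _ _ (fun Q' => (par x, v) \in Q')).
      by move=> Q' S'; split=> //; lia.
    by apply: (@copy_spec _ _ _ _ _ _ l f) => //; apply: up_root => //; lia.
  apply: (@grows_impl _ _ _ (up_closed x v Q2)).
    by move=> Q' S'; split=> //; lia.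
  by apply: (@inner_spec _ _ _ _ _ l f) => //; lia.
exists fs3, Q3; split=> //; [exact: ext_trans e3|exact: ext_trans e4|].
split=> //.
  by move=> nx0; apply: ext_mem e4 _; apply: S2.
move=> p0 pW; have [u1 u2 u3 u4] := S4 p0 pW; split=> // *.
  by apply: u3 => //; apply: ext_mem e2 _.
by apply: u4 => //; apply: ext_mem e2 _.
Qed.

Lemma par_neq0 x t r : (x, (t, r)) \in NN -> par x != 0.
Proof.
move=> xin; have [-> _] := Hpar xin; have W0 := Hsz.
case: (allnodes_parent xin) => [[A [-> _]]|[t' [p' [/node_lt]]]]; lia.
Qed.

Hypothesis hd : d = 0 \/ d = k.

Lemma atom_spec fs Q h i :
  search_inv fs Q h -> reg h rI = i ->
  grows fs Q (sem q sAtom h) (fun Q' => forall a r,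
    (i, (Atom a, r)) \in NN -> (i, vals d T (Atom a)) \in Q').
Proof.
move=> I hi.
have atomw a r : (i, (Atom a, r)) \in NN -> 0 < nth 0 w i < 3.
  move=> iin; suff [->|->] : nth 0 w i = 1 \/ nth 0 w i = 2 by [].
  by case: a iin => ? ? iin; [left|right]; apply: (word0 iin (erefl _)).
have none : ~~ ((par i != 0) && (0 < nth 0 w i < 3)) ->
    grows fs Q h (fun Q' => forall a r,
      (i, (Atom a, r)) \in NN -> (i, vals d T (Atom a)) \in Q').
  move=> no; exists fs, Q; split=> //; try exact: ext_refl.
  by move=> a r iin; move: no; rewrite (par_neq0 iin) (atomw _ _ iin).
rewrite /sAtom sem_cond /= hi (inv_par I); case: ifP => p0; last first.
  by apply: none; rewrite p0.
rewrite sem_cond /= hi (inv_word I); case: ifP => w0; last first.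
  by apply: none; lia.
rewrite sem_cond /= hi (inv_word I); case: ifP => w3.
  by apply: none; lia.
have [t iin] := par_node p0.
have [a tE] : exists a, t = Atom a.
  case: t iin => [A|a|u t|b t1 t2] iin; last 1 first.
  - by have := word0 iin (tree_code_bin _ _ _); case: (b) => /=; lia.
  - by have := word0 iin (erefl _); lia.
  - by exists a.
  case: u iin => [|j|j] iin; by have := word0 iin (erefl _); lia.
subst t.
apply: (@grows_impl _ _ _ (fun Q' => (i, vals d T (Atom a)) \in Q')).
  move=> Q' S a' r' iin'; have [<- //] : Atom a = Atom a' :> tree k 'I_n.
  exact: node_uniq iin iin'.
have gi : gen i (Atom a).
  by right; exists (Atom a), (par i); split=> //; constructor.
rewrite 2!sem_sq !sem_asg /= hi (inv_word I).
case: a {none} iin gi => j l iin gi.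
- have i0 : nth 0 w i = 1 := word0 iin (erefl _).
  have i1 : nth 0 w (i + 1) = j by apply: (@word_at _ _ _ 1 _ _ iin (erefl _)).
  have i2 : nth 0 w (i + 2) = l by apply: (@word_at _ _ _ 2 _ _ iin (erefl _)).
  apply: (@emit_spec _ _ _ _ _ _ _ 1 j l j l (Atom (Lt j l))) => //=;
    rewrite ?(inv_word I) ?i1 ?i2 //.
  + by do 2![apply: inv_set_reg => //].
  + by case: hd => ->; rewrite // !ltn_ord orbT.
  + exact: line_lt.
have i0 : nth 0 w i = 2 := word0 iin (erefl _).
have i1 : nth 0 w (i + 1) = j by apply: (@word_at _ _ _ 1 _ _ iin (erefl _)).
have i2 : nth 0 w (i + 2) = l by apply: (@word_at _ _ _ 2 _ _ iin (erefl _)).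
apply: (@emit_spec _ _ _ _ _ _ _ 2 j l j l (Atom (Eq j l))) => //=;
  rewrite ?(inv_word I) ?i1 ?i2 //.
- by do 2![apply: inv_set_reg => //].
- by case: hd => ->; rewrite // !ltn_ord orbT.
- exact: line_eq.
Qed.

End Processing.

Definition sFind : stm :=
  Asg rx (Plus (V rW) (Arr 0 (K 4))) ;;;
  For rD rI
    (Cond (Arr 7 (addr (V rx) (V rI)))
      (Cond (App1 eBad (V rI)) Skip (Asg rFound (Arr 7 (addr (V rx) (V rI)))))
      Skip).

(* Copies also the unused lines: the output is delimited by register 0. *)
Definition sCopyLine : stm :=
  Asg rx (Plus (V rI) (Plus (V rI) (V rI))) ;;;
  St 0 (Plus (V rx) (K 1)) (Arr 8 (V rI)) ;;;
  St 0 (Plus (V rx) (K 2)) (Arr 9 (V rI)) ;;;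
  St 0 (Plus (V rx) (K 3)) (Arr 10 (V rI)).

Definition sOut : stm :=
  Cond (V rFound)
    (For rF rI sCopyLine ;;; St 0 (K 0) (K 1) ;;;
     Asg rW (Plus (K 1) (Plus (V rFound) (Plus (V rFound) (V rFound)))))
    (St 0 (K 0) (K 0) ;;; Asg rW (K 1)).

Lemma onth_some (A : Type) (s : seq A) i : i < size s -> exists x, onth s i = Some x.
Proof. by elim: s i => [//|y s IH] [|i] /=; [exists y | apply: IH]. Qed.

Lemma take_onth (A : Type) (s : seq A) i x :
  onth s i = Some x -> take i.+1 s = rcons (take i s) x.
Proof.
by elim: s i => [|y s IH] [|i] //=; [move=> [->]; rewrite take0 | move/IH=> ->].
Qed.

Section Loops.
Variables (k : nat) (G : grammar k) (q : seq rat) (w : seq nat).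
Variables (d m p : nat) (par lst nx : nat -> nat).
Local Notation n := (nonterms G).
Local Notation W := (size w).
Local Notation T := (d ^ d).
Local Notation D := (2 ^ T).
Local Notation NN := (allnodes W (prods G) 6).
Local Notation gen := (@gen k G w).
Local Notation search_inv := (@search_inv k G w d T m p par lst nx).
Local Notation grows := (@grows k G w d T m p par lst nx).

Hypothesis Hat : at_pos w 6 (prods_code (prods G)).
Hypothesis Hsz : 6 + size (prods_code (prods G)) = W.
Hypothesis Hpar : parsed par lst NN.
Hypothesis Hpar0 : forall y, y \notin map fst NN -> par y = 0.
Hypothesis Hnx : nx =1 nxf w (rev (pmap (@leaf_of k n) NN)).

Lemma inv_size fs Q h : search_inv fs Q h -> size Q <= (W + n) * D.
Proof.
move=> I; rewrite -(size_iota 0 (W + n)) -[X in _ * X](size_iota 0 D).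
rewrite -(size_allpairs (fun x v => (x, v))).
apply: uniq_leq_size; first exact: inv_uniq I.
move=> [x v] /(inv_range I)[xn vD].
by apply/allpairsP; exists (x, v); rewrite !mem_iota.
Qed.

Definition has_atoms (Q : seq (nat * nat)) : Prop := forall x a r,
  (x, (Atom a, r)) \in NN -> (x, vals d T (Atom a)) \in Q.

Lemma atoms_loop h : d = 0 \/ d = k -> search_inv [::] [::] h ->
  exists fs Q, search_inv fs Q (sem q (For rW rI sAtom) h) /\ has_atoms Q.
Proof.
move=> hd I.
pose P j h := exists fs Q, search_inv fs Q h /\ forall x a r, x < j ->
  (x, (Atom a, r)) \in NN -> (x, vals d T (Atom a)) \in Q.
have [|||fs [Q [I' S]]] := @sem_for q rW rI sAtom h P.
- by exists [::], [::].
- move=> j h1 [fs1 [Q1 [I1 S1]]] _.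
  have I2 : search_inv fs1 Q1 (set_reg h1 rI j) by apply: inv_set_reg.
  have [|fs2 [Q2 [I3 e1 e2 S2]]] :=
    @atom_spec k G q w d m p par lst nx Hat Hsz Hpar Hpar0 hd fs1 Q1 _ j I2.
    by [].
  exists fs2, Q2; split=> // x a r; rewrite ltnS leq_eqVlt => /orP[/eqP->|xj] xin.
    exact: S2 xin.
  exact: ext_mem e2 (S1 _ _ _ xj xin).
- by [].
exists fs, Q; split=> // x a r xin; apply: S (xin).
by rewrite (inv_W I); have := node_lt Hsz xin; lia.
Qed.

(* The rules of a binary node are complete once both children have been taken
   from the queue: whichever comes last sees the other in the table. *)
Definition queue_closed (R Q : seq (nat * nat)) : Prop :=
  (forall x v, (x, v) \in R ->
    [/\ nx x != 0 -> (nx x, v) \in Q, W <= par x -> (par x, v) \in Q &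
      let P := par x in let c := nth 0 w P in P != 0 -> P < W ->
      (c = 3 -> (P, valop d T 3 v 0) \in Q) /\
      (c = 4 \/ c = 5 -> (P, valop d T c (nth 0 w (P + 1)) v) \in Q)]) /\
  (forall P u v, P != 0 -> P < W -> 5 < nth 0 w P -> par (P + 1) = P ->
    par (lst P) = P -> lst P <> P + 1 -> (P + 1, u) \in R ->
    (lst P, v) \in R -> (P, valop d T (nth 0 w P) u v) \in Q).

Lemma queue_closed_rcons R Q Q' x v : {subset R <= Q} -> (x, v) \in Q -> ext Q Q' ->
  queue_closed R Q -> item_closed w d par lst nx x v Q Q' ->
  queue_closed (rcons R (x, v)) Q'.
Proof.
move=> RQ xQ e [C1 C2] [I1 I2 I3]; split=> [y u|P u u' p0 pW w5 pl pr lP].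
  rewrite mem_rcons inE => /orP[/eqP[-> ->]|yu].
    by split=> // P c p0 pW; have [H1 H2 _ _] := I3 p0 pW.
  have [H1 H2 H3] := C1 _ _ yu.
  split=> [y0|pW|P c p0 pW]; first exact: ext_mem e (H1 y0).
    exact: ext_mem e (H2 pW).
  have [H4 H5] := H3 p0 pW.
  by split=> E; [apply: ext_mem e (H4 E)|apply: ext_mem e (H5 E)].
rewrite !mem_rcons !inE.
case/orP=> [/eqP[px uv]|lR].
  have [] : par x != 0 /\ par x < W by rewrite -px pl.
  move=> /I3 H /H [_ _ H1 _]; move: H1; rewrite -px pl -uv => H1.
  case/orP=> [/eqP[lx _]|rR]; first by case: lP; rewrite lx px.
  by apply: H1 => //; apply: RQ.
case/orP=> [/eqP[rx' uv]|rR].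
  have [] : par x != 0 /\ par x < W by rewrite -rx' pr.
  move=> /I3 H /H [_ _ _ H1]; move: H1; rewrite -rx' pr -uv => H1.
  by apply: H1 => //; apply: RQ.
by apply: ext_mem e _; apply: C2.
Qed.

Lemma main_loop fs0 Q0 h : search_inv fs0 Q0 h -> reg h rHd = 0 ->
  reg h rF = (W + n) * D -> has_atoms Q0 ->
  exists fs Q, [/\ search_inv fs Q (sem q (For rF rI sItem) h), has_atoms Q
    & queue_closed Q Q].
Proof.
move=> I hH hF A0.
pose P j h := exists fs Q, [/\ search_inv fs Q h, has_atoms Q,
  reg h rHd <= size Q, j <= reg h rHd \/ reg h rHd = size Q
  & queue_closed (take (reg h rHd) Q) Q].
have [|||fs [Q [I' A S1 S2 C]]] := @sem_for q rF rI sItem h P.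
- exists fs0, Q0; rewrite hH take0; split=> //; first by left.
- move=> j h1 [fs1 [Q1 [I1 A1 S1 S2 C1]]] _.
  rewrite /sItem sem_cond /= (inv_tl I1).
  have I2 : search_inv fs1 Q1 (set_reg h1 rI j) by apply: inv_set_reg.
  case: ifP => E; last first.
    by exists fs1, Q1; split=> //=; right; lia.
  have jQ : reg (set_reg h1 rI j) rHd < size Q1 by rewrite /=; lia.
  case N : (nth (0, 0) Q1 (reg h1 rHd)) => [x v].
  have [[fs2 [Q2 [I3 e1 e2 C2]]] hd2] := @item_spec k G q w d m p par lst nx Hat
     Hsz Hpar Hpar0 Hnx fs1 Q1 (set_reg h1 rI j) x v I2 jQ N.
  have sQ : size Q1 <= size Q2 by case: e2 => r ->; rewrite size_cat leq_addr.
  exists fs2, Q2; rewrite hd2 /= in jQ *; split=> //.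
  + by move=> y a r /A1; apply: ext_mem.
  + lia.
  + by left; lia.
  have -> : take (reg h1 rHd).+1 Q2 = rcons (take (reg h1 rHd) Q1) (x, v).
    case: e2 => r ->; rewrite takel_cat // (take_nth (0, 0)) ?N //.
  apply: queue_closed_rcons C2 => //.
  + by move=> y; apply: mem_take.
  + by rewrite -N mem_nth.
- by [].
exists fs, Q; split=> //; move: C; rewrite take_oversize //.
by case: S2 => [|->//]; rewrite hF; apply: leq_trans; apply: inv_size I'.
Qed.

Lemma queue_closed_complete Q : has_atoms Q -> queue_closed Q Q ->
  forall t f, derives t f ->
  (forall x r, (x, (t, r)) \in NN -> (x, vals d T f) \in Q) /\
  (forall A, t = Leaf A -> (W + A, vals d T f) \in Q).
Proof.
move=> At [C1 C2] t f; elim=> {t f} [A t f tin _ [IH _]|a|u t f _ [IH _]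
  |b t1 t2 f1 f2 _ [IH1 _] _ [IH2 _]].
- have inA : (W + A, vals d T f) \in Q.
    have [y yin] := @allnodes_root k n W (prods G) 6 A t tin.
    have [_ H _] := C1 _ _ (IH _ _ yin); have [py _] := Hpar yin.
    by rewrite py in H; apply: H; lia.
  split; last by move=> B [<-].
  move=> x r xin.
  apply: (@nxf_complete w (fun z => (z, vals d T f) \in Q)
    (rev (pmap (@leaf_of k n) NN)) A) => //.
  + rewrite map_rev rev_uniq; apply: subseq_uniq (leaves_subseq _) _.
    exact: allnodes_uniq.
  + by move=> y B /leaf_node[B' [r' [/(node_lt Hsz) yin _]]]; lia.
  + by move=> y yQ; rewrite -Hnx; have [H _ _] := C1 _ _ yQ.
  + by apply/leaf_node; exists A, r.
- by split=> // x r; apply: At.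
- split=> // x r xin; have cin := allnodes_un xin.
  have [_ _ H] := C1 _ _ (IH _ _ cin); have [pc _] := Hpar cin.
  rewrite pc in H; have xW := node_lt Hsz xin.
  have {H}[||H3 H4] := H; [lia|lia|].
  case: u xin {cin pc} => [|i|i] xin.
  + by apply: H3; apply: (word0 Hat xin (erefl _)).
  + have w0 := word0 Hat xin (erefl _).
    have wi : nth 0 w (x + 1) = i
      by apply: (@word_at k G w Hat _ _ _ 1 _ _ xin (erefl _)).
    by rewrite w0 wi in H4; apply: H4; left.
  + have w0 := word0 Hat xin (erefl _).
    have wi : nth 0 w (x + 1) = i
      by apply: (@word_at k G w Hat _ _ _ 1 _ _ xin (erefl _)).
    by rewrite w0 wi in H4; apply: H4; right.
split=> // x r xin; have [c1 c2] := allnodes_bin xin.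
have w0 := word0 Hat xin (tree_code_bin b t1 t2).
have [p1 _] := Hpar c1; have [p2 _] := Hpar c2.
have [_ /= lx] := Hpar xin; have cl := clen_gt0 t1.
have xW := node_lt Hsz xin.
rewrite -lx in c2 p2; rewrite -addn1 in c1 p1.
have := C2 x _ _ _ _ _ p1 p2 _ (IH1 _ _ c1) (IH2 _ _ c2).
rewrite w0 => H.
suff : (x, valop d T (bcode b) (vals d T f1) (vals d T f2)) \in Q by case: (b).
by apply: H; rewrite ?lx; try lia; case: (b).
Qed.

Lemma find_correct fs Q h :
  nth 0 w 4 = start G -> search_inv fs Q h -> has_atoms Q -> queue_closed Q Q ->
  reg h rFound = 0 ->
  let h' := sem q sFind h in
  [/\ search_inv fs Q h',
    reg h' rFound = 0 -> forall f, derives (Leaf (start G)) f ->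
      ~~ accepts q d T m p (vals d T f)
  & forall l, reg h' rFound = l.+1 -> exists f,
      [/\ onth fs l = Some f, derives (Leaf (start G)) f
        & accepts q d T m p (vals d T f)]].
Proof.
move=> Hstart I A C h0 h'.
pose S := W + start G.
pose P j h := [/\ search_inv fs Q h, reg h rx = S,
  reg h rFound = 0 -> forall v, v < j -> (S, v) \in Q -> ~~ accepts q d T m p v
  & forall l, reg h rFound = l.+1 -> exists f,
      [/\ onth fs l = Some f, derives (Leaf (start G)) f
        & accepts q d T m p (vals d T f)]].
have [|||I' _ N F] := @sem_for q rD rI (Cond (Arr 7 (addr (V rx) (V rI)))
      (Cond (App1 eBad (V rI)) Skip (Asg rFound (Arr 7 (addr (V rx) (V rI)))))
      Skip) (set_reg h rx S) P.
- split=> //=; first exact: inv_set_reg.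
  by rewrite h0.
- move=> j h1 [I1 x1 N1 F1]; rewrite (inv_D I1) => jD.
  have I2 : search_inv fs Q (set_reg h1 rI j) by apply: inv_set_reg.
  rewrite sem_cond /= eval_addr /= x1 (inv_D I1) (inv_table I1) //.
  case: ifP => SQ; last first.
    split=> //= E v; rewrite ltnS leq_eqVlt => /orP[/eqP->|]; last exact: N1.
    by rewrite SQ.
  rewrite sem_cond /= (@eval_bad q (set_reg h1 rI j) d T m p) //; first last.
    exact: inv_P I2. exact: inv_M I2. exact: inv_D I2. exact: inv_T I2. exact: inv_K I2.
  case: ifP => acc.
    split=> //= E v; rewrite ltnS leq_eqVlt => /orP[/eqP->//|]; exact: N1.
  move/negbFE: acc => acc.
  have [l [f [a1 a2 a3 a4]]] := inv_sound I1 SQ.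
  rewrite sem_asg /= eval_addr /= x1 (inv_D I1) a1; split=> //=.
  + exact: inv_set_reg.
  + move=> l' [<-]; exists f; rewrite a4; split=> //.
    case: a3 => [[B [/addnI E dB]]|[t [r [/(node_lt Hsz) H _]]]].
      by rewrite (_ : start G = B) //; apply: val_inj.
    by move: H; rewrite /S; lia.
- by [].
have hE : h' = sem q (For rD rI (Cond (Arr 7 (addr (V rx) (V rI)))
      (Cond (App1 eBad (V rI)) Skip (Asg rFound (Arr 7 (addr (V rx) (V rI)))))
      Skip)) (set_reg h rx S).
  rewrite /h' /sFind sem_sq sem_asg; congr (sem q _ (set_reg h _ _)).
  by rewrite /= (inv_W I) (inv_word I) Hstart.
rewrite -hE in I' N F; split=> // E f df; apply: (N E).
  by rewrite /= (inv_D I) vals_lt.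
by have [_] := queue_closed_complete A C df; apply.
Qed.

Lemma lines_take fs Q h : search_inv fs Q h -> forall j, j <= size fs ->
  lines_code (take j fs) (flatten
    [seq [:: arr h 8 i; arr h 9 i; arr h 10 i] | i <- iota 0 j]).
Proof.
move=> I; elim=> [|j IH] jfs; first by rewrite take0; constructor.
have [f fj] : exists f, onth fs j = Some f.
  exact: onth_some.
rewrite (take_onth fj).
have -> : iota 0 j.+1 = iota 0 j ++ [:: j] by rewrite -[j.+1]addn1 iotaD.
rewrite map_cat flatten_cat /=.
by constructor; [apply: IH; lia|apply: inv_lines I _ _ fj].
Qed.

Lemma mkseq_lines (a : nat -> nat) (b : nat -> seq nat) j :
  (forall i, i < j -> [:: a (3 * i).+1; a (3 * i).+2; a (3 * i).+3] = b i) ->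
  mkseq a (1 + 3 * j) = a 0 :: flatten [seq b i | i <- iota 0 j].
Proof.
elim: j => [//|j IH] H.
have -> : iota 0 j.+1 = iota 0 j ++ [:: j] by rewrite -[j.+1]addn1 iotaD.
rewrite (_ : 1 + 3 * j.+1 = (1 + 3 * j) + 3); last lia.
rewrite /mkseq iotaD !map_cat -/(mkseq _ _) IH; last by move=> i ij; apply: H; lia.
by rewrite flatten_cat /= cats0 -H // add0n add1n.
Qed.

Lemma out_spec fs Q h : search_inv fs Q h -> reg h rF = (W + n) * D ->
  (forall l, reg h rFound = l.+1 -> l < size fs) ->
  output (sem q sOut h) = if reg h rFound is l.+1 then
     1 :: flatten [seq [:: arr h 8 i; arr h 9 i; arr h 10 i] | i <- iota 0 l.+1]
  else [:: 0].
Proof.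
move=> I hF hl; have hfs := leq_trans (inv_lines_le I) (inv_size I).
rewrite /sOut sem_cond /=.
case E : (reg h rFound) => [|l] /=.
  by rewrite sem_sq sem_asg sem_st /output.
have lfs := hl _ E.
pose P j h' := [/\ arr h' 8 =1 arr h 8, arr h' 9 =1 arr h 9, arr h' 10 =1 arr h 10
  & forall i, i < j -> [:: arr h' 0 (3 * i).+1; arr h' 0 (3 * i).+2;
      arr h' 0 (3 * i).+3] = [:: arr h 8 i; arr h 9 i; arr h 10 i]].
have [|||_ _ _] := @sem_for q rF rI sCopyLine h P.
- by split.
- move=> j h1 [A1 A2 A3 A4] _.
  split; try by move=> i; rewrite sem_keepa //= ?A1 ?A2 ?A3.
  move=> i; rewrite /sCopyLine ltnS => ij.
  have [->|ij'] := eqVneq i j; last first.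
    rewrite -A4; last lia.
    congr [:: _; _; _]; rewrite /sem /= !ifN //; lia.
  rewrite -A1 -A2 -A3 /sem /=.
  have e1 : (3 * j).+1 = j + (j + j) + 1 by lia.
  have e2 : (3 * j).+2 = j + (j + j) + 2 by lia.
  have e3 : (3 * j).+3 = j + (j + j) + 3 by lia.
  by rewrite e3 e2 e1 !eqn_add2l !eqxx.
- by [].
rewrite hF => H.
set h' := sem q _ h in H *.
have E' : reg h' rFound = l.+1 by rewrite sem_keepr.
rewrite /output 2!sem_sq sem_asg sem_st -/h' /=.
rewrite E' (_ : 1 + _ = 1 + 3 * l.+1); last lia.
rewrite (@mkseq_lines _ (fun i => [:: arr h 8 i; arr h 9 i; arr h 10 i])) //.
by move=> i il; rewrite -H //; lia.
Qed.

End Loops.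

(** * The whole program *)

Definition sInput : stm :=
  Asg rP (Arr 0 (K 1)) ;;; Asg rM (Plus (V rP) (Arr 0 (K 2))) ;;;
  Asg rK (IfE (V rM) (Arr 0 (K 0)) (K 0)) ;;; Asg rPos (K 6).
Definition sTypes : stm := Asg rT (It rK (K 1) (App1 eMulK (L 0))).
Definition sValues : stm := Asg rD (It rT (K 1) (Plus (L 0) (L 0))).
Definition sFacts : stm := Asg rF (App1 eMulD (Plus (V rW) (Arr 0 (K 3)))).
Definition sSearch : stm :=
  For rW rI sParse ;;; For rW rI sAtom ;;; For rF rI sItem ;;; sFind.

Definition stages : seq (seq nat * stm) :=
  [:: ([::], sInput); ([:: rK], sTypes); ([:: rT], sValues); ([:: rD], sFacts);
      ([:: rW; rK; rM; rT; rD; rF], sSearch); ([:: rF], sOut)].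

Definition run_stages (q : seq rat) (cs : seq (seq nat * stm)) (h : state) : state :=
  foldl (fun h c => sem q c.2 h) h cs.

Definition compile (cs : seq (seq nat * stm)) : prog :=
  foldr (fun c r => Seq (compS nregs c.2) r) (Const nregs 0) cs.

Definition big : pred nat := mem [:: rW; rF].

Fixpoint stages_within (q : seq rat) (beta : nat -> nat) (cs : seq (seq nat * stm))
    (h : state) : Prop :=
  if cs is c :: cs' then
    (forall x, x \in c.1 -> reg h x <= beta x) /\
    stages_within q beta cs' (sem q c.2 h)
  else True.

Lemma run_stages_cons q c cs h :
  run_stages q (c :: cs) h = run_stages q cs (sem q c.2 h).
Proof. by []. Qed.

Lemma stages_within_cons q beta c cs h h' :
  (forall x, x \in c.1 -> reg h x <= beta x) -> sem q c.2 h = h' ->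
  stages_within q beta cs h' -> stages_within q beta (c :: cs) h.
Proof. by move=> hb <-. Qed.

Lemma compile_correct q beta cs s h :
  all (fun c => wfs nregs (mem c.1) big c.2) cs -> stages_within q beta cs h ->
  agree nregs s h ->
  exists t s', [/\ exec q (compile cs) s t s',
    t <= \sum_(c <- cs) scost beta c.2 + 1 & agree nregs s' (run_stages q cs h)].
Proof.
elim: cs s h => [|c cs IH] s h /=.
  move=> _ _ [Hr Ha]; exists 1, (set_reg s nregs 0); split.
  - exact: exec_const.
  - by rewrite big_nil.
  by split=> // x xg; rewrite /= ltn_eqF // Hr.
move=> /andP[wc wcs] [hb hbs] ag.
have wi : within nregs (mem c.1) beta h by move=> x _; apply: hb.
have [t1 [s1 [e1 k1 ag1 _]]] := compS_correct q wc (leqnn _) wi ag.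
have [t2 [s2 [e2 k2 ag2]]] := IH _ _ wcs hbs ag1.
exists (t1 + t2), s2; split=> //; first exact: exec_seq e1 e2.
by rewrite big_cons -addnA leq_add.
Qed.

Definition degree : nat := \max_(c <- stages) sdepth c.2.
Definition stages_size : nat := \sum_(c <- stages) ssize c.2.

Lemma stages_wf : all (fun c => wfs nregs (mem c.1) big c.2) stages.
Proof. by vm_compute. Qed.

Definition count_bound (B Z x : nat) : nat := if big x then B * Z else B.

Lemma stages_shallow :
  all (fun c => (sdepth c.2 <= degree) && (sbig big c.2 <= 1)) stages.
Proof. by rewrite /degree unlock; vm_compute. Qed.

Lemma stages_cost B Z : 0 < B -> 0 < Z ->
  \sum_(c <- stages) scost (count_bound B Z) c.2 + 1
    <= (stages_size + 1) * (B ^ degree * Z).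
Proof.
move=> B0 Z0; rewrite mulnDl mul1n.
apply: leq_add; last by rewrite muln_gt0 expn_gt0 B0.
rewrite /stages_size; move: stages_wf stages_shallow; move: degree => E.
elim: stages => [|c cs IH] /=; first by rewrite big_nil.
move=> /andP[wc /IH{}IH] /andP[/andP[dc bc] /IH{}IH].
rewrite !big_cons mulnDl leq_add //.
have b1 x : (mem c.1) x -> ~~ big x -> count_bound B Z x <= B.
  by rewrite /count_bound => _ /negPf->.
have b2 x : (mem c.1) x -> big x -> count_bound B Z x <= B * Z.
  by rewrite /count_bound => _ ->.
apply: leq_trans (scost_bound B0 Z0 b1 b2 wc) _.
rewrite leq_mul2l; apply/orP; right; apply: leq_mul; first by rewrite leq_pexp2l.
by case: (sbig big c.2) bc => [|[|//]] _; rewrite ?expn0 ?expn1.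
Qed.

Lemma iter_fixed (A : Type) (f : A -> A) x m : f x = x -> iter m f x = x.
Proof. by move=> fx; elim: m => //= m ->. Qed.

Lemma prods_code_size (k n : nat) (ps : seq ('I_n * tree k 'I_n)) :
  size (prods_code ps) <= 3 * \sum_(p <- ps) (tree_size p.2).+1.
Proof.
elim: ps => [|[A t] ps IH]; first by rewrite big_nil.
rewrite big_cons /prods_code /= size_cat -/(prods_code ps) -/(clen t).
by have := clen_tree_size t; lia.
Qed.

Lemma nonterms_gt0 (k : nat) (G : grammar k) : 0 < nonterms G.
Proof. exact: leq_ltn_trans (leq0n _) (ltn_ord (start G)). Qed.

Lemma iteri_mul c j : iteri j (fun _ acc => acc * c) 1 = c ^ j.
Proof. by elim: j => //= j ->; rewrite expnS mulnC. Qed.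

Lemma iteri_double j : iteri j (fun _ acc => acc + acc) 1 = 2 ^ j.
Proof. by elim: j => //= j ->; rewrite expnS mul2n addnn. Qed.

Section Correct.
Variables (k : nat) (P N : seq (k.-tuple rat)) (G : grammar k).
Local Notation n := (nonterms G).
Local Notation w := (input_word P N G).
Local Notation q := (input_rats P N).
Local Notation W := (size w).
Local Notation m := (size P + size N).
(* Without examples every formula is consistent, and a single order type
   suffices; this keeps the running time linear in the size of the grammar. *)
Let d : nat := if m != 0 then k else 0.
Local Notation T := (d ^ d).
Local Notation D := (2 ^ T).

Lemma accepts_iff (f : formula k) :
  accepts q d T m (size P) (vals d T f) <-> consistent P N f.
Proof.
rewrite /d; case: (eqVneq m 0) => [m0|m0] /=; last exact: accepts_consistent.
rewrite m0; split=> // _.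
by case: (P) (N) m0 => [|? ?] [|? ?].
Qed.

Lemma input_at : at_pos w 6 (prods_code (prods G)).
Proof. by []. Qed.

Lemma input_size : 6 + size (prods_code (prods G)) = W.
Proof. by []. Qed.

Lemma word_size_le : W <= 6 * grammar_size G.
Proof.
rewrite -input_size /grammar_size mulnDr.
have n0 := nonterms_gt0 G.
suff : size (prods_code (prods G)) <= 3 * \sum_(p <- prods G) (tree_size p.2).+1 by lia.
exact: prods_code_size.
Qed.

Definition h_input := set_reg (set_reg (set_reg (set_reg (init w) rP (size P)) rM m)
  rK d) rPos 6.
Definition h_types := set_reg h_input rT T.
Definition h_values := set_reg h_types rD D.
Definition h_facts := set_reg h_values rF ((W + n) * D).

Lemma sem_input : sem q sInput (init w) = h_input.
Proof. by rewrite /sInput !sem_sq !sem_asg. Qed.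

Lemma sem_types : sem q sTypes h_input = h_types.
Proof.
rewrite /sTypes sem_asg; congr set_reg.
rewrite [LHS]/= (eq_iteri (f' := fun _ acc => acc * d)); last first.
  by move=> i acc; rewrite (@eval_mulK q h_input d).
exact: iteri_mul.
Qed.

Lemma sem_values : sem q sValues h_types = h_values.
Proof.
rewrite /sValues sem_asg; congr set_reg; rewrite [LHS]/=.
exact: iteri_double.
Qed.

Lemma sem_facts : sem q sFacts h_values = h_facts.
Proof.
rewrite /sFacts sem_asg; congr set_reg; rewrite [LHS]/=.
elim: D => [|j /= ->]; first by rewrite muln0.
by rewrite mulnS addnC.
Qed.

Lemma types_le : T <= (m * k ^ k).+1.
Proof.
rewrite /d; case: (eqVneq m 0) => [->|m0] //=.
have : 0 < m by lia.
by move: (k ^ k) => x; nia.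
Qed.

Lemma stages_bounded : stages_within q
  (count_bound (2 ^ (m * k ^ k).+1) (7 * grammar_size G)) stages (init w).
Proof.
set B := 2 ^ _; have BT : D <= B by rewrite leq_pexp2l // types_le.
have TB : T <= B by apply: leq_trans BT; apply: ltnW; apply: ltn_expl.
have dB : d <= B.
  apply: leq_trans TB; case: (d) => // j.
  by rewrite -{1}[j.+1]expn1 leq_pexp2l.
have mB : m <= B.
  apply: ltnW; apply: leq_ltn_trans (ltn_expl _ (ltnSn 1)).
  apply: leqW; apply: leq_pmulr; rewrite expn_gt0; case: (k) => //.
have B0 : 0 < B by rewrite expn_gt0.
have WZ := word_size_le.
have nG : n <= grammar_size G by rewrite /grammar_size leq_addr.
have WB : W <= B * (7 * grammar_size G) by nia.
have FB : (W + n) * D <= B * (7 * grammar_size G).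
  by rewrite mulnC leq_mul //; lia.
rewrite /stages.
apply: (@stages_within_cons _ _ ([::], sInput) _ _ _ _ sem_input); first by [].
apply: (@stages_within_cons _ _ ([:: rK], sTypes) _ _ _ _ sem_types);
  first by move=> x; rewrite inE => /eqP->.
apply: (@stages_within_cons _ _ ([:: rT], sValues) _ _ _ _ sem_values);
  first by move=> x; rewrite inE => /eqP->.
apply: (@stages_within_cons _ _ ([:: rD], sFacts) _ _ _ _ sem_facts);
  first by move=> x; rewrite inE => /eqP->.
apply: (@stages_within_cons _ _ (_, _) _ _ _ _ (erefl _)).
  move=> x; rewrite !inE.
  case/predU1P => [->|]; first exact: WB.
  case/predU1P => [->|]; first exact: dB.
  case/predU1P => [->|]; first exact: mB.
  case/predU1P => [->|]; first exact: TB.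
  by case/predU1P => [->|/eqP->]; [exact: BT | exact: FB].
apply: (@stages_within_cons _ _ (_, _) _ _ _ _ (erefl _)); last by [].
by move=> x; rewrite inE => /eqP->; rewrite sem_keepr.
Qed.

Lemma search_correct :
  correct_answer P N G (output (run_stages q stages (init w))).
Proof.
rewrite /stages !run_stages_cons sem_input sem_types sem_values sem_facts.
rewrite /sSearch 3!sem_sq.
have hd : d = 0 \/ d = k by rewrite /d; case: ifP; [right|left].
pose c0 := Config (fun=> 0) (fun=> 0) (nxf w [::]) [::] 6.
have [par [lst [run K1 K2 _]]] :=
  parse_prods (fun=> 0) (fun=> 0) [::] input_at input_size.
rewrite cats0 in run; set ls := rev _ in run.
pose nx := nxf w ls; pose pc := Config par lst nx [::] W.
set h1 := sem q (For rW rI sParse) _.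
have [_ _ _ _ [A0 A2 A3 A4]] : parser_state w pc h1.
  have runW : iter W (pstep w) c0 = pc.
    have le : prods_steps (prods G) <= W.
      by rewrite -input_size (leq_trans (prods_steps_le _)) // leq_addl.
    by rewrite -(subnK le) iterD run iter_fixed // /pstep /= ltnn.
  pose R j h := parser_state w (iter j (pstep w) c0) h.
  rewrite -runW; apply: (@sem_for q rW rI sParse h_facts R) => //.
  by move=> j h Rj _; apply: sem_parse.
have I1 : @search_inv k G w d T m (size P) par lst nx [::] [::] h1.
  split=> //; try by rewrite sem_keepr.
    by move=> x v _; rewrite sem_keepa.
  by case.
have [fs2 [Q2 [I2 At2]]] :=
  @atoms_loop k G q w d m (size P) par lst nx input_at input_size K1 K2 h1 hd I1.
set h2 := sem q (For rW rI sAtom) h1 in I2 *.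
have h2F : reg h2 rF = (W + n) * D by rewrite !sem_keepr.
have h2H : reg h2 rHd = 0 by rewrite !sem_keepr.
have [fs3 [Q3 [I3 At3 C3]]] := @main_loop k G q w d m (size P) par lst nx
  input_at input_size K1 K2 (fun _ => erefl) fs2 Q2 h2 I2 h2H h2F At2.
set h3 := sem q (For rF rI sItem) h2 in I3 *.
have h3F : reg h3 rFound = 0 by rewrite !sem_keepr.
have [I4 none found] := @find_correct k G q w d m (size P) par lst nx
  input_at input_size K1 (fun _ => erefl) fs3 Q3 h3 (erefl _) I3 At3 C3 h3F.
have h4F : reg (sem q sFind h3) rF = (W + n) * D by rewrite !sem_keepr.
have fsl l : reg (sem q sFind h3) rFound = l.+1 -> l < size fs3.
  by move=> E; have [f [fl _ _]] := found l E; apply: onth_size fl.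
rewrite -[run_stages _ _ _]/(sem q sOut (sem q sFind h3))
  (out_spec q input_size I4 h4F fsl).
case E : (reg _ rFound) => [|l]; last first.
  have [f [fl df acc]] := found l E; left.
  exists f; eexists; split; [reflexivity| |by apply/language_derives|].
    exists (take l fs3); rewrite -(take_onth fl).
    by apply: (lines_take input_size I4); apply: onth_size fl.
  by apply/accepts_iff.
right; split=> // f /language_derives df /accepts_iff acc.
by have := none E f df; rewrite acc.
Qed.

End Correct.

Theorem theorem8p1 :
  exists (c : prog) (p : {poly nat}) (C : nat),
    forall (k : nat) (P N : seq (k.-tuple rat)) (G : grammar k),
      uniq P -> uniq N ->
      let m := size P + size N in
      exists (t : nat) (out : seq nat),
        [/\ runs c (input_word P N G) (input_rats P N) t out,
            t <= C * (2 ^ (p.[(m * k ^ k)%N])%R * grammar_size G)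
          & correct_answer P N G out].
Proof.
exists (compile stages), (Poly [:: 0; degree]).
exists ((stages_size + 1) * 2 ^ degree * 7) => k P N G _ _ m.
have ag : agree nregs (init (input_word P N G)) (init (input_word P N G)) by [].
have [t [s [ex tle [Hr Ha]]]] :=
  compile_correct stages_wf (stages_bounded P N G) ag.
exists t, (output (run_stages (input_rats P N) stages (init (input_word P N G)))).
split; last exact: search_correct.
  by exists s; split=> //; rewrite /output Hr // Ha.
apply: leq_trans tle _; apply: leq_trans (stages_cost _ _) _.
- by rewrite expn_gt0.
- by rewrite muln_gt0 /grammar_size ltn_addr // nonterms_gt0.
rewrite horner_Poly.
have -> : horner_rec [:: 0; degree] (m * k ^ k)%N = (degree * (m * k ^ k))%N.
  by rewrite /= GRing.mul0r GRing.add0r GRing.addr0.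
rewrite -expnM mulSn expnD -/m [_ * degree]mulnC.
move: (2 ^ (degree * _)) (2 ^ degree) => a b.
by move: (stages_size + 1) (grammar_size G) => c g; lia.
Qed.
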